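(* Assume $c_i^0>0$ for all $i$. For any solution to the fully discrete space-time scheme (S1)–(S3) described in the context, the following three properties hold, where $c_{h,i}^n:=\exp(u_{h,i}^n)$ and $\mu_{h,i}^n:=u_{h,i}^n+\frac{z_ie}{k_BT}\phi_h^n$: (a) for each $i$, $$\int_\Omega\exp(u_{h,i}^{n,-})\,dx=\int_\Omega\exp(u_{h,i}^{n-1,-})\,dx;$$ (b) for each $i$, $c_{h,i}^n=\exp(u_{h,i}^n)>0$; (c) $$E_h^n-E_h^{n-1}=-\mathsf{Diss}_h^n-N_{1,h}^n-N_{2,h}^n,$$ where the discrete energy is $$E_h^n:=\int_\Omega\Big(\sum_{i=1}^NU(u_{h,i}^{n,-})+\frac{\epsilon}{2k_BT}|\nabla\phi_h^{n,-}|^2\Big)\,dx,\qquad U(\eta):=\exp(\eta)(\eta-1),$$ the (non-negative) physical dissipation term is $$\mathsf{Diss}_h^n:=\int_{I^n}\int_\Omega\sum_{i=1}^ND_ic_{h,i}^n|\nabla\mu_{h,i}^n|^2\,dx\,dt,$$ and the (non-negative) numerical dissipation terms for the temporal discretization are $$N_{1,h}^n:=\int_\Omega\sum_{i=1}^N\frac12\exp(\xi_{h,i}^n)\,(u_{h,i}^{n-1,-}-u_{h,i}^{n,+})^2\,dx,\qquad N_{2,h}^n:=\int_\Omega\frac{\epsilon}{2k_BT}\big|\nabla(\phi_h^{n,+}-\phi_h^{n-1,-})\big|^2\,dx,$$ where $\xi_{h,i}^n$ is a function between $u_{h,i}^{n,+}$ and $u_{h,i}^{n-1,-}$ for each $i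$.
   Context: Setting: $\Omega\subset\mathbb{R}^d$, $d=1,2,3$, is a bounded domain with a conforming simplicial triangulation $\mathcal{T}_h=\{K\}$. $N$ is the number of charged particle species. For $i=1,\dots,N$, $D_i$ is the diffusion constant, $z_i$ the valence and $c_i^0=c_i^0(x)$ the initial density of species $i$; $e$ is the unit charge, $k_B$ the Boltzmann constant, $T$ the absolute temperature, $\epsilon$ the electric permittivity, and $\rho_0$ the permanent (fixed) charge density. The quantities $D_i,e,k_B,T,\epsilon$ are positive, and $\rho_0,z_i,k_B,T,\epsilon$ are independent of time. The Poisson-Nernst-Planck equations in log-density (entropy) variables $u_i=\log(c_i)$ are $$\partial_t\exp(u_i)=\nabla\cdot\Big(D_i\exp(u_i)\big(\nabla u_i+\tfrac{z_ie}{k_BT}\nabla\phi\big)\Big),\qquad -\nabla\cdot(\epsilon\nabla\phi)=\rho_0+\sum_{i=1}^Nz_ie\exp(u_i),$$ with homogeneous Neumann boundary conditions (for the particle fluxes and for $\phi$) and initial condition $u_i(0,x)=\log(c_i^0(x))$. Spaces: let $k\ge1$ and $m\ge0$ be integers; $\mathcal{P}_k(K)$ and $\mathcal{P}_m(I)$ denote polynomials of degree at most $k$ on $K$ and at most $m$ on the interval $I$, respectively. Let $$V_h^k:=\{v\in H^1(\Omega):\ v|_K\in\mathcal{P}_k(K)\ \forall K\in\mathcal{T}_h\}.$$ At the $n$-th time level $t^n$, $\Delta t^n$ is the time step size and $I^n=[t^n,t^{n+1})$ is the update interval, with $t^{n+1}=t^n+\Delta t^n$. Define $$\mathsf{V}_h^{k,m,n}:=\{v\in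 H^1(\Omega\times I^n):\ v|_{K\times I^n}\in\mathcal{P}_k(K)\otimes\mathcal{P}_m(I^n)\ \ \forall K\in\mathcal{T}_h\},$$ and $\mathsf{V}_h^{k,m-1,n}$ likewise with $m$ replaced by $m-1$ (the zero space if $m=0$). Traces: $\xi^{n,-}:=\lim_{t\nearrow t^{n+1}}\xi^n(t,x)$ and $\xi^{n,+}:=\lim_{t\searrow t^n}\xi^n(t,x)$. Thus a superscript $n-1,-$ denotes the trace at $t^n$ of the solution on the preceding slab $\Omega\times I^{n-1}$; for the first slab, $u_{h,i}^{0,-}$ is the initial datum $\log(c_i^0)$. Fully discrete scheme: for any $n=1,2,\dots$, find $u_{h,i}^n\in\mathsf{V}_h^{k,m,n}$ ($i=1,\dots,N$) and $\phi_h^n\in\mathsf{V}_h^{k,m,n}$ with $\int_\Omega\phi_h^{n,-}\,dx=0$ such that (S1) for all $i$ and all $v_i\in\mathsf{V}_h^{k,m,n}$, $$\int_{I^n}\int_\Omega\frac{\partial\exp(u_{h,i}^n)}{\partial t}v_i\,dx\,dt+\int_\Omega\big(\exp(u_{h,i}^{n,+})-\exp(u_{h,i}^{n-1,-})\big)v_i^{n,+}\,dx+\int_{I^n}\int_\Omega D_i\exp(u_{h,i}^n)\Big(\nabla u_{h,i}^n+\frac{z_ie}{k_BT}\nabla\phi_h^n\Big)\cdot\nabla v_i\,dx\,dt=0;$$ (S2) for all $\psi\in\mathsf{V}_h^{k,m-1,n}$, $$\int_{I^n}\int_\Omega\epsilon\nabla\phi_h^n\cdot\nabla\psi\,dx\,dt-\int_{I^n}\int_\Omega\Big(\rho_0+\sum_{i=1}^Nz_ie\exp(u_{h,i}^n)\Big)\psi\,dx\,dt=0;$$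 (S3) for all $\psi\in V_h^k$, $$\int_\Omega\epsilon\nabla\phi_h^{n,-}\cdot\nabla\psi\,dx-\int_\Omega\Big(\rho_0+\sum_{i=1}^Nz_ie\exp(u_{h,i}^{n,-})\Big)\psi\,dx=0.$$ *)

(* Defs.v *)
From HB Require Import structures.
From mathcomp Require Import all_boot all_order all_algebra.
From mathcomp Require Import all_classical all_reals all_analysis.
Set Implicit Arguments.
Unset Strict Implicit.
Unset Printing Implicit Defensive.
Import Order.TTheory GRing.Theory Num.Theory.
Import numFieldNormedType.Exports.
Local Open Scope classical_set_scope.
Local Open Scope ring_scope.

(* The Borel sigma-algebra of R^n, as the one generated by the coordinates (the
   library does the same for tuples but has no measurable structure on 'rV). *)
Section measurable_rV.
Context {R : realType} {n : nat}.

Definition rV_coord (i : 'I_n) (x : 'rV[R]_n) : R := x 0 i.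

Let rV_set0 : g_sigma_preimage rV_coord set0.
Proof. exact: sigma_algebra0. Qed.
Let rV_setC A : g_sigma_preimage rV_coord A -> g_sigma_preimage rV_coord (~` A).
Proof. exact: sigma_algebraC. Qed.
Let rV_bigcup (F : _^nat) : (forall i, g_sigma_preimage rV_coord (F i)) ->
  g_sigma_preimage rV_coord (\bigcup_i F i).
Proof. exact: sigma_algebra_bigcup. Qed.

HB.instance Definition _ := @isMeasurable.Build default_measure_display
  'rV[R]_n (g_sigma_preimage rV_coord) rV_set0 rV_setC rV_bigcup.

Lemma measurable_rV_coord i : measurable_fun [set: 'rV[R]_n] (rV_coord i).
Proof.
move=> _ Y mY; rewrite setTI; apply: sub_sigma_algebra => /=.
rewrite -bigcup_seq/=; exists i => /=; first by rewrite mem_index_enum.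
by exists Y => //; rewrite setTI.
Qed.

Lemma measurable_fun_rVP d (T : measurableType d) (f : T -> 'rV[R]_n) :
  (forall i, measurable_fun [set: T] (rV_coord i \o f)) ->
  measurable_fun [set: T] f.
Proof.
move=> mf.
have : g_sigma_preimage (fun i => rV_coord i \o f) `<=` measurable.
  apply: smallest_sub; first exact: sigma_algebra_measurable.
  rewrite -bigcup_seq; apply: bigcup_sub => i _ A [B mB <-]; exact: mf.
rewrite g_sigma_preimage_comp => H _ A mA; apply: H; by exists A.
Qed.

End measurable_rV.


Section lebesgue_rV_succ.
Context {R : realType} {n : nat}.
Variable m : {sigma_finite_measure set 'rV[R]_n -> \bar R}.

Definition rV_cons (p : measurableTypeR R * 'rV[R]_n) : 'rV[R]_n.+1 :=
  row_mx (p.1)%:M p.2 : 'rV[R]_(1 + n).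

Lemma rV_consE0 p : rV_coord ord0 (rV_cons p) = p.1.
Proof.
rewrite /rV_coord /rV_cons mxE; case: splitP => j //= _.
by rewrite ord1 mxE eqxx.
Qed.

Lemma rV_consES p (j : 'I_n) :
  rV_coord (lift ord0 j) (rV_cons p) = rV_coord j p.2.
Proof.
rewrite /rV_coord /rV_cons mxE; case: splitP => l /= jl; first by rewrite ord1 in jl.
by congr (p.2 _ _); apply/val_inj/eqP; rewrite -(eqn_add2l 1) -jl.
Qed.

Lemma measurable_rV_cons : measurable_fun [set: measurableTypeR R * 'rV[R]_n] rV_cons.
Proof.
apply: measurable_fun_rVP => i; have [j ->|->] := unliftP ord0 i.
  rewrite (_ : _ \o _ = rV_coord j \o snd); last first.
    by apply/funext => p /=; rewrite rV_consES.
  by apply: measurableT_comp => //; exact: measurable_rV_coord.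
rewrite (_ : _ \o _ = fst) //.
by apply/funext => p /=; rewrite rV_consE0.
Qed.

Definition lebesgue_rV_succ : set 'rV[R]_n.+1 -> \bar R :=
  pushforward (@lebesgue_measure R \x m)%E rV_cons.

Let succ0 : lebesgue_rV_succ set0 = 0%E.
Proof. by rewrite /lebesgue_rV_succ /pushforward preimage_set0 measure0. Qed.

Let preim_meas A : measurable A -> measurable (rV_cons @^-1` A).
Proof. by move=> mA; rewrite -[X in measurable X]setTI; exact: measurable_rV_cons. Qed.

Let succ_ge0 A : (0 <= lebesgue_rV_succ A)%E.
Proof. rewrite /lebesgue_rV_succ /pushforward; set B := _ @^-1` _; exact: (measure_ge0 (@lebesgue_measure R \x m)%E B). Qed.

Let succ_sigma_additive : semi_sigma_additive lebesgue_rV_succ.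
Proof.
move=> F mF tF mUF; rewrite /lebesgue_rV_succ /pushforward preimage_bigcup.
apply: measure_semi_sigma_additive.
- by move=> k; exact: preim_meas.
- apply/trivIsetP => /= i j _ _ ij; rewrite -preimage_setI.
  by move/trivIsetP : tF => /(_ _ _ _ _ ij) ->//; rewrite preimage_set0.
- by rewrite -preimage_bigcup; exact: preim_meas.
Qed.

HB.instance Definition _ := isMeasure.Build _ _ _ lebesgue_rV_succ
  succ0 succ_ge0 succ_sigma_additive.

Let succ_sigma_finite : sigma_finite setT lebesgue_rV_succ.
Proof.
have /sigma_finiteP[F [TF ndF Foo]] := sigma_finiteT (@lebesgue_measure R).
have /sigma_finiteP[G [TG ndG Goo]] := sigma_finiteT m.
pose H k := (rV_coord ord0 @^-1` F k) `&`
  ((fun y : 'rV[R]_(1 + n) => rsubmx y) @^-1` G k) : set 'rV[R]_n.+1.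
have preH k : rV_cons @^-1` H k = F k `*` G k.
  by apply/seteqP; split=> -[a b]; rewrite /H /= rV_consE0 /rV_cons row_mxKr.
exists H.
  apply/seteqP; split=> // y _.
  have [i _ Fi] : (\bigcup_i F i) (rV_coord ord0 y) by rewrite -TF.
  have [j _ Gj] : (\bigcup_i G i) (rsubmx (y : 'rV_(1 + n))) by rewrite -TG.
  exists (maxn i j) => //; split.
    exact: (subsetPset _ _ (ndF _ _ (leq_maxl i j))).
  exact: (subsetPset _ _ (ndG _ _ (leq_maxr i j))).
move=> k; have [mF Fk] := Foo k; have [mG Gk] := Goo k; split.
  apply: measurableI; first by rewrite -[X in measurable X]setTI; exact: measurable_rV_coord.
  rewrite -[X in measurable X]setTI.
  have mr : measurable_fun [set: 'rV[R]_n.+1] (fun y : 'rV[R]_(1 + n) => rsubmx y : 'rV[R]_n).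
    apply: measurable_fun_rVP => i.
    rewrite (_ : _ \o _ = rV_coord (lift ord0 i)); first exact: measurable_rV_coord.
    apply/funext => y; rewrite /rV_coord /= mxE; congr (y _ _).
    exact/val_inj.
  exact: mr.
rewrite /lebesgue_rV_succ /pushforward preH.
by rewrite product_measure1E// lte_mul_pinfty// ge0_fin_numE.
Qed.

HB.instance Definition _ := Measure_isSigmaFinite.Build _ _ _ lebesgue_rV_succ
  succ_sigma_finite.

End lebesgue_rV_succ.

(* Lebesgue measure on R^n, as the n-fold product of the Lebesgue measure on R. *)
Fixpoint leb (R : realType) (n : nat) :
    {sigma_finite_measure set 'rV[R]_n -> \bar R} :=
  if n is n'.+1 then lebesgue_rV_succ (leb R n') else dirac (0 : 'rV[R]_0).

Section gradient.
Context {R : realType} {d : nat}.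

Definition partial (j : 'I_d) (f : 'rV[R]_d -> R) (x : 'rV[R]_d) : R :=
  'D_(delta_mx 0 j) f x.

Definition grad (f : 'rV[R]_d -> R) (x : 'rV[R]_d) : 'rV[R]_d :=
  \row_j partial j f x.

Definition dot (a b : 'rV[R]_d) : R := \sum_j a 0 j * b 0 j.

(* squared Euclidean norm; the library norm `|a| on 'rV is the sup norm *)
Definition sqnorm (a : 'rV[R]_d) : R := dot a a.

End gradient.

Section sobolev.
Context {R : realType} {D : nat}.
Implicit Types (O : set 'rV[R]_D) (v w chi : 'rV[R]_D -> R).

Definition square_integrable O v :=
  measurable_fun O v /\ (leb R D).-integrable O (fun x => (v x ^+ 2)%:E).

(* C^1 functions with compact support in O; they define the same weak first
   derivatives as the C^infinity ones *)
Definition test_function O chi :=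
  [/\ continuous chi,
      forall j x, derivable chi x (delta_mx 0 j),
      forall j, continuous (partial j chi) &
      exists2 K, compact K /\ K `<=` O & forall x, ~ K x -> chi x = 0].

Definition weak_partial O (j : 'I_D) v w :=
  forall chi, test_function O chi ->
    \int[leb R D]_(x in O) (v x * partial j chi x) =
    - \int[leb R D]_(x in O) (w x * chi x).

Definition H1 O v :=
  square_integrable O v /\
  forall j, exists2 w, square_integrable O w & weak_partial O j v w.

End sobolev.

Section triangulation.
Context {R : realType} {d : nat}.

Definition bounded_domain (Omega : set 'rV[R]_d) :=
  [/\ open Omega, connected Omega, bounded_set Omega & Omega !=set0].

(* the face of the simplex with vertices p spanned by the vertices in A;
   the empty set when A is empty *)
Definition face (p : 'I_d.+1 -> 'rV[R]_d) (A : {set 'I_d.+1}) : set 'rV[R]_d :=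
  [set x | exists2 l : 'I_d.+1 -> R,
     [/\ forall j, 0 <= l j, forall j, j \notin A -> l j = 0 &
         \sum_j l j = 1] &
     x = \sum_j l j *: p j].

Definition simplex (p : 'I_d.+1 -> 'rV[R]_d) : set 'rV[R]_d := face p [set: 'I_d.+1].

Definition affinely_independent (p : 'I_d.+1 -> 'rV[R]_d) : bool :=
  row_free (\matrix_(j < d) (p (lift ord0 j) - p ord0)).

(* M simplices, the a-th one having vertices P a 0, ..., P a d *)
Definition conforming_triangulation (Omega : set 'rV[R]_d) (M : nat)
    (P : 'I_M -> 'I_d.+1 -> 'rV[R]_d) :=
  [/\ forall a, affinely_independent (P a),
      injective (fun a => simplex (P a)),
      closure Omega = \bigcup_a simplex (P a),
      forall a, interior (simplex (P a)) `<=` Omega &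
      forall a b, a != b -> exists A B : {set 'I_d.+1},
        simplex (P a) `&` simplex (P b) = face (P a) A /\
        face (P a) A = face (P b) B].

End triangulation.

Section finite_elements.
Context {R : realType} {d : nat}.

(* polynomial functions on R^d of total degree at most k *)
Definition poly_le (k : nat) (p : 'rV[R]_d -> R) :=
  exists a : {ffun 'I_d -> 'I_k.+1} -> R, forall x,
    p x = \sum_(al : {ffun 'I_d -> 'I_k.+1} | (\sum_i al i <= k)%N)
            a al * \prod_i x 0 i ^+ al i.

Variables (Omega : set 'rV[R]_d) (M : nat) (P : 'I_M -> 'I_d.+1 -> 'rV[R]_d).

(* Elements of H^1 are classes modulo null sets: a representative is asked to be
   polynomial in the interior of each element, and is arbitrary on the (null)
   mesh skeleton; [grad] then is the elementwise gradient, which is the weak one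
   almost everywhere. *)
Definition fe_space (k : nat) (v : 'rV[R]_d -> R) :=
  H1 Omega v /\
  forall a, exists2 p, poly_le k p &
    forall x, interior (simplex (P a)) x -> v x = p x.

(* Omega x ]t0, t1[ as a subset of R^(1 + d), time being the first coordinate *)
Definition cylinder (t0 t1 : R) : set 'rV[R]_(1 + d) :=
  [set y | t0 < lsubmx y 0 0 < t1 /\ Omega (rsubmx y)].

(* Space-time functions in H^1(Omega x [t0, t1[) that are in P_k (x) P_(r-1) on
   each slab element: r counts the powers of t, so that V_h^{k,m,n} is r = m+1,
   V_h^{k,m-1,n} is r = m, and r = 0 gives the zero space. *)
Definition st_space (k r : nat) (t0 t1 : R) (v : R -> 'rV[R]_d -> R) :=
  H1 (cylinder t0 t1) (fun y : 'rV[R]_(1 + d) => v (lsubmx y 0 0) (rsubmx y)) /\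
  forall a, exists2 c : 'I_r -> 'rV[R]_d -> R, forall j, poly_le k (c j) &
    forall t x, t0 <= t < t1 -> interior (simplex (P a)) x ->
      v t x = \sum_(j < r) c j x * t ^+ j.

End finite_elements.

Section traces.
Context {R : realType} {d : nat}.

Definition trace_minus (t1 : R) (v : R -> 'rV[R]_d -> R) (x : 'rV[R]_d) : R :=
  lim (v s x @[s --> t1^'-]).

Definition trace_plus (t0 : R) (v : R -> 'rV[R]_d -> R) (x : 'rV[R]_d) : R :=
  lim (v s x @[s --> t0^'+]).

End traces.

Record pnp_data (R : realType) (d N : nat) := PnpData {
  diffusion : 'I_N -> R;
  valence : 'I_N -> R;
  unit_charge : R;
  boltzmann : R;
  temperature : R;
  permittivity : R;
  fixed_charge : 'rV[R]_d -> R;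
  init_density : 'I_N -> 'rV[R]_d -> R }.

Section scheme.
Context {R : realType} {d N : nat}.
Variables (Omega : set 'rV[R]_d) (M : nat) (P : 'I_M -> 'I_d.+1 -> 'rV[R]_d).
Variable dat : pnp_data R d N.
Variables (k m : nat) (t : nat -> R).

Local Notation D := (diffusion dat).
Local Notation z := (valence dat).
Local Notation e := (unit_charge dat).
Local Notation kB := (boltzmann dat).
Local Notation T := (temperature dat).
Local Notation eps := (permittivity dat).
Local Notation rho0 := (fixed_charge dat).
Local Notation c0 := (init_density dat).
Local Notation "\int_Omega_ x F" := (\int[leb R d]_(x in Omega) F)
  (at level 36, x name, F at level 36).
Local Notation "\int_I n , s F" :=
  (\int[@lebesgue_measure R]_(s in `[t n, t n.+1[) F)
  (at level 36, n at level 0, s name, F at level 36).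

(* [rho0] and [c0] are only assumed regular enough for the integrals of the
   scheme and of the energy of the initial datum to be finite. *)
Definition pnp_admissible :=
  [/\ [/\ forall i, 0 < D i, 0 < e, 0 < kB, 0 < T & 0 < eps],
      (leb R d).-integrable Omega (EFin \o rho0),
      forall i, (leb R d).-integrable Omega (EFin \o c0 i) &
      forall i, (leb R d).-integrable Omega (fun x => (c0 i x * ln (c0 i x))%:E)].

Definition charge_density (w : 'I_N -> 'rV[R]_d -> R) (x : 'rV[R]_d) : R :=
  rho0 x + \sum_i z i * e * expR (w i x).

Definition discrete_poisson (w : 'I_N -> 'rV[R]_d -> R) (ph : 'rV[R]_d -> R) :=
  forall psi, fe_space Omega P k psi ->
    \int_Omega_ x (eps * dot (grad ph x) (grad psi x)) -
    \int_Omega_ x (charge_density w x * psi x) = 0.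

(* The potential at the initial time is not part of the unknowns of the scheme:
   it is the solution of the discrete Poisson problem for the initial datum. *)
Definition initial_potential (phi0 : 'rV[R]_d -> R) :=
  [/\ fe_space Omega P k phi0, \int_Omega_ x phi0 x = 0 &
      discrete_poisson (fun i x => ln (c0 i x)) phi0].

(* The slab of index n >= 1 is Omega x [t n, t n.+1[; index 0 only refers to the
   initial data. *)
Section unknowns.
Variables (u : nat -> 'I_N -> R -> 'rV[R]_d -> R) (phi : nat -> R -> 'rV[R]_d -> R).

Definition u_minus (n : nat) (i : 'I_N) : 'rV[R]_d -> R :=
  if n is 0%N then fun x => ln (c0 i x) else trace_minus (t n.+1) (u n i).

Definition u_plus (n : nat) (i : 'I_N) : 'rV[R]_d -> R := trace_plus (t n) (u n i).

Definition conc (n : nat) (i : 'I_N) (s : R) (x : 'rV[R]_d) : R :=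
  expR (u n i s x).

Definition chem_pot (n : nat) (i : 'I_N) (s : R) (x : 'rV[R]_d) : R :=
  u n i s x + z i * e / (kB * T) * phi n s x.

Definition scheme_S1 (n : nat) :=
  forall (i : 'I_N) v, st_space Omega P k m.+1 (t n) (t n.+1) v ->
    \int_I n, s (\int_Omega_ x (derive1 (fun r => expR (u n i r x)) s * v s x)) +
    \int_Omega_ x ((expR (u_plus n i x) - expR (u_minus n.-1 i x)) *
                   trace_plus (t n) v x) +
    \int_I n, s (\int_Omega_ x (D i * expR (u n i s x) *
       dot (grad (u n i s) x + (z i * e / (kB * T)) *: grad (phi n s) x)
           (grad (v s) x))) = 0.

Definition scheme_S2 (n : nat) :=
  forall psi, st_space Omega P k m (t n) (t n.+1) psi ->
    \int_I n, s (\int_Omega_ x (eps * dot (grad (phi n s) x) (grad (psi s) x))) -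
    \int_I n, s (\int_Omega_ x (charge_density (fun i => u n i s) x * psi s x)) = 0.

Definition scheme_S3 (n : nat) :=
  discrete_poisson (u_minus n) (trace_minus (t n.+1) (phi n)).

Definition scheme_solution := forall n, (1 <= n)%N ->
  [/\ forall i, st_space Omega P k m.+1 (t n) (t n.+1) (u n i),
      st_space Omega P k m.+1 (t n) (t n.+1) (phi n),
      \int_Omega_ x trace_minus (t n.+1) (phi n) x = 0 &
      [/\ scheme_S1 n, scheme_S2 n & scheme_S3 n]].

Definition entropy (eta : R) : R := expR eta * (eta - 1).

Definition dissipation (n : nat) : R :=
  \int_I n, s (\int_Omega_ x
    (\sum_i D i * conc n i s x * sqnorm (grad (chem_pot n i s) x))).

Definition num_diss1_density (n : nat) (xi : 'I_N -> 'rV[R]_d -> R)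
    (x : 'rV[R]_d) : R :=
  \sum_i 2^-1 * expR (xi i x) * (u_minus n.-1 i x - u_plus n i x) ^+ 2.

Definition num_diss1 (n : nat) (xi : 'I_N -> 'rV[R]_d -> R) : R :=
  \int_Omega_ x num_diss1_density n xi x.

Section energy.
Variable phi0 : 'rV[R]_d -> R.

Definition phi_minus (n : nat) : 'rV[R]_d -> R :=
  if n is 0%N then phi0 else trace_minus (t n.+1) (phi n).

Definition energy (n : nat) : R :=
  \int_Omega_ x (\sum_i entropy (u_minus n i x) +
                 eps / (2 * kB * T) * sqnorm (grad (phi_minus n) x)).

Definition num_diss2 (n : nat) : R :=
  \int_Omega_ x (eps / (2 * kB * T) *
    sqnorm (grad (fun y => trace_plus (t n) (phi n) y - phi_minus n.-1 y) x)).

End energy.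

(* [xi] is a measurable function between u_plus n and u_minus n.-1 almost
   everywhere, for which the integral of the first numerical dissipation is
   finite (so that [num_diss1] is an actual integral). *)
Definition intermediate (n : nat) (xi : 'I_N -> 'rV[R]_d -> R) :=
  [/\ forall i, measurable_fun Omega (xi i),
      forall i, {ae leb R d, forall x, Omega x ->
        Num.min (u_plus n i x) (u_minus n.-1 i x) <= xi i x
          <= Num.max (u_plus n i x) (u_minus n.-1 i x)} &
      (\int[leb R d]_(x in Omega) (num_diss1_density n xi x)%:E < +oo)%E].

End unknowns.
End scheme.

(* Main.v *)
Require Import Defs.
From mathcomp Require Import all_boot all_order all_algebra.
From mathcomp Require Import all_classical all_reals all_analysis.
From mathcomp Require Import measurable_realfun ring lra.
Set Implicit Arguments.
Unset Strict Implicit.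
Unset Printing Implicit Defensive.
Import Order.TTheory GRing.Theory Num.Theory.
Import numFieldNormedType.Exports.
Local Open Scope classical_set_scope.
Local Open Scope ring_scope.

(** The balance comes from testing the scheme with the variables themselves.
    The test function 1 in the transport equation gives the conservation of mass
    (mass_conservation): the integral in time of the derivative of exp u and the
    jump add up to the difference of the traces. Positivity is that of exp.

    For the energy, write w for the trace of u left by the preceding slab and
    kappa for z e / (kB T). The transport equation is tested with u and with
    kappa phi; the two flux terms add up to the dissipation, the gradient of the
    chemical potential being grad u + kappa grad phi.

    - With u, the integrand exp(u) u' u is the time derivative of U(u), and the
      jump (exp u - exp w) u at the beginning of the slab is U(u) - U(w) plus
      exp u - exp w - exp(w) (u - w) (entropy_jump). By Taylor's formula the
      latter is exp(xi) (w - u)^2 / 2: this is the first numerical dissipation.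
      The intermediate value is given by an explicit formula, hence measurable
      in x (exp_mean, exp_mean_between).
    - With phi, integration by parts in time replaces the derivative of exp u by
      that of phi (by_parts). The charges that remain are eliminated by means of
      three instances of the Poisson equation: in the slab against the time
      derivative of phi, at its end against phi, and just before its beginning
      against the trace of phi after the jump (poisson_slab, poisson1,
      poisson0). At the first step the last one is the equation that defines the
      initial potential. What is left is a quadratic expression in the fields,
      and the polarization identity makes the squared jump of the field appear:
      this is the second numerical dissipation.

    That the test functions above are admissible is the analytic core. The
    discrete space consists of functions in H^1 of the space-time cylinder that
    are polynomials on each slab element; but the time derivative and the traces
    of such a function must again be discrete functions, in particular weakly
    differentiable across the elements. For this the function is written as a
    polynomial in t with coefficients in the finite element space in x
    (st_space_coefficients). Each coefficient is an average in time against a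
    smooth weight supported inside the time interval, dual to the monomials
    (dual_time_functions); and averaging in time preserves H^1
    (H1_time_average), because the product of the weight and a test function of
    space is a test function of space-time. Conversely such a polynomial is a
    discrete function (st_space_of_coefficients, H1_tensor).

    Finally, all integrals can be computed in the interiors of the elements,
    since the faces lie on hyperplanes, which are null (mesh_interior_ae); there
    every discrete function is a polynomial, bounded, with classical gradients. *)

(** * Integrals of functions known almost everywhere *)

Section ae_integral.
Local Open Scope ereal_scope.
Context d (T : measurableType d) (R : realType).
Variable mu : {measure set T -> \bar R}.
Import HBNNSimple.

Let le_ge0_integral_ae (f g : T -> \bar R) :
  (forall x, 0 <= f x) -> (forall x, 0 <= g x) ->
  {ae mu, forall x, f x = g x} -> \int[mu]_x f x <= \int[mu]_x g x.
Proof.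
move=> f0 g0 [N [mN N0 fgN]].
rewrite !ge0_integralTE//; apply/ge_ereal_sup => _ [h /= hf <-].
have mNC : measurable (~` N) by exact: measurableC.
apply: le_ereal_sup_tmp.
pose h' := mul_nnsfun h (indic_nnsfun R mNC).
exists (sintegral mu h').
  exists h' => // x; rewrite (_ : h' x = h x * \1_(~` N) x)%R// indicE.
  have [xN|xN] := boolP (x \in ~` N); last by rewrite mulr0.
  rewrite mulr1; apply: (le_trans (hf x)); move: xN; rewrite inE => xN.
  suff -> : f x = g x by [].
  by apply: contrapT => fg; apply: xN; apply: fgN.
rewrite -(integralT_nnsfun mu h) -(integralT_nnsfun mu h').
rewrite (@ge0_negligible_integral _ _ _ mu setT N (fun x => (h x)%:E))//; first last.
- by move=> x _; rewrite lee_fin; exact: fun_ge0.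
- exact: measurableT_comp.
- rewrite (@ge0_negligible_integral _ _ _ mu setT N (fun x => (h' x)%:E))//; first last.
  + by move=> x _; rewrite lee_fin; exact: fun_ge0.
  + exact: measurableT_comp.
  + rewrite le_eqVlt; apply/orP; left; apply/eqP; apply: eq_integral => x.
    rewrite inE => -[_ xN]; rewrite (_ : h' x = h x * \1_(~` N) x)%R// indicE.
    by rewrite mem_set// mulr1.
Qed.

(** The integral of a function that is not measurable is the supremum of the
    integrals of the simple functions below it, and this supremum does not see
    null sets either. Discrete functions are arbitrary on the mesh skeleton, so
    that the integrands of the scheme may well fail to be measurable there. *)
Lemma ae_eq_integral_nm (D1 D2 : set T) (f g : T -> \bar R) :
  {ae mu, forall x, (f \_ D1) x = (g \_ D2) x} ->
  \int[mu]_(x in D1) f x = \int[mu]_(x in D2) g x.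
Proof.
move=> fg; rewrite integral_mkcond [RHS]integral_mkcond.
rewrite integralE [RHS]integralE; congr (_ - _); apply/eqP; rewrite eq_le;
  apply/andP; split; apply: le_ge0_integral_ae => //; apply: filterS fg => x;
  by rewrite ?funeposE ?funenegE => ->.
Qed.

End ae_integral.

Section ae_Rintegral.
Context d (T : measurableType d) (R : realType).
Variable mu : {measure set T -> \bar R}.

Lemma ae_eq_Rintegral (D1 D2 : set T) (f g : T -> R) :
  {ae mu, forall x, (f \_ D1) x = (g \_ D2) x} ->
  \int[mu]_(x in D1) f x = \int[mu]_(x in D2) g x.
Proof.
move=> fg; congr fine; apply: ae_eq_integral_nm; apply: filterS fg => x.
by rewrite /patch; case: ifP => _; case: ifP => _ //; [move=> ->|move=> ->|move=> <-].
Qed.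

Lemma ae_eq_in_Rintegral (D : set T) (f g : T -> R) :
  {ae mu, forall x, D x -> f x = g x} ->
  \int[mu]_(x in D) f x = \int[mu]_(x in D) g x.
Proof.
move=> fg; apply: ae_eq_Rintegral; apply: filterS fg => x fg.
by rewrite /patch; case: ifPn => // /set_mem /fg.
Qed.

Lemma Rintegral0_eq (D : set T) (f : T -> R) :
  (forall x, D x -> f x = 0) -> \int[mu]_(x in D) f x = 0.
Proof.
by move=> f0; rewrite /Rintegral integral0_eq// => x Dx; rewrite f0.
Qed.

Lemma RintegralN (D : set T) (f : T -> R) :
  \int[mu]_(x in D) (- f x) = - \int[mu]_(x in D) f x.
Proof.
rewrite /Rintegral integralE [X in _ = - fine X]integralE.
rewrite (_ : (fun x => (- f x)%:E) = \- (fun x => (f x)%:E))%E; last first.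
  by apply/funext => x; rewrite EFinN.
rewrite funeposN funenegN.
have := @integral_ge0 _ _ _ mu D ((fun x => (f x)%:E)^\+)%E (fun x _ => funepos_ge0 _ x).
have := @integral_ge0 _ _ _ mu D ((fun x => (f x)%:E)^\-)%E (fun x _ => funeneg_ge0 _ x).
case: (integral mu D _) => [p||] //; case: (integral mu D _) => [q||] // _ _ /=;
  by rewrite ?opprB ?oppr0.
Qed.

Lemma Rintegral_sum (D : set T) (mD : measurable D) I (s : seq I) (P : pred I)
    (F : I -> T -> R) :
  (forall i, mu.-integrable D (EFin \o F i)) ->
  \int[mu]_(x in D) (\sum_(i <- s | P i) F i x) =
  \sum_(i <- s | P i) \int[mu]_(x in D) F i x.
Proof.
move=> iF; elim: s => [|i s IHs].
  rewrite big_nil; under eq_Rintegral do rewrite big_nil.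
  by rewrite Rintegral_cst// mul0r.
rewrite big_cons; under eq_Rintegral do rewrite big_cons.
case: ifP => // _; rewrite RintegralD// ?IHs//.
rewrite (_ : _ \o _ = fun x => (\sum_(i <- s | P i) (F i x)%:E)%E).
  by apply: (@integrable_sum _ _ _ mu D mD I s P (fun i x => (F i x)%:E)) => j _; exact: iF.
by apply/funext => x /=; rewrite sumEFin.
Qed.

End ae_Rintegral.

Section real_fubini.
Context d1 d2 (T1 : measurableType d1) (T2 : measurableType d2) (R : realType).
Variable m1 : {sigma_finite_measure set T1 -> \bar R}.
Variable m2 : {sigma_finite_measure set T2 -> \bar R}.
Variables (A : set T1) (B : set T2) (f : T1 -> T2 -> R).
Hypotheses (mA : measurable A) (mB : measurable B).
Hypothesis fi : (m1 \x m2)%E.-integrable (A `*` B) (fun z => (f z.1 z.2)%:E).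

Let F (z : T1 * T2) : \bar R := ((fun z => (f z.1 z.2)%:E) \_ (A `*` B)) z.
Let Fi : (m1 \x m2)%E.-integrable setT F.
Proof. by apply/(integrable_mkcond _ _).1 => //; exact: measurableX. Qed.

Let F1 x : A x -> (fun y => F (x, y)) = (fun y => (f x y)%:E) \_ B.
Proof.
move=> Ax; apply/funext => y; rewrite /F /patch.
by rewrite in_setX /= mem_set.
Qed.
Let F2 y : B y -> (fun x => F (x, y)) = (fun x => (f x y)%:E) \_ A.
Proof.
move=> By; apply/funext => x; rewrite /F /patch.
by rewrite in_setX /= (mem_set By) andbT.
Qed.
Let F1' x : ~ A x -> (fun y => F (x, y)) = cst 0%E.
Proof.
by move=> Ax; apply/funext => y; rewrite /F /patch in_setX /= memNset.
Qed.
Let F2' y : ~ B y -> (fun x => F (x, y)) = cst 0%E.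
Proof.
move=> By; apply/funext => x; rewrite /F /patch in_setX /= (memNset By).
by rewrite andbF.
Qed.

Lemma ae_integrable_section1 :
  {ae m1, forall x, A x -> m2.-integrable B (EFin \o f x)}.
Proof.
apply: filterS (ae_integrable1 Fi) => x /[swap] Ax.
by rewrite (F1 Ax) => /(integrable_mkcond _ mB).2.
Qed.

Lemma ae_integrable_section2 :
  {ae m2, forall y, B y -> m1.-integrable A (fun x => (f x y)%:E)}.
Proof.
apply: filterS (ae_integrable2 Fi) => y /[swap] By.
by rewrite (F2 By) => /(integrable_mkcond _ mA).2.
Qed.

Let fine_inner1 : {ae m1, forall x,
  fubini_F m2 F x = ((fun x => (\int[m2]_(y in B) f x y)%:E) \_ A) x}.
Proof.
apply: filterS ae_integrable_section1 => x xi; rewrite /fubini_F.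
have [Ax|nAx] := pselect (A x).
  rewrite /patch mem_set// F1// -integral_mkcond fineK//.
  by apply: integrable_fin_num => //; exact: xi.
by rewrite /patch memNset// F1'// integral0.
Qed.

Let fine_inner2 : {ae m2, forall y,
  fubini_G m1 F y = ((fun y => (\int[m1]_(x in A) f x y)%:E) \_ B) y}.
Proof.
apply: filterS ae_integrable_section2 => y yi; rewrite /fubini_G.
have [By|nBy] := pselect (B y).
  rewrite /patch mem_set// F2// -integral_mkcond fineK//.
  by apply: integrable_fin_num => //; exact: yi.
by rewrite /patch memNset// F2'// integral0.
Qed.

Lemma Rintegral12_prod :
  \int[m1]_(x in A) (\int[m2]_(y in B) f x y) =
  \int[(m1 \x m2)%E]_(z in A `*` B) f z.1 z.2.
Proof.
rewrite /Rintegral; congr fine; rewrite [RHS]integral_mkcond.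
rewrite -/F -(integral12_prod_meas1 Fi).
rewrite -[RHS]/(integral m1 setT (fubini_F m2 F)).
apply: ae_eq_integral_nm; apply: filterS fine_inner1 => x.
by rewrite patch_setT => /esym.
Qed.

Lemma Rintegral21_prod :
  \int[m2]_(y in B) (\int[m1]_(x in A) f x y) =
  \int[(m1 \x m2)%E]_(z in A `*` B) f z.1 z.2.
Proof.
rewrite /Rintegral; congr fine; rewrite [RHS]integral_mkcond.
rewrite -/F -(integral21_prod_meas1 Fi).
rewrite -[RHS]/(integral m2 setT (fubini_G m1 F)).
apply: ae_eq_integral_nm; apply: filterS fine_inner2 => x.
by rewrite patch_setT => /esym.
Qed.

Lemma Rintegral_swap :
  \int[m1]_(x in A) (\int[m2]_(y in B) f x y) =
  \int[m2]_(y in B) (\int[m1]_(x in A) f x y).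
Proof. by rewrite Rintegral12_prod Rintegral21_prod. Qed.

Lemma integrable_integral2 :
  m2.-integrable B (fun y => \int[m1]_(x in A) (f x y)%:E)%E.
Proof.
have Gi : m2.-integrable setT (fubini_G m1 F).
  apply/integrableP; split; first exact: measurable_fubini_G Fi.
  have mF : measurable_fun setT F by exact: measurable_int Fi.
  apply: le_lt_trans ((integrable21ltyP _ _ mF).1 Fi).
  apply: ge0_le_integral => //.
  - by apply: measurableT_comp => //; exact: measurable_fubini_G Fi.
  - apply: (measurable_fun_fubini_tonelli_G (abse \o F)) => //=.
    exact: measurableT_comp.
  - move=> y _; apply: le_abse_integral => //.
    exact: measurableT_comp.
have := integrableS measurableT mB (@subsetT _ B) Gi.
by apply: eq_integrable => // y /set_mem By; rewrite /fubini_G F2// -integral_mkcond.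
Qed.

Lemma integrable_Rintegral2 :
  m2.-integrable B (fun y => (\int[m1]_(x in A) f x y)%:E).
Proof.
have Gi := integrable_integral2.
apply: (@le_integrable _ _ _ m2 B mB _ _ _ _ Gi).
- apply/measurable_EFinP; apply: (@measurableT_comp _ _ _ _ _ _ fine) => //.
  exact: measurable_int Gi.
- move=> y By; rewrite /Rintegral.
  by case: (integral m1 A _) => [r||] /=; rewrite ?leey// normr0.
Qed.

End real_fubini.

(** * Lebesgue measure on row vectors *)

Section rV_borel.
Context {R : realType} {n : nat}.

Lemma measurable_rV_ball (x : 'rV[R]_n) (e : R) : measurable (ball x e).
Proof.
have [e0|e0] := ltP 0 e; last first.
  rewrite (_ : ball x e = set0)//; apply/seteqP; split => // y [].
  by rewrite ltNge e0.
rewrite (_ : ball x e = \big[setI/setT]_(j : 'I_n)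
    (@rV_coord R n j @^-1` ball (x 0 j) e)).
  apply: bigsetI_measurable => j _; rewrite -[X in measurable X]setTI.
  by apply: measurable_rV_coord => //; exact: measurable_ball.
apply/seteqP; split => y.
  by move=> [_ xy]; rewrite -bigcap_seq => j _; exact: xy.
rewrite -bigcap_seq => xy; split => // i j; rewrite ord1.
by apply: xy; rewrite /= mem_index_enum.
Qed.

(** An open set is the union of the balls with rational centre and radius that it
    contains; these are countably many, and balls for the sup norm are boxes. *)
Lemma open_measurable_rV (U : set 'rV[R]_n) : open U -> measurable U.
Proof.
move=> oU.
pose F (q : 'rV[rat]_n * rat) : set 'rV[R]_n :=
  let B := ball (map_mx (@ratr R) q.1) (ratr q.2) in
  if `[< B `<=` U >] then B else set0.
have -> : U = \bigcup_(q in [set: 'rV[rat]_n * rat]) F q.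
  apply/seteqP; split => [x Ux|x [q _]]; last first.
    by rewrite /F; case: asboolP => // + xB; exact.
  have /nbhs_ballP[e /= e0 xeU] := open_nbhs_nbhs (conj oU Ux).
  have [r /andP[r0 re]] : exists r : rat, (0 < ratr r :> R) && (ratr r < e / 2 :> R).
    have /rat_in_itvoo[r] : 0 < e / 2 :> R by rewrite divr_gt0.
    by rewrite in_itv/= => ?; exists r.
  have xq (j : 'I_n) : exists q : rat, `|x 0 j - ratr q| < ratr r :> R.
    have /rat_in_itvoo[q] : x 0 j - ratr r < x 0 j + ratr r :> R.
      by rewrite ltrBlDr -addrA ltrDl addr_gt0.
    rewrite in_itv/= => /andP[q1 q2]; exists q.
    by rewrite ltr_norml; apply/andP; split; lra.
  pose q j := sval (cid (xq j)).
  have qP j : `|x 0 j - ratr (q j)| < ratr r :> R by exact: (svalP (cid (xq j))).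
  exists (\row_j q j, r) => //; rewrite /F /=.
  set B := ball _ _.
  have xB : B x.
    split => // i j; rewrite ord1 !mxE -ball_normE /ball_ /= distrC.
    exact: qP.
  case: asboolP => // -[] y By; apply: xeU.
  apply: (@le_ball _ _ _ (ratr r + ratr r)); first by lra.
  by apply: ball_triangle By; exact: ball_sym.
apply: countable_bigcupT_measurable => // q; rewrite /F; case: asboolP => // _.
exact: measurable_rV_ball.
Qed.

Lemma continuous_measurable_rV (f : 'rV[R]_n -> R) (D : set 'rV[R]_n) :
  continuous f -> measurable_fun D f.
Proof.
move=> cf; apply: (@measurable_funS _ _ _ _ setT) => //.
apply: (measurability _ (RGenOpens.measurableE R)).
move=> _ [_ [a [b ->] <-]]; rewrite setTI.
apply: open_measurable_rV; move/continuousP : cf; apply.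
exact: interval_open.
Qed.

End rV_borel.

Section rV_uncons.
Context {R : realType} {n : nat}.

Definition rV_uncons (y : 'rV[R]_n.+1) : measurableTypeR R * 'rV[R]_n :=
  (rV_coord ord0 y, rsubmx (y : 'rV_(1 + n))).

Lemma rV_coord_rsubmx (y : 'rV[R]_n.+1) (j : 'I_n) :
  rsubmx (y : 'rV_(1 + n)) 0 j = y 0 (lift ord0 j).
Proof. by rewrite mxE; congr (y _ _); exact/val_inj. Qed.

Lemma rV_unconsK (y : 'rV[R]_n.+1) : rV_cons (rV_uncons y) = y.
Proof.
apply/rowP => i; have [j ->|->] := unliftP ord0 i.
  by have := rV_consES (rV_uncons y) j; rewrite /rV_coord rV_coord_rsubmx.
by have := rV_consE0 (rV_uncons y).
Qed.

Lemma measurable_rV_uncons : measurable_fun [set: 'rV[R]_n.+1] rV_uncons.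
Proof.
apply/measurable_fun_pair; first exact: measurable_rV_coord.
apply: measurable_fun_rVP => j.
rewrite (_ : _ \o _ = rV_coord (lift ord0 j)); first exact: measurable_rV_coord.
by apply/funext => y; rewrite /= /rV_coord rV_coord_rsubmx.
Qed.

Lemma measurable_rV_cons_preimage (D : set 'rV[R]_n.+1) :
  measurable D -> measurable (rV_cons @^-1` D).
Proof. by move=> mD; rewrite -[X in measurable X]setTI; exact: measurable_rV_cons. Qed.

Lemma measurable_fun_rV_cons (D : set 'rV[R]_n.+1) (f : 'rV[R]_n.+1 -> R) :
  measurable D ->
  measurable_fun D f <-> measurable_fun (rV_cons @^-1` D) (f \o rV_cons).
Proof.
move=> mD; split => mf.
  apply: (measurable_comp mD) => //; first by move=> _ [p Dp <-].
  exact: measurable_funTS measurable_rV_cons.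
rewrite (_ : f = (f \o rV_cons) \o rV_uncons); last first.
  by apply/funext => y /=; rewrite rV_unconsK.
apply: (measurable_comp (measurable_rV_cons_preimage mD)) => //.
  by move=> _ [y Dy <-] /=; rewrite rV_unconsK.
exact: measurable_funTS measurable_rV_uncons.
Qed.

Lemma integrable_rV_cons (D : set 'rV[R]_n.+1) (f : 'rV[R]_n.+1 -> R) :
  measurable D ->
  (leb R n.+1).-integrable D (EFin \o f) <->
  (@lebesgue_measure R \x leb R n)%E.-integrable (rV_cons @^-1` D)
    (EFin \o (f \o rV_cons)).
Proof.
move=> mD.
have E (mf : measurable_fun D f) :
    (\int[leb R n.+1]_(x in D) `|(EFin \o f) x|)%E =
    (\int[(@lebesgue_measure R \x leb R n)%E]_(x in rV_cons @^-1` D)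
      `|(EFin \o (f \o rV_cons)) x|)%E.
  rewrite (ge0_integral_pushforward measurable_rV_cons
    (@lebesgue_measure R \x leb R n)%E) //.
  by do 2 apply: measurableT_comp => //.
split=> /integrableP[/measurable_EFinP mf foo]; apply/integrableP.
  split; first exact/measurable_EFinP/measurable_fun_rV_cons.
  by rewrite -E.
have {}mf : measurable_fun D f by exact/measurable_fun_rV_cons.
by split; [exact/measurable_EFinP|rewrite E].
Qed.

Lemma Rintegral_rV_cons (D : set 'rV[R]_n.+1) (f : 'rV[R]_n.+1 -> R) :
  measurable D -> (leb R n.+1).-integrable D (EFin \o f) ->
  \int[leb R n.+1]_(x in D) f x =
  \int[(@lebesgue_measure R \x leb R n)%E]_(p in rV_cons @^-1` D) f (rV_cons p).
Proof.
move=> mD fi; rewrite /Rintegral; congr fine.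
have fi' := (integrable_rV_cons f mD).1 fi.
rewrite integral_mkcond (integral_pushforward measurable_rV_cons) //.
- by rewrite [RHS]integral_mkcond; apply: eq_integral => p _.
- apply/(measurable_restrictT _ mD) => //; exact: measurable_int fi.
- have /(integrable_mkcond _ (measurable_rV_cons_preimage mD)).1 := fi'.
  exact.
Qed.

End rV_uncons.

Section leb_size.
Context {R : realType}.

Lemma measurable_rV_box n (C : R) :
  measurable [set x : 'rV[R]_n | forall j : 'I_n, -C <= x 0 j <= C].
Proof.
rewrite (_ : mkset _ = \big[setI/setT]_(j : 'I_n)
    (@rV_coord R n j @^-1` `[-C, C]%classic)).
  apply: bigsetI_measurable => j _; rewrite -[X in measurable X]setTI.
  exact: measurable_rV_coord.
rewrite -bigcap_seq; apply/seteqP; split => x /=.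
  by move=> xC j _ /=; rewrite in_itv /=; exact: xC.
by move=> xC j; have := xC j; rewrite /= in_itv /= mem_index_enum; exact.
Qed.

Lemma leb_box_fin n (C : R) :
  (leb R n [set x : 'rV[R]_n | forall j : 'I_n, (-C <= x 0 j <= C)%R] < +oo)%E.
Proof.
elim: n => [|n IHn].
  by rewrite /= diracE; case: (_ \in _); rewrite ltry.
rewrite /= /lebesgue_rV_succ /pushforward.
pose B := [set x : 'rV[R]_n | forall j : 'I_n, -C <= x 0 j <= C].
pose B' := [set x : 'rV[R]_n.+1 | forall j : 'I_n.+1, -C <= x 0 j <= C].
rewrite -/B in IHn; rewrite -/B'.
have mB : measurable B by exact: measurable_rV_box.
have -> : rV_cons @^-1` B' = `[-C, C]%classic `*` B.
  apply/seteqP; split => -[s y] /=.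
    move=> sy; split.
      by rewrite in_itv /=; have := sy ord0; have /= := rV_consE0 (s, y); rewrite /rV_coord => ->.
    move=> j; have := sy (lift ord0 j).
    by have /= := rV_consES (s, y) j; rewrite /rV_coord => ->.
  rewrite in_itv /= => -[sC yC] i; have [j ->|->] := unliftP ord0 i.
    by have /= := rV_consES (s, y) j; rewrite /rV_coord => ->; exact: yC.
  by have /= := rV_consE0 (s, y); rewrite /rV_coord => ->.
rewrite product_measure1E//= lte_mul_pinfty ?ge0_fin_numE//.
by rewrite lebesgue_measure_itv /=; case: ifP => _; rewrite ?ltry.
Qed.

Lemma bounded_rV_box n (D : set 'rV[R]_n) : bounded_set D ->
  exists C : R, forall x, D x -> forall j, -C <= x 0 j <= C.
Proof.
move=> [M [Mreal DM]]; exists (M + 1) => x Dx j.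
have xM : `|x| <= M + 1 by apply: DM => //; rewrite ltrDl.
have : `|x 0 j| <= M + 1.
  apply: le_trans xM; rewrite -[leRHS]/(mx_norm x) mx_normrE.
  by apply/bigmax_geP; right => /=; exists (0, j).
by rewrite ler_norml.
Qed.

Lemma leb_bounded_fin n (D : set 'rV[R]_n) :
  bounded_set D -> measurable D -> (leb R n D < +oo)%E.
Proof.
move=> /bounded_rV_box[C DC] mD; apply: le_lt_trans (leb_box_fin n C).
apply: le_measure; rewrite ?inE//.
exact: measurable_rV_box.
Qed.

Lemma measurable_affine n (a : 'I_n -> R) :
  measurable_fun [set: 'rV[R]_n] (fun x => \sum_j a j * x 0 j).
Proof.
apply: (@eq_measurable_fun _ _ _ _ _ (fun x => \sum_j a j * rV_coord j x)) => //.
apply: measurable_sum => j; apply: measurable_funM => //.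
exact: measurable_rV_coord.
Qed.

Lemma measurable_hyperplane n (a : 'I_n -> R) (b : R) :
  measurable [set x : 'rV[R]_n | \sum_j a j * x 0 j = b].
Proof.
rewrite -[X in measurable X]setTI.
exact: (measurable_affine a) measurableT _ (measurable_set1 b).
Qed.

(** Slicing along the first coordinate: if another coefficient is nonzero,
    every slice is a hyperplane of one dimension less; otherwise all slices are
    empty but one. *)
Lemma hyperplane_null n (a : 'I_n -> R) (b : R) : (exists j, a j != 0) ->
  leb R n [set x : 'rV[R]_n | \sum_j a j * x 0 j = b] = 0%E.
Proof.
elim: n a b => [a b [[]]//|n IHn a b aN0].
pose H := [set x : 'rV[R]_n.+1 | \sum_j a j * x 0 j = b].
rewrite -/H [LHS]/= /lebesgue_rV_succ /pushforward.
have xs s : xsection (rV_cons @^-1` H) s =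
    [set y | \sum_j a (lift ord0 j) * y 0 j = b - a ord0 * s].
  apply/seteqP; split => y; rewrite /xsection /= inE /H /= big_ord_recl.
    have /= := rV_consE0 (s, y); rewrite /rV_coord => ->.
    under eq_bigr do (have /= := rV_consES (s, y) _; rewrite /rV_coord => ->).
    by move=> <-; ring.
  have /= := rV_consE0 (s, y); rewrite /rV_coord => ->.
  under [X in _ + X = _]eq_bigr do (have /= := rV_consES (s, y) _; rewrite /rV_coord => ->).
  by move=> ->; ring.
rewrite /product_measure1.
have [[j aj]|a0] := pselect (exists j, a (lift ord0 j) != 0).
  by apply: integral0_eq => s _ /=; rewrite xs IHn//; exists j.
have {}a0 j : a (lift ord0 j) = 0.
  by apply/eqP; apply/negPn/negP => aj; apply: a0; exists j.
have aN : a ord0 != 0.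
  have [i] := aN0; have [j ->|->//] := unliftP ord0 i; by rewrite a0 eqxx.
rewrite (_ : 0%E = (\int[@lebesgue_measure R]_(s in setT) (cst 0 s))%E); last first.
  by rewrite integral0.
apply: ae_eq_integral_nm; exists [set b / a ord0]; split => //.
  exact: lebesgue_measure_set1.
move=> s /= sN; apply: contrapT => sb; apply: sN; rewrite !patch_setT /= xs.
rewrite (_ : [set y | _] = set0) ?measure0//.
apply/seteqP; split => // y /=; rewrite big1; last by move=> j _; rewrite a0 mul0r.
move=> e; apply: sb; have {}e : b = a ord0 * s by rewrite -[LHS]subr0 e; ring.
by rewrite e mulrC mulKf.
Qed.

End leb_size.

(** * Integrals over cylinders *)

Section cylinders.
Context {R : realType} {n : nat}.
Notation mu := (@lebesgue_measure R).

Definition cyl (A : set R) (B : set 'rV[R]_n) : set 'rV[R]_(1 + n) :=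
  [set y | A (lsubmx y 0 0) /\ B (rsubmx y)].

Lemma lsubmx_rV_cons (p : measurableTypeR R * 'rV[R]_n) :
  lsubmx (rV_cons p : 'rV_(1 + n)) 0 0 = p.1.
Proof. by rewrite /rV_cons row_mxKl mxE eqxx. Qed.

Lemma rsubmx_rV_cons (p : measurableTypeR R * 'rV[R]_n) :
  rsubmx (rV_cons p : 'rV_(1 + n)) = p.2.
Proof. by rewrite /rV_cons row_mxKr. Qed.

Lemma rV_cons_submx (y : 'rV[R]_(1 + n)) :
  rV_cons (lsubmx y 0 0, rsubmx y) = y.
Proof.
rewrite -[RHS]rV_unconsK /rV_uncons; congr (rV_cons (_, _)).
by rewrite /rV_coord mxE; congr (y _ _); exact/val_inj.
Qed.

Lemma rV_cons_cyl A B : rV_cons @^-1` cyl A B = A `*` B.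
Proof.
by apply/seteqP; split => p /=; rewrite /cyl /= lsubmx_rV_cons rsubmx_rV_cons.
Qed.

Lemma measurable_cyl (A : set (measurableTypeR R)) B :
  measurable A -> measurable B -> measurable (cyl A B).
Proof.
move=> mA mB; have := measurable_rV_uncons measurableT (measurableX mA mB).
rewrite setTI (_ : _ @^-1` _ = cyl A B)//.
have l0 : lshift n (0 : 'I_1) = ord0 by apply/val_inj.
by apply/seteqP; split => y; rewrite /cyl /rV_uncons /= mxE /rV_coord l0.
Qed.

Section fubini.
Variables (A : set (measurableTypeR R)) (B : set 'rV[R]_n).
Hypotheses (mA : measurable A) (mB : measurable B).
Variable (f : 'rV[R]_(1 + n) -> R).
Hypothesis fi : (leb R (1 + n)).-integrable (cyl A B) (EFin \o f).

Lemma integrable_cyl : (mu \x leb R n)%E.-integrable (A `*` B)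
  (fun z => (f (rV_cons (z.1, z.2)))%:E).
Proof.
have /integrable_rV_cons : measurable (cyl A B) by exact: measurable_cyl.
move=> /(_ f) [/(_ fi) + _]; rewrite rV_cons_cyl.
by apply: eq_integrable; [exact: measurableX|case].
Qed.

Lemma Rintegral_cyl12 : \int[leb R (1 + n)]_(y in cyl A B) f y =
  \int[mu]_(s in A) (\int[leb R n]_(x in B) f (rV_cons (s, x))).
Proof.
rewrite (@Rintegral12_prod _ _ (measurableTypeR R) _ R mu (leb R n) A B
  (fun s x => f (rV_cons (s, x))) mA mB integrable_cyl).
rewrite Rintegral_rV_cons//; last exact: measurable_cyl.
by rewrite rV_cons_cyl; apply: eq_Rintegral => -[].
Qed.

Lemma Rintegral_cyl21 : \int[leb R (1 + n)]_(y in cyl A B) f y =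
  \int[leb R n]_(x in B) (\int[mu]_(s in A) f (rV_cons (s, x))).
Proof.
rewrite -(@Rintegral_swap _ _ (measurableTypeR R) _ R mu (leb R n) A B
  (fun s x => f (rV_cons (s, x))) mA mB integrable_cyl).
exact: Rintegral_cyl12.
Qed.

Lemma ae_integrable_cyl : {ae leb R n, forall x, B x ->
  mu.-integrable A (fun s => (f (rV_cons (s, x)))%:E)}.
Proof.
exact: (@ae_integrable_section2 _ _ (measurableTypeR R) _ R mu (leb R n) A B
  (fun s x => f (rV_cons (s, x))) mA mB integrable_cyl).
Qed.

Lemma integrable_integral_cyl : (leb R n).-integrable B
  (fun x => \int[mu]_(s in A) (f (rV_cons (s, x)))%:E)%E.
Proof.
exact: (@integrable_integral2 _ _ (measurableTypeR R) _ R mu (leb R n) A B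
  (fun s x => f (rV_cons (s, x))) mA mB integrable_cyl).
Qed.

Lemma integrable_Rintegral_cyl : (leb R n).-integrable B
  (fun x => (\int[mu]_(s in A) f (rV_cons (s, x)))%:E).
Proof.
exact: (@integrable_Rintegral2 _ _ (measurableTypeR R) _ R mu (leb R n) A B
  (fun s x => f (rV_cons (s, x))) mA mB integrable_cyl).
Qed.

End fubini.

End cylinders.

(** * Integration in one variable *)

Section one_variable.
Context {R : realType}.
Notation mu := (@lebesgue_measure R).

Lemma is_derive_continuous (F f : R -> R) :
  (forall s, is_derive s (1 : R) F (f s)) -> continuous F.
Proof.
move=> dF s; apply: differentiable_continuous; apply/derivable1_diffP.
exact: (@ex_derive _ _ _ _ _ _ _ (dF s)).
Qed.

Lemma continuous_integrable_oo (a b : R) (f : R -> R) : continuous f ->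
  mu.-integrable `]a, b[ (EFin \o f).
Proof.
move=> cf; apply: (@integrableS _ _ _ mu `[a, b]%classic) => //.
- exact: subset_itv_oo_cc.
- apply: continuous_compact_integrable; first exact: segment_compact.
  exact: continuous_subspaceT.
Qed.

Lemma Rintegral_itv_endpoints (a b : R) (b1 b2 b3 b4 : bool) (f : R -> R) :
  \int[mu]_(s in [set` Interval (BSide b1 a) (BSide b2 b)]) f s =
  \int[mu]_(s in [set` Interval (BSide b3 a) (BSide b4 b)]) f s.
Proof.
apply: ae_eq_Rintegral; exists ([set a] `|` [set b]); split.
- by apply: measurableU; exact: measurable_set1.
- apply: null_set_setU; [exact: measurable_set1|exact: measurable_set1| |];
    exact: lebesgue_measure_set1.
move=> s /= sab; apply: contrapT => sN; apply: sab.
have sa : s != a by apply/eqP => sa; apply: sN; left.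
have sb : s != b by apply/eqP => sb; apply: sN; right.
rewrite /patch; congr (if _ then _ else _); apply: asbool_equiv_eq => /=.
by rewrite !in_itv /=; case: b1; case: b2; case: b3; case: b4 => /=;
  rewrite ?le_eqVlt ?(eq_sym a) ?(negbTE sa) ?(negbTE sb).
Qed.

Lemma Rintegral_FTC (F f : R -> R) (a b : R) (b1 b2 : bool) : a < b ->
  (forall s, is_derive s (1 : R) F (f s)) -> continuous f ->
  \int[mu]_(s in [set` Interval (BSide b1 a) (BSide b2 b)]) f s = F b - F a.
Proof.
move=> ab dF cf; rewrite (Rintegral_itv_endpoints _ _ _ _ true false).
have cF := is_derive_continuous dF.
rewrite /Rintegral (continuous_FTC2 (F := F) ab) //.
- exact: continuous_subspaceT.
- split.
  + by move=> s _; exact: (@ex_derive _ _ _ _ _ _ _ (dF s)).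
  + by apply: cvg_at_right_filter; exact: cF.
  + by apply: cvg_at_left_filter; exact: cF.
- by move=> s _; rewrite derive1E; exact: (@derive_val _ _ _ _ _ _ _ (dF s)).
Qed.

Lemma Rintegral_by_parts0 (F f G g : R -> R) (a b : R) (b1 b2 : bool) : a < b ->
  (forall s, is_derive s (1 : R) F (f s)) -> continuous f ->
  (forall s, is_derive s (1 : R) G (g s)) -> continuous g ->
  G a = 0 -> G b = 0 ->
  \int[mu]_(s in [set` Interval (BSide b1 a) (BSide b2 b)]) (F s * g s) =
  - \int[mu]_(s in [set` Interval (BSide b1 a) (BSide b2 b)]) (f s * G s).
Proof.
move=> ab dF cf dG cg Ga Gb.
have cF := is_derive_continuous dF.
have cG := is_derive_continuous dG.
rewrite !(Rintegral_itv_endpoints _ _ b1 b2 true false).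
apply/eqP; rewrite -subr_eq0 opprK; apply/eqP.
have ci (h : R -> R) : continuous h -> mu.-integrable `[a, b] (EFin \o h).
  move=> ch; apply: continuous_compact_integrable; first exact: segment_compact.
  exact: continuous_subspaceT.
have cFg : continuous (fun s => F s * g s) by move=> s; apply: cvgM; [exact: cF|exact: cg].
have cfG : continuous (fun s => f s * G s) by move=> s; apply: cvgM; [exact: cf|exact: cG].
rewrite -RintegralD //; [|exact: ci|exact: ci].
have dFG s : is_derive s (1 : R) (F * G) (F s * g s + f s * G s).
  have := @is_deriveM _ _ F G s 1 _ _ (dF s) (dG s).
  by rewrite /GRing.scale /= (mulrC (G s)).
have cFG : continuous (fun s => F s * g s + f s * G s).
  by move=> s; apply: cvgD; [exact: cFg|exact: cfG].
by rewrite (Rintegral_FTC _ _ ab dFG cFG) !fctE Ga Gb !mulr0 subr0.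
Qed.

End one_variable.

(** * Test functions *)

Section derive_lines.
Context {R : realType} {V W : normedModType R}.
Variables (f : V -> R) (g : W -> R) (a v : V) (b w : W).
Hypothesis fg : forall h : R, f (h *: v + a) = g (h *: w + b).

(** A directional derivative depends only on the restriction to a line. *)
Let quotients :
  (fun h : R => h^-1 *: ((f \o shift a) (h *: v) - f a)) =
  (fun h : R => h^-1 *: ((g \o shift b) (h *: w) - g b)).
Proof.
apply/funext => h; have := fg 0; rewrite !scale0r !add0r => ->.
by rewrite /= fg.
Qed.

Lemma derivable_line : derivable g b w -> derivable f a v.
Proof. by rewrite /derivable quotients. Qed.

Lemma derive_line : 'D_v f a = 'D_w g b.
Proof. by rewrite /derive quotients. Qed.

End derive_lines.

Section rV_cons_lines.
Context {R : realType} {n : nat}.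
Implicit Types (s h e : R) (x y : 'rV[R]_n).

Lemma rV_cons0 (p : measurableTypeR R * 'rV[R]_n) : rV_cons p 0 ord0 = p.1.
Proof. exact: rV_consE0. Qed.

Lemma rV_consS (p : measurableTypeR R * 'rV[R]_n) (j : 'I_n) :
  rV_cons p 0 (lift ord0 j) = p.2 0 j.
Proof. exact: rV_consES. Qed.

Lemma rV_cons_line0 h s x :
  rV_cons (h * 1 + s, x) = h *: delta_mx 0 ord0 + rV_cons (s, x).
Proof.
apply/rowP => i; have [j ->|->] := unliftP ord0 i; rewrite [RHS]mxE [X in _ = X + _]mxE.
  by rewrite !rV_consS /= mxE /= mulr0 add0r.
by rewrite !rV_cons0 /= mxE.
Qed.

Lemma rV_cons_lineS h s x (j : 'I_n) :
  rV_cons (s, h *: delta_mx 0 j + x) =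
  h *: delta_mx 0 (lift ord0 j) + rV_cons (s, x).
Proof.
apply/rowP => i; have [l ->|->] := unliftP ord0 i; rewrite [RHS]mxE [X in _ = X + _]mxE.
  by rewrite !rV_consS /= !mxE /= (inj_eq lift_inj).
by rewrite !rV_cons0 /= mxE /= mulr0 add0r.
Qed.

Lemma ball_rV_cons s s' x x' e : ball s e s' -> ball x e x' ->
  ball (rV_cons (s, x)) e (rV_cons (s', x')).
Proof.
move=> ss' [e0 xx']; split => // i j; rewrite ord1.
have [l ->|->] := unliftP ord0 j; first by rewrite !rV_consS; exact: xx'.
by rewrite !rV_cons0.
Qed.

Lemma continuous_rV_consr s : continuous (fun x : 'rV[R]_n => rV_cons (s, x)).
Proof.
move=> x A /nbhs_ballP[e /= e0 eA]; apply/nbhs_ballP; exists e => //= y xy.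
by apply: eA; apply: ball_rV_cons => //; exact: ballxx.
Qed.

Lemma continuous_rV_consl x : continuous (fun s : R => rV_cons (s, x)).
Proof.
move=> s A /nbhs_ballP[e /= e0 eA]; apply/nbhs_ballP; exists e => //= y xy.
by apply: eA; apply: ball_rV_cons => //; exact: ballxx.
Qed.

Lemma continuous_rsubmx : continuous (fun y : 'rV[R]_(1 + n) => rsubmx y).
Proof.
move=> x A /nbhs_ballP[e /= e0 eA]; apply/nbhs_ballP; exists e => //= y [_ xy].
apply: eA; split => // i j; rewrite !mxE; exact: xy.
Qed.

Lemma continuous_lsubmx00 : continuous (fun y : 'rV[R]_(1 + n) => lsubmx y 0 0).
Proof.
rewrite (_ : (fun _ => _) = fun y : 'rV[R]_(1 + n) => y 0 (lshift n 0)).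
  exact: coord_continuous.
by apply/funext => y; rewrite mxE.
Qed.

End rV_cons_lines.

Section test_functions.
Context {R : realType}.
Notation mu := (@lebesgue_measure R).

Lemma test_function_sub n (O O' : set 'rV[R]_n) chi : O `<=` O' ->
  test_function O chi -> test_function O' chi.
Proof.
move=> OO' [c1 c2 c3 [K [cK KO] K0]]; split => //.
by exists K => //; split => //; exact: subset_trans OO'.
Qed.

(** The partial derivatives of a test function vanish off its support, which
    is closed. *)
Lemma test_function_support n (O : set 'rV[R]_n) chi : test_function O chi ->
  exists K, [/\ compact K, K `<=` O, forall x, ~ K x -> chi x = 0 &
    forall j x, ~ K x -> partial j chi x = 0].
Proof.
move=> [_ _ _ [K [cK KO] K0]]; exists K; split => // j x nKx.
have oK : open (~` K) by apply: closed_openC; apply: compact_closed => //; exact: norm_hausdorff.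
rewrite /partial (@near_eq_derive _ _ _ chi (cst 0)).
- by rewrite derive_cst.
- by apply: filterS (open_nbhs_nbhs (conj oK nKx)) => y /K0.
Qed.

Lemma compact_support_bounded n (K : set 'rV[R]_n) (f : 'rV[R]_n -> R) :
  compact K -> continuous f -> (forall x, ~ K x -> f x = 0) ->
  exists2 C, 0 <= C & forall x, `|f x| <= C.
Proof.
move=> cK cf K0.
have : bounded_set (f @` K).
  by apply: compact_bounded; apply: continuous_compact => //; exact: continuous_subspaceT.
move=> [M [Mreal MK]]; exists (`|M| + 1); first by rewrite addr_ge0.
move=> x; have [Kx|/K0 ->] := pselect (K x); last by rewrite normr0 addr_ge0.
by apply: (MK (`|M| + 1)) => /=; [rewrite ltr_pwDr // ler_norm|exists x].
Qed.

Lemma test_function_bounded n (O : set 'rV[R]_n) chi : test_function O chi ->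
  exists2 C, 0 <= C & forall x, `|chi x| <= C.
Proof.
move=> tchi; have [K [cK _ K0 _]] := test_function_support tchi.
by apply: compact_support_bounded K0 => //; case: tchi.
Qed.

Lemma partial_bounded n (O : set 'rV[R]_n) chi j : test_function O chi ->
  exists2 C, 0 <= C & forall x, `|partial j chi x| <= C.
Proof.
move=> tchi; have [K [cK _ _ K0]] := test_function_support tchi.
by apply: (compact_support_bounded cK); [case: tchi|exact: K0].
Qed.

Section slices.
Context {n : nat}.
Variables (A : set R) (B : set 'rV[R]_n) (chi : 'rV[R]_(1 + n) -> R).
Hypothesis tchi : test_function (cyl A B) chi.

Lemma partial_sliceS s x j :
  partial j (fun x => chi (rV_cons (s, x))) x =
  partial (lift ord0 j) chi (rV_cons (s, x)).
Proof. by apply: derive_line => h; rewrite rV_cons_lineS. Qed.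

Lemma test_function_slice s : test_function B (fun x => chi (rV_cons (s, x))).
Proof.
have [c1 c2 c3 [K [cK KO] K0]] := tchi.
split.
- by move=> x; apply: continuous_comp; [exact: continuous_rV_consr|exact: c1].
- move=> j x; apply: derivable_line (c2 (lift ord0 j) (rV_cons (s, x))) => h.
  by rewrite rV_cons_lineS.
- move=> j; rewrite (_ : partial j _ =
      fun x => partial (lift ord0 j) chi (rV_cons (s, x))).
    by move=> x; apply: continuous_comp; [exact: continuous_rV_consr|exact: c3].
  by apply/funext => x; exact: partial_sliceS.
exists [set x | K (rV_cons (s, x))]; last by move=> x; exact: K0.
split; last by move=> x /KO[_]; rewrite rsubmx_rV_cons.
apply: bounded_closed_compact.
  have [C KC] : exists C : R, forall y, K y -> `|y| <= C.
    have [M [Mreal MK]] := compact_bounded cK.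
    by exists (M + 1) => y Ky; apply: MK => //; rewrite ltrDl.
  exists C; split; first exact: num_real.
  move=> D CD x /= /KC xC; apply: (le_trans _ (ltW CD)); apply: le_trans xC.
  rewrite -[leLHS]/(mx_norm x) mx_normrE; apply/bigmax_leP; split => //.
  move=> [i j] _ /=; rewrite ord1 -(rV_consS (s, x)).
  rewrite -[leRHS]/(mx_norm _) mx_normrE.
  by apply/bigmax_geP; right => /=; exists (0, lift ord0 j).
have clK : closed K by apply: compact_closed => //; exact: norm_hausdorff.
apply: (@preimage_closed _ _ (fun x => rV_cons (s, x)) K) => // x _.
exact: continuous_rV_consr.
Qed.

Lemma is_derive_slice x s :
  is_derive s (1 : R) (fun s => chi (rV_cons (s, x)))
    (partial ord0 chi (rV_cons (s, x))).
Proof.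
have [_ c2 _ _] := tchi.
have E h : (fun s => chi (rV_cons (s, x))) (h *: (1 : R) + s) =
    chi (h *: delta_mx 0 ord0 + rV_cons (s, x)) by rewrite -rV_cons_line0.
apply: DeriveDef; last exact: (derive_line E).
exact: (derivable_line E (c2 _ _)).
Qed.

Lemma continuous_slice x : continuous (fun s : R => chi (rV_cons (s, x))).
Proof.
have [c1 _ _ _] := tchi.
by move=> s; apply: continuous_comp; [exact: continuous_rV_consl|exact: c1].
Qed.

Lemma continuous_partial_slice x i :
  continuous (fun s : R => partial i chi (rV_cons (s, x))).
Proof.
have [_ _ c3 _] := tchi.
by move=> s; apply: continuous_comp; [exact: continuous_rV_consl|exact: c3].
Qed.

Lemma slice_out s x : ~ A s -> chi (rV_cons (s, x)) = 0.
Proof.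
move=> nAs; have [_ _ _ [K [_ KO] K0]] := tchi; apply: K0 => /KO[].
by rewrite lsubmx_rV_cons.
Qed.

End slices.

Section tensor.
Context {n : nat}.
Variables (A : set R) (B : set 'rV[R]_n).
Variables (theta theta' : R -> R) (KA : set R) (eta : 'rV[R]_n -> R).
Hypotheses (dtheta : forall s, is_derive s (1 : R) theta (theta' s))
  (ctheta' : continuous theta') (cKA : compact KA) (KAA : KA `<=` A)
  (theta0 : forall s, ~ KA s -> theta s = 0).
Hypothesis teta : test_function B eta.

Let chi (y : 'rV[R]_(1 + n)) := theta (lsubmx y 0 0) * eta (rsubmx y).

Let chiE s x : chi (rV_cons (s, x)) = theta s * eta x.
Proof. by rewrite /chi lsubmx_rV_cons rsubmx_rV_cons. Qed.

Let chi_uncons (g : R -> 'rV[R]_n -> R) (f : 'rV[R]_(1 + n) -> R) :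
  (forall s x, f (rV_cons (s, x)) = g s x) ->
  f = fun y => g (lsubmx y 0 0) (rsubmx y).
Proof.
by move=> fg; apply/funext => y; rewrite -[y in LHS]rV_cons_submx fg.
Qed.

Let continuous_tensor (a : R -> R) (b : 'rV[R]_n -> R) :
  continuous a -> continuous b ->
  continuous (fun y : 'rV[R]_(1 + n) => a (lsubmx y 0 0) * b (rsubmx y)).
Proof.
move=> ca cb.
have ha : continuous (a \o fun y : 'rV[R]_(1 + n) => lsubmx y 0 0).
  by move=> y; apply: continuous_comp; [exact: continuous_lsubmx00|exact: ca].
have hb : continuous (b \o fun y : 'rV[R]_(1 + n) => rsubmx y).
  by move=> y; apply: continuous_comp; [exact: continuous_rsubmx|exact: cb].
by move=> y; exact: (continuousM (ha y) (hb y)).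
Qed.

Let ctheta : continuous theta.
Proof. exact: is_derive_continuous dtheta. Qed.

Let is_derive0 s x :
  is_derive (rV_cons (s, x)) (delta_mx 0 ord0) chi (theta' s * eta x).
Proof.
pose g r := theta r * eta x.
have E h : chi (h *: delta_mx 0 ord0 + rV_cons (s, x)) =
    g (h *: (1 : R) + s) by rewrite -rV_cons_line0 chiE.
have dg : is_derive s (1 : R) g (theta' s * eta x).
  have -> : g = eta x \*: theta by apply/funext => r; rewrite /g mulrC.
  have := @is_deriveZ _ _ _ theta (eta x) s 1 _ (dtheta s).
  by rewrite /GRing.scale /= mulrC.
apply: DeriveDef.
  exact: (derivable_line E (@ex_derive _ _ _ _ _ _ _ dg)).
rewrite (derive_line E); exact: (@derive_val _ _ _ _ _ _ _ dg).
Qed.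

Let is_deriveS s x j :
  is_derive (rV_cons (s, x)) (delta_mx 0 (lift ord0 j)) chi
    (theta s * partial j eta x).
Proof.
pose g := theta s \*: eta.
have E h : chi (h *: delta_mx 0 (lift ord0 j) + rV_cons (s, x)) =
    g (h *: delta_mx 0 j + x) by rewrite -rV_cons_lineS chiE.
have dg : is_derive x (delta_mx 0 j) g (theta s * partial j eta x).
  apply: is_deriveZ; apply: derivableP; have [_ + _ _] := teta; exact.
apply: DeriveDef.
  exact: (derivable_line E (@ex_derive _ _ _ _ _ _ _ dg)).
rewrite (derive_line E); exact: (@derive_val _ _ _ _ _ _ _ dg).
Qed.

Lemma partial_tensorS s x j :
  partial (lift ord0 j) chi (rV_cons (s, x)) = theta s * partial j eta x.
Proof. exact: (@derive_val _ _ _ _ _ _ _ (is_deriveS s x j)). Qed.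

Lemma test_function_tensor : test_function (cyl A B) chi.
Proof.
have [c1 c2 c3 [K [cK KO] K0]] := teta.
split.
- exact: continuous_tensor.
- move=> i y; rewrite -(rV_unconsK y); have [j ->|->] := unliftP ord0 i.
    exact: (@ex_derive _ _ _ _ _ _ _ (is_deriveS _ _ j)).
  exact: (@ex_derive _ _ _ _ _ _ _ (is_derive0 _ _)).
- move=> i; have [j ->|->] := unliftP ord0 i.
    rewrite (@chi_uncons (fun s x => theta s * partial j eta x)
      (partial (lift ord0 j) chi)).
      exact: continuous_tensor.
    by move=> s x; exact: partial_tensorS.
  rewrite (@chi_uncons (fun s x => theta' s * eta x) (partial ord0 chi)).
    exact: continuous_tensor.
  by move=> s x; exact: (@derive_val _ _ _ _ _ _ _ (is_derive0 s x)).
exists (cyl KA K).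
  split; last by move=> y [/KAA ? /KO].
  have -> : cyl KA K = (fun p : R * 'rV[R]_n => rV_cons p) @` (KA `*` K).
    apply/seteqP; split.
      move=> y [y1 y2]; exists (lsubmx y 0 0, rsubmx y) => //.
      exact: rV_cons_submx.
    by move=> _ [[s x] [/= As Bx] <-]; rewrite /cyl /= lsubmx_rV_cons rsubmx_rV_cons.
  apply: continuous_compact; last exact: compact_setX.
  apply: continuous_subspaceT => -[s x] V /nbhs_ballP[e /= e0 eV].
  apply/nbhs_ballP; exists e => //= -[s' x'] [/= ss' xx'].
  by apply: eV; exact: ball_rV_cons.
move=> y yK; rewrite /chi.
have [Ay|nAy] := pselect (KA (lsubmx y 0 0)); last by rewrite theta0// mul0r.
by rewrite K0 ?mulr0// => Ky; apply: yK.
Qed.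

End tensor.

End test_functions.

(** * Sobolev functions on bounded sets *)

Section integrability.
Context d (T : measurableType d) (R : realType).
Variable mu : {measure set T -> \bar R}.
Variables (D : set T) (mD : measurable D).

Lemma integrable_bndM (f g : T -> R) (C : R) :
  mu.-integrable D (EFin \o f) -> measurable_fun D g ->
  (forall x, D x -> `|g x| <= C) ->
  mu.-integrable D (fun x => (f x * g x)%:E).
Proof.
move=> fi mg gC; have mf : measurable_fun D f.
  by apply/measurable_EFinP; exact: measurable_int fi.
apply: (@le_integrable _ _ _ mu D mD _ (fun x => (C%:E * (f x)%:E)%E)).
- by apply/measurable_EFinP; exact: measurable_funM.
- move=> x Dx; rewrite -EFinM !abse_EFin lee_fin !normrM mulrC.
  by apply: ler_wpM2r => //; apply: le_trans (gC x Dx) (ler_norm _).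
- exact: integrableZl.
Qed.

Lemma integrable_EFinD (f g : T -> R) : mu.-integrable D (EFin \o f) ->
  mu.-integrable D (EFin \o g) -> mu.-integrable D (fun x => (f x + g x)%:E).
Proof.
move=> fi gi; rewrite (_ : (fun _ => _) = (EFin \o f) \+ (EFin \o g))%E.
  exact: integrableD.
by apply/funext => x /=; rewrite EFinD.
Qed.

Lemma integrable_EFin_sum I (s : seq I) (f : I -> T -> R) :
  (forall i, mu.-integrable D (EFin \o f i)) ->
  mu.-integrable D (fun x => (\sum_(i <- s) f i x)%:E).
Proof.
move=> fi; rewrite (_ : (fun _ => _) = fun x => (\sum_(i <- s) (f i x)%:E)%E).
  by apply: (integrable_sum mD) => i _; exact: fi.
by apply/funext => x; rewrite sumEFin.
Qed.

Lemma integrable_bnd (g : T -> R) (C : R) : (mu D < +oo)%E ->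
  measurable_fun D g -> (forall x, D x -> `|g x| <= C) ->
  mu.-integrable D (EFin \o g).
Proof.
move=> Doo mg gC; apply: measurable_bounded_integrable => //.
exists C; split; first exact: num_real.
by move=> M CM x Dx; exact: le_trans (gC x Dx) (ltW CM).
Qed.

Lemma square_integrable_L1 (v : T -> R) : (mu D < +oo)%E ->
  measurable_fun D v -> mu.-integrable D (fun x => (v x ^+ 2)%:E) ->
  mu.-integrable D (EFin \o v).
Proof.
move=> Doo mv v2.
apply: (@le_integrable _ _ _ mu D mD _ (fun x => (1 + v x ^+ 2)%:E)).
- exact/measurable_EFinP.
- move=> x _; rewrite !abse_EFin lee_fin [leRHS]ger0_norm; last first.
    by rewrite addr_ge0// sqr_ge0.
  have := sqr_ge0 (`|v x| - 1); rewrite -(@real_normK _ (v x)) ?num_real//.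
  have := normr_ge0 (v x); nra.
- rewrite (_ : (fun _ => _) = (EFin \o cst 1%R) \+ (fun x => (v x ^+ 2)%:E))%E.
    by apply: integrableD => //; apply: (@integrable_bnd _ 1) => // x _; rewrite normr1.
  by apply/funext => x /=; rewrite EFinD.
Qed.

(** Cauchy-Schwarz against the constant 1: the variance is nonnegative. *)
Lemma sqr_Rintegral_le (h : T -> R) : (mu D < +oo)%E ->
  measurable_fun D h -> mu.-integrable D (fun x => (h x ^+ 2)%:E) ->
  (\int[mu]_(x in D) h x) ^+ 2 <=
  fine (mu D) * \int[mu]_(x in D) (h x ^+ 2).
Proof.
move=> Doo mh h2; have hi := square_integrable_L1 Doo mh h2.
set I := \int[mu]_(x in D) h x; set m := fine (mu D).
have m0 : 0 <= m by exact: fine_ge0.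
have icst (r : R) : mu.-integrable D (EFin \o cst r).
  by apply: (@integrable_bnd _ `|r|) => // x _ /=.
have E (c : R) : 0 <= \int[mu]_(x in D) (h x ^+ 2) - 2 * c * I + c ^+ 2 * m.
  have : 0 <= \int[mu]_(x in D) ((h x - c) ^+ 2).
    by apply: Rintegral_ge0 => x _; exact: sqr_ge0.
  rewrite (_ : (fun x => (h x - c) ^+ 2) =
    fun x => (h x ^+ 2 + (- (2 * c)) * h x) + c ^+ 2); last first.
    by apply/funext => x; ring.
  have hci : mu.-integrable D (fun x => (- (2 * c) * h x)%:E).
    exact: (@integrableZl _ _ _ mu D mD (- (2 * c)) _ hi).
  rewrite RintegralD //; last exact: icst.
    rewrite RintegralD // (RintegralZl (- (2 * c)) mD hi) Rintegral_cst//.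
    by rewrite mulNr.
  rewrite (_ : _ \o _ = (fun x => (h x ^+ 2)%:E) \+
      (fun x => (- (2 * c))%:E * (h x)%:E))%E.
    by apply: integrableD => //; exact: integrableZl.
  by apply/funext => x /=; rewrite EFinD EFinM.
have [m_eq0|mN0] := eqVneq m 0.
  rewrite m_eq0 mul0r /I.
  have muD0 : mu D = 0%E.
    by apply/eqP; rewrite -fine_eq0 ?ge0_fin_numE// -/m m_eq0.
  rewrite /Rintegral null_set_integral ?expr0n//.
  exact/measurable_EFinP.
have {}m0 : 0 < m by rewrite lt_neqAle eq_sym mN0.
have := E (I / m); set J := \int[mu]_(x in D) _.
have -> : J - 2 * (I / m) * I + (I / m) ^+ 2 * m = (m * J - I ^+ 2) / m by field.
by rewrite pmulr_lge0 ?invr_gt0// subr_ge0.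
Qed.

End integrability.

Section test_integral.
Context {R : realType}.
Notation mu := (@lebesgue_measure R).

Lemma measurable_partial n (O D : set 'rV[R]_n) chi j : test_function O chi ->
  measurable_fun D (partial j chi).
Proof. by move=> [_ _ c3 _]; exact: continuous_measurable_rV. Qed.

Lemma measurable_test n (O D : set 'rV[R]_n) chi : test_function O chi ->
  measurable_fun D chi.
Proof. by move=> [c1 _ _ _]; exact: continuous_measurable_rV. Qed.

Lemma integrable_partial n (O : set 'rV[R]_n) chi j : test_function O chi ->
  (leb R n).-integrable setT (EFin \o partial j chi).
Proof.
move=> tchi; have [K [cK _ _ K0]] := test_function_support tchi.
have [C C0 chiC] := partial_bounded j tchi.
have mK : measurable K.
  rewrite -(setCK K); apply: measurableC; apply: open_measurable_rV.
  by apply: closed_openC; apply: compact_closed => //; exact: norm_hausdorff.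
have Ki : (leb R n).-integrable K (EFin \o partial j chi).
  apply: (@integrable_bnd _ _ _ _ K mK _ C) => //.
    by apply: leb_bounded_fin => //; exact: compact_bounded.
  exact: measurable_partial tchi.
have := (integrable_mkcond _ mK).1 Ki; apply: eq_integrable => // x _.
by rewrite /patch /=; case: ifPn => // /negP xK; rewrite K0// => Kx; apply: xK; rewrite inE.
Qed.

Let cylT n : cyl [set: R] [set: 'rV[R]_n] = [set: 'rV[R]_(1 + n)].
Proof. by apply/seteqP; split. Qed.

(** Induction on the dimension by slicing along the first coordinate. For a
    derivative in another direction each slice has a vanishing integral; for a
    derivative in the first direction integrate along lines first, over an
    interval that contains the support. *)
Lemma Rintegral_partialT n (chi : 'rV[R]_n -> R) j : test_function setT chi ->
  \int[leb R n]_(x in setT) partial j chi x = 0.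
Proof.
elim: n chi j => [chi []//|n IHn chi i tchi].
have tchi' : test_function (cyl [set: R] [set: 'rV[R]_n]) chi by rewrite cylT.
have pi : (leb R (1 + n)).-integrable (cyl setT setT) (EFin \o partial i chi).
  by rewrite cylT; exact: integrable_partial tchi.
rewrite -[X in Rintegral _ X _](cylT n).
have [j ij|i0] := unliftP ord0 i.
  rewrite (Rintegral_cyl12 measurableT measurableT pi).
  apply: Rintegral0_eq => s _.
  rewrite -[RHS](IHn (fun x => chi (rV_cons (s, x))) j); last exact: (test_function_slice tchi').
  by apply: eq_Rintegral => x _; rewrite ij; apply/esym; exact: partial_sliceS.
rewrite (Rintegral_cyl21 measurableT measurableT pi).
apply: Rintegral0_eq => x _.
have [K [cK _ Kchi Kp]] := test_function_support tchi.
have [C KC] := bounded_rV_box (compact_bounded cK).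
pose C' := `|C| + 1.
have out s : ~ `]-C', C'[%classic s -> ~ K (rV_cons (s, x)).
  move=> sC /KC /(_ ord0); rewrite rV_cons0 /= => /andP[s1 s2]; apply: sC.
  rewrite /= in_itv /= /C'; have := ler_norm C; lra.
transitivity (\int[mu]_(s in `]-C', C'[) partial i chi (rV_cons (s, x))).
  rewrite Rintegral_mkcond [RHS]Rintegral_mkcond; apply: eq_Rintegral => s _.
  rewrite /patch in_setT; case: ifPn => // /negP; rewrite inE => sC.
  by rewrite Kp//; exact: out.
have CC : -C' < C' by rewrite /C'; have := normr_ge0 C; lra.
rewrite i0 (Rintegral_FTC _ _ CC (is_derive_slice tchi' x)).
- rewrite !Kchi ?subr0//; apply: out; rewrite /= in_itv /= ltxx ?andbF//.
- exact: (continuous_partial_slice tchi').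
Qed.

Lemma Rintegral_partial n (O : set 'rV[R]_n) (chi : 'rV[R]_n -> R) j :
  test_function O chi -> \int[leb R n]_(x in O) partial j chi x = 0.
Proof.
move=> tchi; have [K [cK KO _ K0]] := test_function_support tchi.
rewrite -(Rintegral_partialT j (test_function_sub (@subsetT _ O) tchi)).
rewrite Rintegral_mkcond; apply: eq_Rintegral => x _.
rewrite /patch; case: ifPn => // /negP; rewrite inE => xO.
by rewrite K0// => /KO.
Qed.

End test_integral.

Section sobolev_space.
Context {R : realType} {n : nat}.
Variables (O : set 'rV[R]_n).
Hypotheses (mO : measurable O) (bO : bounded_set O).

Let Ooo : (leb R n O < +oo)%E. Proof. exact: leb_bounded_fin. Qed.

Lemma square_integrable_integrable v : square_integrable O v ->
  (leb R n).-integrable O (EFin \o v).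
Proof. by move=> [mv v2]; exact: square_integrable_L1. Qed.

Lemma square_integrable_bndM (v g : 'rV[R]_n -> R) (C : R) : square_integrable O v ->
  measurable_fun O g -> (forall x, O x -> `|g x| <= C) ->
  square_integrable O (fun x => v x * g x).
Proof.
move=> [mv v2] mg gC; split; first exact: measurable_funM.
rewrite (_ : (fun _ => _) = fun x => (v x ^+ 2 * g x ^+ 2)%:E); last first.
  by apply/funext => x; rewrite exprMn.
apply: (@integrable_bndM _ _ _ (leb R n) O mO _ _ (C ^+ 2)) => //.
  exact: measurable_funX.
by move=> x Ox; rewrite normrX; apply: lerXn2r; rewrite ?nnegrE// ?gC//;
  apply: le_trans (gC x Ox).
Qed.

Lemma square_integrable_bnd (g : 'rV[R]_n -> R) (C : R) : measurable_fun O g ->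
  (forall x, O x -> `|g x| <= C) -> square_integrable O g.
Proof.
move=> mg gC; split => //.
apply: (@integrable_bnd _ _ _ (leb R n) O mO (fun x => g x ^+ 2) (C ^+ 2)) => //.
  exact: measurable_funX.
by move=> x Ox; rewrite normrX; apply: lerXn2r; rewrite ?nnegrE// ?gC//;
  apply: le_trans (gC x Ox).
Qed.

Lemma square_integrableD v w : square_integrable O v -> square_integrable O w ->
  square_integrable O (fun x => v x + w x).
Proof.
move=> [mv v2] [mw w2]; split; first exact: measurable_funD.
apply: (@le_integrable _ _ _ _ O mO _ (fun x => (2%:E * (v x ^+ 2)%:E + 2%:E * (w x ^+ 2)%:E)%E)).
- by apply/measurable_EFinP; apply: measurable_funX; exact: measurable_funD.
- move=> x _; rewrite -!EFinM -EFinD !abse_EFin lee_fin !ger0_norm ?sqr_ge0//.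
    by have := sqr_ge0 (v x - w x); nra.
  by have := sqr_ge0 (v x); have := sqr_ge0 (w x); nra.
- by apply: integrableD => //; exact: integrableZl.
Qed.

Lemma integrable_test_mul v chi : square_integrable O v ->
  test_function O chi -> (leb R n).-integrable O (fun x => (v x * chi x)%:E).
Proof.
move=> /square_integrable_integrable vi tchi.
have [C _ chiC] := test_function_bounded tchi.
by apply: (@integrable_bndM _ _ _ _ O mO _ _ C) => //; exact: measurable_test tchi.
Qed.

Lemma integrable_partial_mul v chi j : square_integrable O v ->
  test_function O chi ->
  (leb R n).-integrable O (fun x => (v x * partial j chi x)%:E).
Proof.
move=> /square_integrable_integrable vi tchi.
have [C _ chiC] := partial_bounded j tchi.
by apply: (@integrable_bndM _ _ _ _ O mO _ _ C) => //; exact: measurable_partial tchi.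
Qed.

(** The weak derivatives of a constant vanish because the derivatives of test
    functions have zero integral. *)
Lemma H1_cst (c : R) : H1 O (cst c).
Proof.
have sq r : square_integrable O (cst r : 'rV[R]_n -> R).
  by apply: (@square_integrable_bnd _ `|r|).
split => // j; exists (cst 0) => // chi tchi.
have pi : (leb R n).-integrable O (EFin \o partial j chi).
  by apply: (integrableS measurableT) => //; exact: integrable_partial tchi.
rewrite RintegralZl// Rintegral_partial// mulr0.
by rewrite Rintegral0_eq ?oppr0// => x _; rewrite mul0r.
Qed.

Lemma H1D v w : H1 O v -> H1 O w -> H1 O (fun x => v x + w x).
Proof.
move=> [sv dv] [sw dw]; split; first exact: square_integrableD.
move=> j; have [v' sv' vv'] := dv j; have [w' sw' ww'] := dw j.
exists (fun x => v' x + w' x); first exact: square_integrableD.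
move=> chi tchi.
under eq_Rintegral do rewrite mulrDl.
under [in RHS]eq_Rintegral do rewrite mulrDl.
rewrite !RintegralD ?(vv' _ tchi) ?(ww' _ tchi) ?opprD//.
- exact: integrable_test_mul.
- exact: integrable_test_mul.
- exact: integrable_partial_mul.
- exact: integrable_partial_mul.
Qed.

Lemma H1Z c v : H1 O v -> H1 O (fun x => c * v x).
Proof.
have sZ w : square_integrable O w -> square_integrable O (fun x => c * w x).
  move=> sw; under eq_fun do rewrite mulrC.
  by apply: (@square_integrable_bndM _ _ `|c|) => //.
move=> [sv dv]; split; first exact: sZ.
move=> j; have [v' sv' vv'] := dv j; exists (fun x => c * v' x); first exact: sZ.
move=> chi tchi.
under eq_Rintegral do rewrite -mulrA.
under [in RHS]eq_Rintegral do rewrite -mulrA.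
rewrite !RintegralZl ?(vv' _ tchi) ?mulrN//.
- exact: integrable_test_mul.
- exact: integrable_partial_mul.
Qed.

Lemma H1_sum I (s : seq I) (v : I -> 'rV[R]_n -> R) :
  (forall i, H1 O (v i)) -> H1 O (fun x => \sum_(i <- s) v i x).
Proof.
move=> Hv; elim: s => [|i s IHs].
  by under eq_fun do rewrite big_nil; exact: H1_cst.
by under eq_fun do rewrite big_cons; exact: H1D.
Qed.

End sobolev_space.

(** * Separation of the time variable *)

Section space_time.
Context {R : realType} {n : nat}.
Notation mu := (@lebesgue_measure R).
Variables (a b : R) (B : set 'rV[R]_n).
Hypotheses (ab : a < b) (mB : measurable B) (bB : bounded_set B).

Let A : set (measurableTypeR R) := `]a, b[%classic.
Let mA : measurable A. Proof. exact: measurable_itv. Qed.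
Let Q := cyl A B.

Let muA : mu A = (b - a)%:E.
Proof. by rewrite lebesgue_measure_itv /= lte_fin ab EFinB. Qed.
Let muAoo : (mu A < +oo)%E. Proof. by rewrite muA ltry. Qed.

Lemma measurable_cyl_itv : measurable Q. Proof. exact: measurable_cyl. Qed.

Lemma bounded_cyl_itv : bounded_set Q.
Proof.
have [C BC] := bounded_rV_box bB.
pose M := `|a| + `|b| + `|C|; exists M; split; first exact: num_real.
move=> D MD y [ay By]; apply: le_trans (ltW MD).
have M0 : 0 <= M by rewrite !addr_ge0.
rewrite -[leLHS]/(mx_norm y) mx_normrE; apply/bigmax_leP; split => // -[i j] _ /=.
rewrite ord1 ler_norml; have [l ->|->] := unliftP ord0 j.
  have := BC _ By l; rewrite rV_coord_rsubmx => /andP[y1 y2].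
  have := ler_norm C; have := normr_ge0 a; have := normr_ge0 b.
  by move=> *; apply/andP; split; rewrite /M; lra.
move: ay; rewrite /A /= in_itv /= mxE.
have -> : lshift n (0 : 'I_1) = ord0 by apply/val_inj.
move=> /andP[y1 y2]; have := ler_norm b; have := ler_norm (- a); rewrite normrN.
have := normr_ge0 a; have := normr_ge0 b; have := normr_ge0 C.
by move=> *; apply/andP; split; rewrite /M; lra.
Qed.

Lemma measurable_time (D : set 'rV[R]_(1 + n)) (g : R -> R) : continuous g ->
  measurable_fun D (fun y => g (lsubmx y 0 0)).
Proof.
move=> cg; apply: continuous_measurable_rV.
have cg' : continuous (g \o (fun y : 'rV[R]_(1 + n) => lsubmx y 0 0)).
  by move=> y; apply: continuous_comp; [exact: continuous_lsubmx00|exact: cg].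
exact: cg'.
Qed.

Lemma measurable_space (v : 'rV[R]_n -> R) :
  measurable_fun B v -> measurable_fun Q (fun y => v (rsubmx y)).
Proof.
move=> mv; apply: (@measurable_comp _ _ _ _ _ _ B) => //.
  by move=> _ [y [_ By] <-].
apply: measurable_funTS.
apply: (measurableT_comp measurable_snd measurable_rV_uncons).
Qed.

Lemma measurable_section (f : 'rV[R]_(1 + n) -> R) x : B x ->
  measurable_fun Q f -> measurable_fun A (fun s => f (rV_cons (s, x))).
Proof.
move=> Bx mf; apply: (@measurable_comp _ _ _ _ _ _ Q) => //.
- exact: measurable_cyl_itv.
- by move=> _ [s As <-]; rewrite /Q /cyl /= lsubmx_rV_cons rsubmx_rV_cons.
apply: measurable_funTS; apply: measurableT_comp; first exact: measurable_rV_cons.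
exact: measurable_fun_pair.
Qed.

Lemma integrable_space (h : 'rV[R]_n -> R) :
  (leb R n).-integrable B (EFin \o h) ->
  (leb R (1 + n)).-integrable Q (fun y => (h (rsubmx y))%:E).
Proof.
move=> hi; have mh : measurable_fun B h by apply/measurable_EFinP; exact: measurable_int hi.
have := integrable_rV_cons (fun y : 'rV[R]_(1 + n) => h (rsubmx y)) measurable_cyl_itv.
move=> [_]; apply; rewrite rV_cons_cyl.
have mAB : measurable (A `*` B) by exact: measurableX.
have mhs : measurable_fun (A `*` B) (fun p : measurableTypeR R * 'rV[R]_n => h p.2).
  apply: (@measurable_comp _ _ _ _ _ _ B) => //.
    by move=> _ [p [_ Bp] <-].
  exact: measurable_funTS measurable_snd.
apply/(integrable_mkcond _ mAB).
rewrite (_ : _ \_ _ =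
    (fun p : measurableTypeR R * 'rV[R]_n => (h p.2)%:E) \_ (A `*` B)); last first.
  by congr patch; apply/funext => -[s x] /=; rewrite rsubmx_rV_cons.
apply/integrable12ltyP.
  apply/(measurable_restrictT _ mAB) => //; exact/measurable_EFinP.
apply: (@le_lt_trans _ _ (\int[mu]_(s in A) (cst (\int[leb R n]_(x in B) `|(h x)%:E|)) s)%E).
  rewrite [leRHS]integral_mkcond le_eqVlt; apply/orP; left; apply/eqP.
  apply: eq_integral => s _; rewrite [RHS]/patch; case: ifPn => As.
    rewrite [RHS]integral_mkcond; apply: eq_integral => x _.
    by rewrite /patch in_setX /= As /=; case: ifP => //; rewrite abse0.
  by apply: integral0_eq => x _; rewrite /patch in_setX /= (negbTE As) abse0.
have /integrableP[_ hoo] := hi.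
rewrite integral_cst// lte_mul_pinfty ?integral_ge0 ?ge0_fin_numE ?integral_ge0//.
Qed.

Lemma square_integrable_space v :
  square_integrable B v -> square_integrable Q (fun y => v (rsubmx y)).
Proof.
move=> [mv v2]; split; first exact: measurable_space.
exact: (integrable_space v2).
Qed.

Lemma continuous_bounded_itv (g : R -> R) : continuous g ->
  exists C, forall s, A s -> `|g s| <= C.
Proof.
move=> cg; have : bounded_set (g @` `[a, b]).
  apply: compact_bounded; apply: continuous_compact; last exact: segment_compact.
  exact: continuous_subspaceT.
move=> [M [Mreal MK]]; exists (M + 1) => s As.
apply: (MK (M + 1)) => /=; first by rewrite ltrDl.
by exists s => //; apply: subset_itv_oo_cc.
Qed.

Lemma square_integrable_tensor (v : 'rV[R]_n -> R) (g : R -> R) :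
  square_integrable B v -> continuous g ->
  square_integrable Q (fun y => v (rsubmx y) * g (lsubmx y 0 0)).
Proof.
move=> sv cg; have [C gC] := continuous_bounded_itv cg.
apply: (@square_integrable_bndM _ _ _ measurable_cyl_itv _ _ C).
- exact: square_integrable_space.
- exact: measurable_time.
- by move=> y [Ay _]; exact: gC.
Qed.

(** A test function of space-time restricts to test functions of space at each
    time, which gives the derivatives in space; its restriction to a line in time
    vanishes at both ends, and the derivative in time is an integration by parts
    on each line. *)
Lemma H1_tensor (v : 'rV[R]_n -> R) (g g' : R -> R) :
  (forall s, is_derive s (1 : R) g (g' s)) -> continuous g' -> H1 B v ->
  H1 Q (fun y => v (rsubmx y) * g (lsubmx y 0 0)).
Proof.
move=> dg cg' [sv dv].
have cg := is_derive_continuous dg.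
split; first exact: square_integrable_tensor.
have mQ := measurable_cyl_itv; have bQ := bounded_cyl_itv.
move=> i; have [j ->|->] := unliftP ord0 i.
  have [w sw vw] := dv j.
  exists (fun y => w (rsubmx y) * g (lsubmx y 0 0)); first exact: square_integrable_tensor.
  move=> chi tchi.
  rewrite (Rintegral_cyl12 mA mB); last first.
    by apply: (integrable_partial_mul _ _ _ (square_integrable_tensor sv cg) tchi).
  rewrite [X in _ = - X](Rintegral_cyl12 mA mB); last first.
    by apply: (integrable_test_mul _ _ (square_integrable_tensor sw cg) tchi).
  have tchis s := test_function_slice tchi s.
  rewrite -RintegralN; apply: eq_Rintegral => s _.
  under eq_Rintegral do rewrite lsubmx_rV_cons rsubmx_rV_cons /= -partial_sliceS mulrAC mulrC.
  rewrite RintegralZl//; last exact: (integrable_partial_mul _ _ _ sv (tchis s)).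
  under [X in _ = - X]eq_Rintegral do rewrite lsubmx_rV_cons rsubmx_rV_cons /= mulrAC mulrC.
  rewrite RintegralZl//; last exact: (integrable_test_mul _ _ sw (tchis s)).
  by rewrite (vw _ (tchis s)) mulrN.
exists (fun y => v (rsubmx y) * g' (lsubmx y 0 0)); first exact: square_integrable_tensor.
move=> chi tchi.
rewrite (Rintegral_cyl21 mA mB); last first.
  by apply: (integrable_partial_mul _ _ _ (square_integrable_tensor sv cg) tchi).
rewrite [X in _ = - X](Rintegral_cyl21 mA mB); last first.
  by apply: (integrable_test_mul _ _ (square_integrable_tensor sv cg') tchi).
rewrite -RintegralN; apply: eq_Rintegral => x _.
have cchi : continuous (fun s : R => chi (rV_cons (s, x))) by exact: (continuous_slice tchi (x := x)).
have cpchi : continuous (fun s : R => partial ord0 chi (rV_cons (s, x))).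
  exact: (continuous_partial_slice tchi (x := x) (i := ord0)).
have ci := @continuous_integrable_oo R a b.
under eq_Rintegral do rewrite lsubmx_rV_cons rsubmx_rV_cons /= -mulrA.
rewrite RintegralZl//; last first.
  by apply: ci => s; exact: (continuousM (cg s) (cpchi s)).
under [X in _ = - X]eq_Rintegral do rewrite lsubmx_rV_cons rsubmx_rV_cons /= -mulrA.
rewrite RintegralZl//; last first.
  by apply: ci => s; exact: (continuousM (cg' s) (cchi s)).
rewrite (Rintegral_by_parts0 _ _ ab dg cg' (is_derive_slice tchi x) cpchi) ?mulrN//.
- by apply: (slice_out tchi); rewrite /A /= in_itv /= ltxx.
- by apply: (slice_out tchi); rewrite /A /= in_itv /= ltxx andbF.
Qed.

Section time_average.
Variables (theta theta' : R -> R) (K : set R).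
Hypotheses (dtheta : forall s, is_derive s (1 : R) theta (theta' s))
  (ctheta' : continuous theta') (cK : compact K) (KA : K `<=` A)
  (theta0 : forall s, ~ K s -> theta s = 0).

Definition time_average (f : 'rV[R]_(1 + n) -> R) (x : 'rV[R]_n) : R :=
  \int[mu]_(s in A) (f (rV_cons (s, x)) * theta s).

Let ctheta : continuous theta.
Proof. exact: is_derive_continuous dtheta. Qed.

Let fthetai f : (leb R (1 + n)).-integrable Q (EFin \o f) ->
  (leb R (1 + n)).-integrable Q (fun y => (f y * theta (lsubmx y 0 0))%:E).
Proof.
move=> fi; have [C thetaC] := continuous_bounded_itv ctheta.
apply: (@integrable_bndM _ _ _ _ Q measurable_cyl_itv _ _ C) => //.
  exact: measurable_time.
by move=> y [Ay _]; exact: thetaC.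
Qed.

(** Fubini. The function is integrable on almost every line only, and the
    factor g x can be moved into the integral on these lines. *)
Let Rintegral_average f (g : 'rV[R]_n -> R) C :
  (leb R (1 + n)).-integrable Q (EFin \o f) ->
  measurable_fun B g -> (forall x, B x -> `|g x| <= C) ->
  \int[leb R n]_(x in B) (time_average f x * g x) =
  \int[leb R (1 + n)]_(y in Q) (f y * (theta (lsubmx y 0 0) * g (rsubmx y))).
Proof.
move=> fi mg gC.
have fgi : (leb R (1 + n)).-integrable Q
    (fun y => (f y * (theta (lsubmx y 0 0) * g (rsubmx y)))%:E).
  under eq_fun do rewrite mulrA.
  apply: (@integrable_bndM _ _ _ _ Q measurable_cyl_itv _ _ C) => //.
  - exact: fthetai.
  - exact: measurable_space.
  - by move=> y [_ By]; exact: gC.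
rewrite (Rintegral_cyl21 mA mB fgi); apply: ae_eq_in_Rintegral.
apply: filterS (ae_integrable_cyl mA mB (fthetai fi)) => x /= xi Bx; rewrite /time_average.
have {}xi : mu.-integrable A (fun s => (f (rV_cons (s, x)) * theta s)%:E).
  by apply: eq_integrable (xi Bx) => // s _; rewrite lsubmx_rV_cons.
rewrite -RintegralZr//; apply: eq_Rintegral => s _.
by rewrite lsubmx_rV_cons rsubmx_rV_cons /= mulrA.
Qed.

(** By Cauchy-Schwarz on each line, the square of the average is at most b - a
    times the integral of the square of the integrand, integrable by Fubini. *)
Let square_integrable_average f :
  square_integrable Q f -> square_integrable B (time_average f).
Proof.
move=> sf; have [mf f2] := sf.
have fi := square_integrable_integrable measurable_cyl_itv bounded_cyl_itv sf.
have [C thetaC] := continuous_bounded_itv ctheta.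
have sft : square_integrable Q (fun y => f y * theta (lsubmx y 0 0)).
  apply: (@square_integrable_bndM _ _ _ measurable_cyl_itv _ _ C) => //.
    exact: measurable_time.
  by move=> y [Ay _]; exact: thetaC.
have avgE : time_average f =
    fun x => \int[mu]_(s in A) (f (rV_cons (s, x)) *
      theta (lsubmx (rV_cons (s, x) : 'rV_(1 + n)) 0 0)).
  by apply/funext => x; apply: eq_Rintegral => s _; rewrite lsubmx_rV_cons.
have mavg : measurable_fun B (time_average f).
  rewrite avgE; apply/measurable_EFinP.
  exact: measurable_int (integrable_Rintegral_cyl mA mB (fthetai fi)).
split=> //.
have [msft sft2] := sft.
have Gi := integrable_integral_cyl mA mB sft2.
apply: (@le_integrable _ _ _ _ B mB _ (fun x => ((b - a)%:E *
  \int[mu]_(s in A) ((f (rV_cons (s, x)) *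
    theta (lsubmx (rV_cons (s, x) : 'rV_(1 + n)) 0 0)) ^+ 2)%:E)%E)) => //.
- by apply/measurable_EFinP; exact: measurable_funX.
- move=> x Bx; set J := integral _ _ _.
  have J0 : (0 <= J)%E by apply: integral_ge0 => s _; rewrite lee_fin sqr_ge0.
  have [Joo|Joo] := eqVneq J +oo%E.
    by rewrite Joo gt0_muley ?leey// lte_fin subr_gt0.
  have mfx := measurable_section Bx msft.
  have fx2 : mu.-integrable A (fun s => ((f (rV_cons (s, x)) *
      theta (lsubmx (rV_cons (s, x) : 'rV_(1 + n)) 0 0)) ^+ 2)%:E).
    apply/integrableP; split; first by apply/measurable_EFinP; exact: measurable_funX.
    under eq_integral do rewrite gee0_abs ?lee_fin ?sqr_ge0//.
    by rewrite ltey.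
  have muAf : fine (mu A) = b - a by rewrite muA.
  have := sqr_Rintegral_le mA muAoo mfx fx2; rewrite [fine (_ A)]muAf.
  have JE : J = (fine J)%:E by rewrite fineK// ge0_fin_numE// ltey.
  rewrite JE -EFinM !abse_EFin lee_fin ger0_norm ?sqr_ge0// => h.
  rewrite ger0_norm ?mulr_ge0 ?subr_ge0 ?(ltW ab)//; last exact: fine_ge0.
  by rewrite avgE.
- exact: integrableZl.
Qed.

(** Averaging in time commutes with weak derivatives in space: the tensor
    product of the weight with a test function is a test function. *)
Lemma H1_time_average f : H1 Q f -> H1 B (time_average f).
Proof.
move=> [sf df]; split; first exact: square_integrable_average.
have fi := square_integrable_integrable measurable_cyl_itv bounded_cyl_itv sf.
move=> j; have [w sw fw] := df (lift ord0 j).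
have wi := square_integrable_integrable measurable_cyl_itv bounded_cyl_itv sw.
exists (time_average w); first exact: square_integrable_average.
move=> eta teta.
have [C1 _ etaC] := test_function_bounded teta.
have [C2 _ petaC] := partial_bounded j teta.
rewrite (Rintegral_average fi (measurable_partial j teta) (fun x _ => petaC x)).
rewrite (Rintegral_average wi (measurable_test teta) (fun x _ => etaC x)).
have tchi := test_function_tensor dtheta ctheta' cK KA theta0 teta.
rewrite -(fw _ tchi); apply: eq_Rintegral => y _; congr (_ * _).
by rewrite -[y in RHS]rV_cons_submx (partial_tensorS theta teta).
Qed.

End time_average.
End space_time.

(** * Dual weights in time *)

Section dual_time_functions.
Context {R : realType}.
Notation mu := (@lebesgue_measure R).

Let pos (x : R) := (x + `|x|) / 2.

Let pos_ge x : 0 <= x -> pos x = x.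
Proof. by move=> x0; rewrite /pos ger0_norm//; lra. Qed.
Let pos_le x : x <= 0 -> pos x = 0.
Proof. by move=> x0; rewrite /pos ler0_norm//; lra. Qed.

Let continuous_pos : continuous pos.
Proof.
move=> x; apply: cvgM; last exact: cvg_cst.
by apply: cvgD; [exact: cvg_id|exact: norm_continuous].
Qed.

Let is_derive_pos2 x : is_derive x (1 : R) (fun y => pos y ^+ 2) (2 * pos x).
Proof.
have [x0|x0|->] := ltgtP x 0.
- rewrite pos_le ?ltW// mulr0.
  apply: (@near_eq_is_derive _ _ _ (cst 0)).
  near=> y; rewrite pos_le ?expr0n//.
  by apply/ltW; near: y; exact: lt_nbhsl.
- rewrite pos_ge ?ltW//.
  apply: (@near_eq_is_derive _ _ _ (fun y : R => y ^+ 2 : R)).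
  + near=> y; rewrite pos_ge//.
    by apply/ltW; near: y; exact: lt_nbhsr.
  + have := @is_deriveX _ _ (@id R) 2 x (1 : R) _ (@is_derive_id _ _ _ _).
    by rewrite /GRing.scale /= mulr1 expr1 mulr_natl.
- rewrite pos_ge// mulr0.
  have E : (fun h : R => h^-1 *: (((fun y => pos y ^+ 2) \o shift 0) (h *: (1 : R)) - pos 0 ^+ 2)) = pos.
    apply/funext => h; rewrite /GRing.scale /= mulr1 addr0 (pos_ge (lexx 0)) expr0n subr0.
    have [h0|h0|->] := ltgtP h 0.
    + by rewrite pos_le ?ltW// expr0n mulr0.
    + by rewrite pos_ge ?ltW// expr2 mulKf// gt_eqF.
    + by rewrite pos_ge// expr0n mulr0.
  have cv : pos h @[h --> 0^'] --> (0 : R).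
    rewrite -{2}(pos_ge (lexx 0)); apply: cvg_within_filter; exact: continuous_pos.
  apply: DeriveDef.
    by rewrite /derivable E; apply/cvg_ex; exists 0.
  by rewrite /derive E; exact: cvg_lim.
Unshelve. all: by end_near. Qed.

Lemma continuous_ge0_Rintegral_eq0 (f : R -> R) (a b : R) : a < b ->
  continuous f -> (forall s, 0 <= f s) ->
  \int[mu]_(s in `]a, b[) f s = 0 -> forall s, a < s < b -> f s = 0.
Proof.
move=> ab cf f0 If0 s0 s0ab; apply: contrapT => /eqP fs0.
have {}fs0 : 0 < f s0 by rewrite lt_neqAle eq_sym fs0 f0.
have mI : measurable (`]a, b[%classic : set (measurableTypeR R)) by exact: measurable_itv.
have fi := continuous_integrable_oo a b cf.
have ef0 : (\int[mu]_(s in `]a, b[) `|(f s)%:E|)%E = 0%E.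
  under eq_integral do rewrite gee0_abs ?lee_fin//.
  rewrite -[LHS]fineK; first by rewrite -/(Rintegral mu _ f) If0.
  exact: integrable_fin_num.
have mf : measurable_fun `]a, b[%classic (EFin \o f).
  by apply/measurable_EFinP; apply: measurable_funTS; exact: continuous_measurable_fun.
have /(ae_eq_integral_abs mu mI mf) [N [mN N0 subN]] := ef0.
have : nbhs s0 [set s | (a < s < b) /\ 0 < f s].
  near=> s; split.
    apply/andP; split; near: s; [apply: lt_nbhsr|apply: lt_nbhsl];
      by case/andP: s0ab.
  by near: s; exact: (cvgr_gt _ (cf s0)) fs0.
move=> /nbhs_ballP[e /= e0 es0].
have : (mu (ball s0 e) <= mu N)%E.
  apply: le_measure; rewrite ?inE//; first exact: measurable_ball.
  move=> s /es0[sab fs]; apply: subN => /= H.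
  have := H; rewrite in_itv /= sab => /(_ isT) [] /eqP.
  by rewrite gt_eqF.
rewrite N0 measure_le0 => /eqP B0.
have [/eqP] := etrans (esym B0) (lebesgue_measure_ball s0 (ltW e0)).
by rewrite eq_sym mulrn_eq0 /= gt_eqF.
Unshelve. all: by end_near. Qed.

Variables (a b : R) (ab : a < b).

Let a' := (3 * a + b) / 4.
Let b' := (a + 3 * b) / 4.
Let aa' : a < a'. Proof. by move: ab; rewrite /a'; lra. Qed.
Let ab' : a' < b'. Proof. by move: ab; rewrite /a' /b'; lra. Qed.
Let bb' : b' < b. Proof. by move: ab; rewrite /b'; lra. Qed.

(** Squared positive parts are C^1 with elementary derivatives. The bump lives on
    the middle half of the interval, so that its support is compact inside. *)
Let bump s := pos (s - a') ^+ 2 * pos (b' - s) ^+ 2.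
Let bump' s := 2 * pos (s - a') * pos (b' - s) ^+ 2
  - pos (s - a') ^+ 2 * (2 * pos (b' - s)).

Let is_derive_bump s : is_derive s (1 : R) bump (bump' s).
Proof.
have d1 : is_derive s (1 : R) (fun s => pos (s - a') ^+ 2) (2 * pos (s - a')).
  have dl : is_derive s (1 : R) (fun s => s - a') 1.
    by rewrite -[X in is_derive _ _ _ X]subr0; exact: is_deriveB.
  rewrite -[X in is_derive _ _ _ X]mulr1.
  exact: (@is_derive1_comp R _ (fun s => s - a') s _ _ (is_derive_pos2 _) dl).
have d2 : is_derive s (1 : R) (fun s => pos (b' - s) ^+ 2) (- (2 * pos (b' - s))).
  have dr : is_derive s (1 : R) (fun s => b' - s) (-1).
    by rewrite -[X in is_derive _ _ _ X]sub0r; exact: is_deriveB.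
  rewrite -[X in is_derive _ _ _ X]mulrN1.
  exact: (@is_derive1_comp R _ (fun s => b' - s) s _ _ (is_derive_pos2 _) dr).
refine (is_derive_eq (@is_deriveM _ _ _ _ s 1 _ _ d1 d2) _).
by rewrite /bump' /GRing.scale /=; ring.
Qed.

Let continuous_posl : continuous (fun s : R => pos (s - a')).
Proof.
move=> s; apply: (@continuous_comp _ _ _ (fun s : R => s - a') pos s); last exact: continuous_pos.
by apply: cvgB; [exact: cvg_id|exact: cvg_cst].
Qed.
Let continuous_posr : continuous (fun s : R => pos (b' - s)).
Proof.
move=> s; apply: (@continuous_comp _ _ _ (fun s : R => b' - s) pos s); last exact: continuous_pos.
by apply: cvgB; [exact: cvg_cst|exact: cvg_id].
Qed.

Let cl (s : R) : {for s, continuous (fun s : R => pos (s - a'))}.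
Proof. exact: continuous_posl. Qed.
Let cr (s : R) : {for s, continuous (fun s : R => pos (b' - s))}.
Proof. exact: continuous_posr. Qed.

Let continuous_bump' : continuous bump'.
Proof.
have c2 (s : R) : {for s, continuous (cst 2 : R -> R)} by exact: cst_continuous.
move=> s; exact: (continuousB (continuousM (continuousM (c2 s) (cl (s := s)))
    (continuousM (cr (s := s)) (cr (s := s))))
  (continuousM (continuousM (cl (s := s)) (cl (s := s))) (continuousM (c2 s) (cr (s := s))))).
Qed.

Let continuous_bump : continuous bump.
Proof.
move=> s; exact: (continuousM (continuousM (cl (s := s)) (cl (s := s)))
  (continuousM (cr (s := s)) (cr (s := s)))).
Qed.

Let bump_ge0 s : 0 <= bump s.
Proof. by rewrite mulr_ge0 ?sqr_ge0. Qed.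

Let bump_gt0 s : a' < s < b' -> 0 < bump s.
Proof.
move=> /andP[s1 s2]; rewrite /bump !pos_ge ?subr_ge0 ?ltW//.
by rewrite mulr_gt0// exprn_gt0// subr_gt0.
Qed.

Let bump_out s : ~ `[a', b']%classic s -> bump s = 0.
Proof.
rewrite /= in_itv /= => sab; have [s1|s1] := leP a' s; last first.
  by rewrite /bump pos_le ?subr_le0 ?ltW// expr0n mul0r.
have [s2|s2] := leP s b'; first by case: sab; rewrite s1 s2.
by rewrite /bump mulrC pos_le ?subr_le0 ?ltW// expr0n mul0r.
Qed.

Variable m : nat.

Let moment (k : nat) := \int[mu]_(s in `]a, b[) (s ^+ k * bump s).
Let gram : 'M[R]_m := \matrix_(i, j) moment (i + j).

Let continuous_poly_bump (p : {poly R}) : continuous (fun s => p.[s] * bump s).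
Proof.
move=> s; exact: (continuousM (@continuous_horner _ p s) (@continuous_bump s)).
Qed.

Let Rintegral_poly_bump (v : 'I_m -> R) (k : nat) :
  \int[mu]_(s in `]a, b[) (s ^+ k * ((\sum_(i < m) v i *: 'X^i).[s] * bump s)) =
  \sum_i v i * moment (i + k).
Proof.
have mI : measurable (`]a, b[%classic : set (measurableTypeR R)) by exact: measurable_itv.
transitivity (\int[mu]_(s in `]a, b[) \sum_i v i * (s ^+ (i + k) * bump s)).
  apply: eq_Rintegral => s _; rewrite horner_sum mulr_suml mulr_sumr.
  by apply: eq_bigr => i _; rewrite hornerZ hornerXn exprD; ring.
have mi i : mu.-integrable `]a, b[ (EFin \o (fun s => s ^+ (i + k) * bump s)).
  apply: continuous_integrable_oo; have := continuous_poly_bump (p := 'X^(i + k)).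
  by under eq_fun do rewrite hornerXn.
rewrite Rintegral_sum//.
  by apply: eq_bigr => i _; rewrite RintegralZl.
move=> i; apply: continuous_integrable_oo.
have := continuous_poly_bump (p := v i *: 'X^(i + k)).
by under eq_fun do rewrite hornerZ hornerXn -mulrA.
Qed.

(** The quadratic form of the Gram matrix is the integral of the square of a
    polynomial times the bump, so it is definite. *)
Let gram_unit : gram \in unitmx.
Proof.
rewrite -row_free_unit -kermx_eq0; apply/rowV0P => v /sub_kermxP vG.
pose p := \sum_(i < m) v 0 i *: 'X^i.
have sp : (size p <= m)%N.
  apply: (leq_trans (size_sum _ _ _)); apply/bigmax_leqP => i _.
  by apply: (leq_trans (size_scale_leq _ _)); rewrite size_polyXn.
have p0 : p = 0.
  apply: contrapT => /eqP pN0.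
  have Ip : \int[mu]_(s in `]a, b[) (p.[s] * (p.[s] * bump s)) = 0.
    have mI : measurable (`]a, b[%classic : set (measurableTypeR R)) by exact: measurable_itv.
    transitivity (\int[mu]_(s in `]a, b[) \sum_k v 0 k * (s ^+ k * (p.[s] * bump s))).
      apply: eq_Rintegral => s _; rewrite {1}/p horner_sum mulr_suml.
      by apply: eq_bigr => i _; rewrite hornerZ hornerXn -mulrA.
    have mi (k : 'I_m) : mu.-integrable `]a, b[ (EFin \o (fun s => s ^+ k * (p.[s] * bump s))).
      apply: continuous_integrable_oo; have := continuous_poly_bump (p := 'X^k * p).
      by under eq_fun do rewrite hornerM hornerXn -mulrA.
    rewrite Rintegral_sum//; last first.
      move=> k; apply: continuous_integrable_oo; have := continuous_poly_bump (p := v 0 k *: ('X^k * p)).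
      by under eq_fun do rewrite hornerZ hornerM hornerXn -!mulrA.
    apply: big1 => k _; rewrite RintegralZl// Rintegral_poly_bump.
    have := congr1 (fun w : 'rV_m => w 0 k) vG; rewrite !mxE => vGk.
    rewrite (_ : \sum_i _ = 0) ?mulr0//; rewrite -[RHS]vGk.
    by apply: eq_bigr => i _; rewrite mxE.
  have proot s : a' < s < b' -> root p s.
    move=> sab;
    have cpp : continuous (fun s => p.[s] * (p.[s] * bump s)).
      by move=> r; exact: (continuousM (@continuous_horner _ p r) (@continuous_poly_bump p r)).
    have pp0 r : 0 <= p.[r] * (p.[r] * bump r).
      by rewrite mulrA mulr_ge0// -expr2 sqr_ge0.
    have := continuous_ge0_Rintegral_eq0 ab cpp pp0 Ip (s := s).
    have /andP[s1 s2] := sab.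
    rewrite (lt_trans aa' s1) (lt_trans s2 bb') => /(_ isT) /eqP.
    by rewrite mulf_eq0 [X in _ || X]mulf_eq0 (gt_eqF (bump_gt0 sab)) orbF orbb.
  pose x (k : nat) := a' + (b' - a') * (k.+1%:R / m.+1%:R).
  have rs : all (root p) [seq x k | k <- iota 0 m].
    apply/allP => _ /mapP[k + ->]; rewrite mem_iota add0n => /= km; apply: proot.
    have k0 : 0 < k.+1%:R / m.+1%:R :> R by rewrite divr_gt0.
    have k1 : k.+1%:R / m.+1%:R < 1 :> R.
      by rewrite ltr_pdivrMr// mul1r ltr_nat ltnS.
    have ba : 0 < b' - a' by rewrite subr_gt0.
    by rewrite /x ltrDl mulr_gt0// -ltrBrDl gtr_pMr.
  have ux : uniq [seq x k | k <- iota 0 m].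
    rewrite map_inj_uniq ?iota_uniq// => k l /addrI /(mulfI _).
    have ba : b' - a' != 0 by rewrite subr_eq0 gt_eqF.
    move=> /(_ ba) /(mulIf _) h; have mN0 : (m.+1%:R : R)^-1 != 0 by rewrite invr_eq0 pnatr_eq0.
    by have /eqP := h mN0; rewrite eqr_nat => /eqP[].
  have := max_poly_roots pN0 rs ux; rewrite size_map size_iota.
  by rewrite ltnNge sp.
apply/rowP => i; rewrite mxE.
have := congr1 (fun q : {poly R} => q`_i) p0; rewrite coef0 /p coef_sum (bigD1 i)//=.
rewrite coefZ coefXn eqxx mulr1 big1 ?addr0// => j ji.
by rewrite coefZ coefXn eq_sym (negbTE (_ : (j != i :> nat))) ?mulr0//.
Qed.

(** The i-th weight is the bump times the polynomial whose coefficients are the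
    i-th row of the inverse of the Gram matrix of the monomials; its integral
    against a polynomial is the i-th coefficient. *)
Lemma dual_time_functions : exists (theta theta' : 'I_m -> R -> R) (K : set R),
  [/\ compact K, K `<=` `]a, b[%classic,
      forall i s, is_derive s (1 : R) (theta i) (theta' i s),
      forall i, continuous (theta' i) &
      (forall i s, ~ K s -> theta i s = 0) /\
      forall i j : 'I_m, \int[mu]_(s in `]a, b[) (s ^+ j * theta i s) = (i == j)%:R].
Proof.
pose p i := \sum_(k < m) invmx gram i k *: 'X^k.
exists (fun i s => (p i).[s] * bump s).
exists (fun i s => (p i)^`().[s] * bump s + (p i).[s] * bump' s).
exists `[a', b']%classic; split.
- exact: segment_compact.
- move=> s; rewrite /= !in_itv /= => /andP[s1 s2].
  by rewrite (lt_le_trans aa' s1) (le_lt_trans s2 bb').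
- move=> i s; refine (is_derive_eq
    (@is_deriveM _ _ _ _ s 1 _ _ (is_derive_poly (p i) s) (is_derive_bump s)) _).
  by rewrite /GRing.scale /=; ring.
- move=> i s; exact: (continuousD
    (continuousM (@continuous_horner _ ((p i)^`()) s) (@continuous_bump s))
    (continuousM (@continuous_horner _ (p i) s) (@continuous_bump' s))).
split; first by move=> i s sK; rewrite bump_out ?mulr0.
move=> i j; rewrite Rintegral_poly_bump.
have := congr1 (fun A : 'M[R]_m => A i j) (mulVmx gram_unit); rewrite !mxE => <-.
by apply: eq_bigr => k _; rewrite [gram _ _]mxE.
Qed.

End dual_time_functions.

(** * Polynomials of several variables *)

Section polynomial_functions.
Context {R : realType} {d : nat}.

(** Unlike the polynomials of degree at most k, these are closed under products
    and derivatives; measurability, boundedness and differentiability are then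
    proved by induction on the generation. *)
Inductive polyfun : ('rV[R]_d -> R) -> Prop :=
| polyfun_cst c : polyfun (fun=> c)
| polyfun_coord j : polyfun (fun x => x 0 j)
| polyfunD p q : polyfun p -> polyfun q -> polyfun (fun x => p x + q x)
| polyfunM p q : polyfun p -> polyfun q -> polyfun (fun x => p x * q x).

Lemma polyfun_sum I (s : seq I) (P : pred I) (p : I -> 'rV[R]_d -> R) :
  (forall i, polyfun (p i)) -> polyfun (fun x => \sum_(i <- s | P i) p i x).
Proof.
move=> pp; elim: s => [|i s IHs].
  by under eq_fun do rewrite big_nil; exact: polyfun_cst.
under eq_fun do rewrite big_cons.
by case: (P i) => //; exact: polyfunD.
Qed.

Lemma poly_le_polyfun k p : poly_le k p -> polyfun p.
Proof.
move=> [a pE]; have -> := funext pE; apply: polyfun_sum => al.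
apply: polyfunM; first exact: polyfun_cst.
elim: (index_enum _) => [|i s IHs].
  by under eq_fun do rewrite big_nil; exact: polyfun_cst.
under eq_fun do rewrite big_cons; apply: polyfunM => //.
elim: (nat_of_ord (al i)) => [|e IHe].
  by under eq_fun do rewrite expr0; exact: polyfun_cst.
under eq_fun do rewrite exprS; apply: polyfunM => //; exact: polyfun_coord.
Qed.

Lemma measurable_polyfun p (D : set 'rV[R]_d) : polyfun p -> measurable_fun D p.
Proof.
move=> pp; apply: (@measurable_funS _ _ _ _ setT) => //.
elim: pp => [c|j|{}p q _ mp _ mq|{}p q _ mp _ mq].
- exact: measurable_cst.
- exact: measurable_rV_coord.
- exact: measurable_funD.
- exact: measurable_funM.
Qed.

Lemma polyfun_bounded p (D : set 'rV[R]_d) : bounded_set D -> polyfun p ->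
  exists C, forall x, D x -> `|p x| <= C.
Proof.
move=> /bounded_rV_box[C DC].
elim=> [c|j|{}p q _ [C1 h1] _ [C2 h2]|{}p q _ [C1 h1] _ [C2 h2]].
- by exists `|c|.
- by exists C => x Dx; rewrite ler_norml; exact: DC.
- exists (C1 + C2) => x Dx; apply: le_trans (ler_normD _ _) _.
  by apply: lerD; [exact: h1|exact: h2].
- exists (C1 * C2) => x Dx; rewrite normrM.
  by apply: ler_pM => //; [exact: h1|exact: h2].
Qed.

Lemma polyfun_is_derive p j : polyfun p ->
  exists2 q, polyfun q & forall x, is_derive x (delta_mx 0 j) p (q x).
Proof.
elim=> [c|l|{}p q pp [p' pp' dp] pq [q' pq' dq]|{}p q pp [p' pp' dp] pq [q' pq' dq]].
- exists (fun=> 0); first exact: polyfun_cst.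
  by move=> x; exact: is_derive_cst.
- exists (fun=> (l == j)%:R); first exact: polyfun_cst.
  move=> x; have E h : (fun x : 'rV[R]_d => x 0 l) (h *: delta_mx 0 j + x) =
      (fun s : R => (l == j)%:R * s + x 0 l) (h *: (1 : R) + 0).
    by rewrite /= !mxE /GRing.scale /= addr0 mulr1 ?eqxx /= mulrC.
  have dl : is_derive (0 : R) (1 : R) (fun s : R => (l == j)%:R * s + x 0 l) ((l == j)%:R).
    rewrite -[X in is_derive _ _ _ X]addr0 -[X in is_derive _ _ _ (X + _)]mulr1.
    by apply: is_deriveD; exact: is_deriveZ.
  apply: DeriveDef; first exact: (derivable_line E (@ex_derive _ _ _ _ _ _ _ dl)).
  exact: (etrans (derive_line E) (@derive_val _ _ _ _ _ _ _ dl)).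
- exists (fun x => p' x + q' x); first exact: polyfunD.
  by move=> x; exact: (@is_deriveD _ _ _ _ _ _ _ _ _ (dp x) (dq x)).
- exists (fun x => p x * q' x + q x * p' x); first by apply: polyfunD; exact: polyfunM.
  by move=> x; exact: (@is_deriveM _ _ _ _ _ _ _ _ (dp x) (dq x)).
Qed.

Lemma poly_le_cst k c : poly_le k (fun _ : 'rV[R]_d => c).
Proof.
pose z : {ffun 'I_d -> 'I_k.+1} := [ffun=> ord0].
exists (fun al => if al == z then c else 0) => x.
have z0 : (\sum_i z i <= k)%N by rewrite big1// => i _; rewrite ffunE.
rewrite (bigD1 z)//= eqxx big1 ?mulr1; last by move=> i _; rewrite ffunE expr0.
by rewrite big1 ?addr0// => al /andP[_ /negbTE ->]; rewrite mul0r.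
Qed.

Lemma poly_le_sum k I (s : seq I) (p : I -> 'rV[R]_d -> R) :
  (forall i, poly_le k (p i)) -> poly_le k (fun x => \sum_(i <- s) p i x).
Proof.
move=> pp; have [a aE] : exists a, forall i x, p i x =
    \sum_(al : {ffun 'I_d -> 'I_k.+1} | (\sum_i al i <= k)%N)
      a i al * \prod_i x 0 i ^+ al i.
  exists (fun i => sval (cid (pp i))) => i x; exact: (svalP (cid (pp i))).
exists (fun al => \sum_(i <- s) a i al) => x.
under eq_bigr do rewrite aE; rewrite exchange_big; apply: eq_bigr => al _.
by rewrite mulr_suml.
Qed.

Lemma poly_leZ k c p : poly_le k p -> poly_le k (fun x : 'rV[R]_d => c * p x).
Proof.
move=> [a pE]; exists (fun al => c * a al) => x.
by rewrite pE mulr_sumr; apply: eq_bigr => al _; rewrite mulrA.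
Qed.

End polynomial_functions.

(** * The mesh skeleton *)

Section simplices.
Context {R : realType} {d : nat}.
Variable p : 'I_d.+1 -> 'rV[R]_d.
Hypothesis pind : affinely_independent p.

Let E : 'M[R]_d := \matrix_(j < d) (p (lift ord0 j) - p ord0).
Let Eu : E \in unitmx. Proof. by rewrite -row_free_unit. Qed.

(** Barycentric coordinates, the one of p ord0 being left out. *)
Let bary (x : 'rV[R]_d) (j : 'I_d) : R := ((x - p ord0) *m invmx E) 0 j.

Let simplex_bary x : simplex p x ->
  (forall j, 0 <= bary x j) /\ \sum_j bary x j <= 1.
Proof.
move=> [l [l0 _ l1] xl].
have bE j : bary x j = l (lift ord0 j).
  pose l' : 'rV[R]_d := \row_j l (lift ord0 j).
  have -> : l (lift ord0 j) = (l' *m E *m invmx E) 0 j by rewrite mulmxK// mxE.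
  rewrite /bary; congr ((_ *m _) 0 j); rewrite xl big_ord_recl.
  rewrite (_ : p ord0 = (l ord0 + \sum_(i < d) l (lift ord0 i)) *: p ord0); last first.
    by rewrite -big_ord_recl l1 scale1r.
  rewrite [in X in _ - X]scalerDl scaler_suml opprD addrACA.
  rewrite (_ : l ord0 *: ((l ord0 + _) *: _) = l ord0 *: p ord0); last first.
    by rewrite -big_ord_recl l1 scale1r.
  rewrite subrr add0r -sumrB mulmx_sum_row; apply: eq_bigr => i _.
  by rewrite rowK mxE scalerBr.
split; first by move=> j; rewrite bE.
under eq_bigr do rewrite bE.
by move: l1; rewrite big_ord_recl => <-; rewrite lerDr.
Qed.

(* conversely, nonnegative coordinates of sum at most 1 give the missing one *)
Let bary_simplex x : (forall j, 0 <= bary x j) -> \sum_j bary x j <= 1 ->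
  simplex p x.
Proof.
move=> b0 b1.
pose l (i : 'I_d.+1) := if unlift ord0 i is Some j then bary x j
  else 1 - \sum_j bary x j.
have lS j : l (lift ord0 j) = bary x j by rewrite /l liftK.
have l0 : l ord0 = 1 - \sum_j bary x j by rewrite /l unlift_none.
exists l.
  split.
  - move=> i; have [j ->|->] := unliftP ord0 i; first by rewrite lS.
    by rewrite l0 subr_ge0.
  - by move=> j; rewrite inE.
  - by rewrite big_ord_recl l0; under [X in _ + X]eq_bigr do rewrite lS; rewrite subrK.
rewrite big_ord_recl l0; under [X in _ + X]eq_bigr do rewrite lS.
have : (x - p ord0) *m invmx E *m E = x - p ord0 by rewrite mulmxKV.
rewrite mulmx_sum_row => h.
have {}h : \sum_j bary x j *: (p (lift ord0 j) - p ord0) = x - p ord0.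
  by rewrite -h; apply: eq_bigr => j _; rewrite rowK.
rewrite scalerBl scale1r scaler_suml -addrA -sumrN -big_split /=.
rewrite (eq_bigr (fun j => bary x j *: (p (lift ord0 j) - p ord0))).
  by rewrite h addrC subrK.
by move=> j _; rewrite scalerBr addrC.
Qed.

Let bary_affine x j :
  bary x j = \sum_i invmx E i j * x 0 i - \sum_i invmx E i j * p ord0 0 i.
Proof.
rewrite /bary mxE -sumrB; apply: eq_bigr => i _; rewrite !mxE.
by rewrite mulrC mulrBr.
Qed.

Let bary_sum_affine x : \sum_j bary x j =
  \sum_i (\sum_j invmx E i j) * x 0 i -
  \sum_j \sum_i invmx E i j * p ord0 0 i.
Proof.
under eq_bigr do rewrite bary_affine; rewrite sumrB exchange_big /=.
by under eq_bigr do rewrite -mulr_suml.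
Qed.

Let continuous_affine (a : 'I_d -> R) (b : R) :
  continuous (fun x : 'rV[R]_d => \sum_i a i * x 0 i - b).
Proof.
have cs (s : seq 'I_d) : continuous (fun x : 'rV[R]_d => \sum_(i <- s) a i * x 0 i).
  elim: s => [|i s IHs].
    by under eq_fun do rewrite big_nil; exact: cst_continuous.
  under eq_fun do rewrite big_cons.
  move=> x; have c1 : {for x, continuous (fun _ : 'rV[R]_d => a i)} by exact: cst_continuous.
  have c2 : {for x, continuous (fun x : 'rV[R]_d => x 0 i)} by exact: coord_continuous.
  exact: (continuousD (continuousM c1 c2) (IHs x)).
move=> x; have c1 : {for x, continuous (fun _ : 'rV[R]_d => b)} by exact: cst_continuous.
exact: (continuousB (cs _ x) c1).
Qed.

Let bary_interior x : (forall j, 0 < bary x j) -> \sum_j bary x j < 1 ->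
  interior (simplex p) x.
Proof.
move=> b0 b1.
have cb j : continuous (bary^~ j).
  under eq_fun do rewrite bary_affine; exact: continuous_affine.
have cs : continuous (fun x => \sum_j bary x j).
  under eq_fun do rewrite bary_sum_affine; exact: continuous_affine.
have Hj : \forall y \near x, forall j, 0 < bary y j.
  apply: (@filter_forall _ _ (fun j y => 0 < bary y j) (nbhs x)) => j.
  exact: (cvgr_gt _ (cb j x)) (b0 j).
have Hs : \forall y \near x, \sum_j bary y j < 1 by exact: (cvgr_lt _ (cs x)) b1.
rewrite /interior; apply: filterS2 Hj Hs => y y0 y1; apply: bary_simplex.
  by move=> j; exact/ltW.
exact/ltW.
Qed.

Let hyperplane_ae (a : 'I_d -> R) (b : R) : (exists j, a j != 0) ->
  {ae leb R d, forall x : 'rV[R]_d, \sum_j a j * x 0 j != b}.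
Proof.
move=> aN0; exists [set x : 'rV[R]_d | \sum_j a j * x 0 j = b]; split.
- exact: measurable_hyperplane.
- exact: hyperplane_null.
- by move=> x /= /negP; rewrite negbK => /eqP.
Qed.

Let mulEV i j : \sum_l E i l * invmx E l j = (i == j)%:R.
Proof.
by have := congr1 (fun A : 'M[R]_d => A i j) (mulmxV Eu); rewrite !mxE.
Qed.

(** A point of a simplex that is not interior has a vanishing barycentric
    coordinate, and so lies on one of finitely many hyperplanes. *)
Lemma simplex_interior_ae : (0 < d)%N ->
  {ae leb R d, forall x, simplex p x -> interior (simplex p) x}.
Proof.
move=> d0.
have Hj : {ae leb R d, forall x, forall j, bary x j != 0}.
  apply: (@filter_forall _ _ (fun j x => bary x j != 0)) => j.
  have aN0 : exists i, invmx E i j != 0.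
    apply: contrapT => a0; have := mulEV j j; rewrite big1 ?eqxx.
      by move=> /eqP; rewrite eq_sym oner_eq0.
    move=> l _; have [->|lN0] := eqVneq (invmx E l j) 0; first by rewrite mulr0.
    by exfalso; apply: a0; exists l.
  apply: filterS (hyperplane_ae (\sum_i invmx E i j * p ord0 0 i) aN0) => x.
  by rewrite bary_affine subr_eq0.
have Hs : {ae leb R d, forall x, \sum_j bary x j != 1}.
  pose a i := \sum_j invmx E i j.
  pose j0 := Ordinal d0.
  have aN0 : exists i, a i != 0.
    apply: contrapT => a0.
    have : \sum_l E j0 l * a l = 1.
      under eq_bigr do rewrite /a mulr_sumr; rewrite exchange_big /=.
      under eq_bigr do rewrite mulEV.
      by rewrite (bigD1 j0)//= ?eqxx big1 ?addr0// => j; rewrite eq_sym => /negbTE ->.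
    rewrite big1; first by move=> /eqP; rewrite eq_sym oner_eq0.
    move=> l _; have [->|lN0] := eqVneq (a l) 0; first by rewrite mulr0.
    by exfalso; apply: a0; exists l.
  apply: filterS (hyperplane_ae (1 + \sum_j \sum_i invmx E i j * p ord0 0 i) aN0) => x.
  by rewrite bary_sum_affine subr_eq.
apply: filterS2 Hj Hs => x bN0 sN1 /simplex_bary[b0 b1].
apply: bary_interior => [j|]; rewrite lt_neqAle.
  by rewrite eq_sym bN0 b0.
by rewrite sN1 b1.
Qed.

End simplices.

(** * Finite element spaces *)

Section finite_element_spaces.
Context {R : realType} {d M : nat}.
Variables (Omega : set 'rV[R]_d) (P : 'I_M -> 'I_d.+1 -> 'rV[R]_d).
Hypotheses (d0 : (0 < d)%N) (bdO : bounded_domain Omega)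
  (trP : conforming_triangulation Omega P).
Notation mu := (@lebesgue_measure R).

(** Where the discrete functions are polynomials and classically
    differentiable; the rest of the domain, the mesh skeleton, is null. *)
Definition mesh_interior : set 'rV[R]_d :=
  \bigcup_(a in [set: 'I_M]) interior (simplex (P a)).
Local Notation G := mesh_interior.

Lemma open_mesh_interior : open G.
Proof. by apply: bigcup_open => a _; exact: open_interior. Qed.

Lemma measurable_mesh_interior : measurable G.
Proof. exact: open_measurable_rV open_mesh_interior. Qed.

Lemma mesh_interior_sub : G `<=` Omega.
Proof. by case: trP => _ _ _ h _; move=> x [a _]; exact: h. Qed.

Lemma measurable_domain : measurable Omega.
Proof. by case: bdO => oO _ _ _; exact: open_measurable_rV. Qed.

Lemma bounded_mesh_interior : bounded_set G.
Proof.
case: bdO => _ _ [C [Creal CO]] _; exists C; split => // D CD x Gx.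
by apply: CO => //; exact: mesh_interior_sub.
Qed.

Lemma mesh_interior_ae : {ae leb R d, forall x, Omega x -> G x}.
Proof.
have [pind _ clO _ _] := trP.
have H : {ae leb R d, forall x, forall a, simplex (P a) x -> interior (simplex (P a)) x}.
  apply: (@filter_forall _ _ (fun a x => simplex (P a) x -> interior (simplex (P a)) x)) => a.
  exact: simplex_interior_ae.
apply: filterS H => x H /subset_closure; rewrite clO => -[a _ /H ?].
by exists a.
Qed.

Lemma Rintegral_mesh (f : 'rV[R]_d -> R) :
  \int[leb R d]_(x in Omega) f x = \int[leb R d]_(x in G) f x.
Proof.
apply: ae_eq_Rintegral; apply: filterS mesh_interior_ae => x OG.
rewrite /patch; congr (if _ then _ else _); apply: asbool_equiv_eq.
by split; [exact: OG|exact: mesh_interior_sub].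
Qed.

Lemma integral_mesh (f : 'rV[R]_d -> \bar R) :
  (\int[leb R d]_(x in Omega) f x = \int[leb R d]_(x in G) f x)%E.
Proof.
apply: ae_eq_integral_nm; apply: filterS mesh_interior_ae => x OG.
rewrite /patch; congr (if _ then _ else _); apply: asbool_equiv_eq.
by split; [exact: OG|exact: mesh_interior_sub].
Qed.

Definition pwpoly (f : 'rV[R]_d -> R) :=
  forall a, exists2 p, polyfun p & forall x, interior (simplex (P a)) x -> f x = p x.

Lemma pwpoly_fe k v : fe_space Omega P k v -> pwpoly v.
Proof.
move=> [_ h] a; have [p pk vp] := h a; exists p => //; exact: poly_le_polyfun pk.
Qed.

Lemma pwpoly_cst c : pwpoly (fun=> c).
Proof. by move=> a; exists (fun=> c) => //; exact: polyfun_cst. Qed.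

Lemma pwpolyM f g : pwpoly f -> pwpoly g -> pwpoly (fun x => f x * g x).
Proof.
move=> pf pg a; have [p pp fp] := pf a; have [q pq gq] := pg a.
by exists (fun x => p x * q x) => [|x xa]; [exact: polyfunM|rewrite fp ?gq].
Qed.

Lemma pwpoly_sum I (s : seq I) (f : I -> 'rV[R]_d -> R) :
  (forall i, pwpoly (f i)) -> pwpoly (fun x => \sum_(i <- s) f i x).
Proof.
move=> pf; elim: s => [|i s IHs].
  by under eq_fun do rewrite big_nil; exact: pwpoly_cst.
under eq_fun do rewrite big_cons.
move=> a; have [p pp fp] := pf i a; have [q pq gq] := IHs a.
by exists (fun x => p x + q x) => [|x xa]; [exact: polyfunD|rewrite fp ?gq].
Qed.

Lemma pwpoly_eq f g : (forall x, G x -> f x = g x) -> pwpoly g -> pwpoly f.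
Proof.
move=> fg pg a; have [p pp gp] := pg a; exists p => // x xa.
by rewrite fg ?gp//; exists a.
Qed.

Lemma pwpoly_is_derive f j x : pwpoly f -> G x ->
  is_derive x (delta_mx 0 j) f (partial j f x).
Proof.
move=> pf [a _ xa]; have [p pp fp] := pf a; have [q _ dp] := polyfun_is_derive j pp.
apply: derivableP; have [+ _] : is_derive x (delta_mx 0 j) f (q x).
  apply: near_eq_is_derive (dp x).
  by apply: filterS (open_nbhs_nbhs (conj (@open_interior _ _) xa)) => y /fp.
exact.
Qed.

Lemma pwpoly_partial f j : pwpoly f -> pwpoly (partial j f).
Proof.
move=> pf a; have [p pp fp] := pf a; have [q pq dp] := polyfun_is_derive j pp.
exists q => // x xa; have [_] : is_derive x (delta_mx 0 j) f (q x).
  apply: near_eq_is_derive (dp x).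
  by apply: filterS (open_nbhs_nbhs (conj (@open_interior _ _) xa)) => y /fp.
exact.
Qed.

Lemma partial_eq f g j x : (forall y, G y -> f y = g y) -> G x ->
  partial j f x = partial j g x.
Proof.
move=> fg Gx; apply: near_eq_derive.
by apply: filterS (open_nbhs_nbhs (conj open_mesh_interior Gx)) => y /fg.
Qed.

Lemma partial_sum I (s : seq I) (f : I -> 'rV[R]_d -> R) (c : I -> R) j x :
  (forall i, pwpoly (f i)) -> G x ->
  partial j (fun y => \sum_(i <- s) f i y * c i) x =
  \sum_(i <- s) partial j (f i) x * c i.
Proof.
move=> pf Gx.
suff [_] : is_derive x (delta_mx 0 j) (fun y => \sum_(i <- s) f i y * c i)
    (\sum_(i <- s) partial j (f i) x * c i) by exact.
elim: s => [|i s IHs].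
  under eq_fun do rewrite big_nil.
  by rewrite big_nil; exact: is_derive_cst.
under eq_fun do rewrite big_cons; rewrite big_cons.
have dfi : is_derive x (delta_mx 0 j) (fun y => f i y * c i) (partial j (f i) x * c i).
  have -> : (fun y => f i y * c i) = c i \*: f i by apply/funext => y; rewrite mulrC.
  by rewrite mulrC; apply: is_deriveZ; exact: pwpoly_is_derive.
exact: is_deriveD.
Qed.

Lemma measurable_pwpoly f : pwpoly f -> measurable_fun G f.
Proof.
move=> pf mG Y mY.
rewrite /mesh_interior setI_bigcupl; apply: countable_bigcupT_measurable => // a.
have [p pp fp] := pf a.
rewrite (_ : _ `&` _ = interior (simplex (P a)) `&` p @^-1` Y).
  apply: measurable_polyfun pp _ _ mY.
  by apply: open_measurable_rV; exact: open_interior.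
by apply/seteqP; split => x [xa] /= h; split => //=; [rewrite -fp|rewrite fp].
Qed.

Lemma pwpoly_bounded f : pwpoly f -> exists C, forall x, G x -> `|f x| <= C.
Proof.
move=> pf; have H (a : 'I_M) : exists C, forall x, interior (simplex (P a)) x -> `|f x| <= C.
  have [p pp fp] := pf a.
  have [C pC] := polyfun_bounded bounded_mesh_interior pp.
  by exists C => x xa; rewrite fp//; apply: pC; exists a.
pose C a := sval (cid (H a)).
exists (\sum_a `|C a|) => x [a _ xa].
apply: le_trans (svalP (cid (H a)) x xa) _.
apply: le_trans (ler_norm _) _; rewrite (bigD1 a)//= lerDl.
by apply: sumr_ge0.
Qed.

Lemma fe_space_cst k c : fe_space Omega P k (fun=> c).
Proof.
split.
  case: bdO => _ _ bO _; exact: (H1_cst measurable_domain bO).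
by move=> a; exists (fun=> c) => //; exact: poly_le_cst.
Qed.

Lemma fe_spaceZ k c v : fe_space Omega P k v -> fe_space Omega P k (fun x => c * v x).
Proof.
move=> [Hv pv]; split.
  by case: bdO => _ _ bO _; exact: (H1Z measurable_domain bO).
move=> a; have [p pk vp] := pv a; exists (fun x => c * p x); first exact: poly_leZ.
by move=> x xa; rewrite vp.
Qed.

Lemma fe_space_sum k I (s : seq I) (v : I -> 'rV[R]_d -> R) :
  (forall i, fe_space Omega P k (v i)) ->
  fe_space Omega P k (fun x => \sum_(i <- s) v i x).
Proof.
move=> fv; split.
  case: bdO => _ _ bO _; apply: (H1_sum measurable_domain bO) => i.
  by case: (fv i).
move=> a; have H i : exists2 p, poly_le k p &
    forall x, interior (simplex (P a)) x -> v i x = p x by case: (fv i).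
exists (fun x => \sum_(i <- s) s2val (cid2 (H i)) x).
  by apply: poly_le_sum => i; exact: (s2valP (cid2 (H i))).
move=> x xa; apply: eq_bigr => i _; exact: (s2valP' (cid2 (H i))).
Qed.

Section slab.
Variables (k r : nat) (t0 t1 : R).
Hypothesis t01 : t0 < t1.

Let cylE : cylinder Omega t0 t1 = cyl `]t0, t1[%classic Omega.
Proof. by apply/seteqP; split => y; rewrite /cylinder /cyl /= in_itv /=. Qed.

(** The polynomials in time of the various elements have coefficients given by
    one formula, an average in time against the dual weights; and averaging
    preserves weak differentiability, across the elements too. *)
Lemma st_space_coefficients v : st_space Omega P k r t0 t1 v ->
  exists2 c : 'I_r -> 'rV[R]_d -> R, forall j, fe_space Omega P k (c j) &
    forall s x, t0 <= s < t1 -> G x -> v s x = \sum_(j < r) c j x * s ^+ j.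
Proof.
move=> [Hv pv]; have [_ _ bO _] := bdO.
have [theta [theta' [K [cK KI dtheta ctheta' [theta0 dual]]]]] :=
  dual_time_functions t01 r.
pose c j := time_average t0 t1 (theta j)
  (fun y : 'rV[R]_(1 + d) => v (lsubmx y 0 0) (rsubmx y)).
have ctheta j := is_derive_continuous (dtheta j).
have cE (ca : 'I_r -> 'rV[R]_d -> R) x j :
    (forall s, t0 <= s < t1 -> v s x = \sum_(l < r) ca l x * s ^+ l) ->
    c j x = ca j x.
  move=> vE; rewrite /c /time_average.
  have mI : measurable (`]t0, t1[%classic : set (measurableTypeR R)) by exact: measurable_itv.
  transitivity (\int[mu]_(s in `]t0, t1[) \sum_(l < r) ca l x * (s ^+ l * theta j s)).
    apply: eq_Rintegral => s; rewrite inE /= in_itv /= => /andP[s1 s2].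
    rewrite lsubmx_rV_cons rsubmx_rV_cons /= vE ?(ltW s1)// mulr_suml.
    by apply: eq_bigr => l _; rewrite mulrA.
  have ci := @continuous_integrable_oo R t0 t1.
  have cst (l : nat) : continuous (fun s : R => s ^+ l * theta j s).
    move=> s; exact: (continuousM (@exprn_continuous _ l s) (ctheta j s)).
  rewrite Rintegral_sum//.
    rewrite (bigD1 j)//= big1 ?addr0.
      by rewrite RintegralZl ?dual ?eqxx ?mulr1//; exact: ci.
    move=> l lj; rewrite RintegralZl ?dual; last 2 first.
    - by [].
    - exact: ci.
    by rewrite eq_sym (negbTE lj) mulr0.
  move=> l; apply: ci => s.
  have c1 : {for s, continuous (fun _ : R => ca l x)} by exact: cst_continuous.
  exact: (continuousM c1 (@cst l s)).
exists c.
  move=> j; split.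
    apply: (H1_time_average t01 measurable_domain bO (dtheta j) (ctheta' j)
      cK KI (theta0 j)).
    by rewrite -cylE.
  move=> a; have [ca cak vE] := pv a; exists (ca j) => // x xa.
  by apply: (cE ca) => s s01; exact: vE.
move=> s x s01 [a _ xa]; have [ca cak vE] := pv a.
rewrite vE//; apply: eq_bigr => j _; congr (_ * _).
by apply/esym; apply: (cE ca) => s' s01'; exact: vE.
Qed.

(** Builds test functions for the scheme: constants, and the time derivative of
    the potential, whose coefficients are multiples of those of the potential. *)
Lemma st_space_of_coefficients (c : 'I_r -> 'rV[R]_d -> R) :
  (forall j, fe_space Omega P k (c j)) ->
  st_space Omega P k r t0 t1 (fun s x => \sum_(j < r) c j x * s ^+ j).
Proof.
move=> fc; have [_ _ bO _] := bdO; split.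
  rewrite cylE; apply: H1_sum.
  - exact: (measurable_cyl_itv _ _ measurable_domain).
  - exact: (bounded_cyl_itv _ _ bO).
  move=> j; case: (fc j) => Hc _.
  have dX s : is_derive s (1 : R) (fun s => s ^+ j) (('X^j)^`().[s] : R).
    have -> : (fun s : R => s ^+ j) = horner 'X^j by apply/funext => y; rewrite hornerXn.
    exact: is_derive_poly.
  apply: (H1_tensor t01 measurable_domain bO dX _ Hc).
  exact: continuous_horner.
move=> a; have H j : exists2 p, poly_le k p &
    forall x, interior (simplex (P a)) x -> c j x = p x by case: (fc j).
exists (fun j => s2val (cid2 (H j))).
  by move=> j; exact: (s2valP (cid2 (H j))).
move=> s x _ xa; apply: eq_bigr => j _; congr (_ * _).
exact: (s2valP' (cid2 (H j))).
Qed.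

End slab.

End finite_element_spaces.

(** * Bounded measurable functions *)

Section bounded_measurable_functions.
Context d (T : measurableType d) (R : realType).
Variables (D : set T) (mD : measurable D).
Implicit Types f g : T -> R.

(** Discrete functions and their exponentials all belong to this algebra, on
    domains of finite measure: integrability is read off the form of the
    integrand, and only the fixed charge and the initial densities, which may be
    unbounded, need another argument. *)
Definition bounded_measurable f :=
  measurable_fun D f /\ exists C, forall x, D x -> `|f x| <= C.

Lemma bmeas_eq f g : (forall x, D x -> f x = g x) ->
  bounded_measurable g -> bounded_measurable f.
Proof.
move=> fg [mg [C gC]]; split.
  by apply: eq_measurable_fun mg => x /set_mem /fg.
by exists C => x Dx; rewrite fg ?gC.
Qed.

Lemma bmeas_cst c : bounded_measurable (fun=> c).
Proof. by split; [exact: measurable_cst|exists `|c|]. Qed.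

Lemma bmeasD f g : bounded_measurable f -> bounded_measurable g ->
  bounded_measurable (fun x => f x + g x).
Proof.
move=> [mf [C fC]] [mg [C' gC]]; split; first exact: measurable_funD.
exists (C + C') => x Dx; apply: le_trans (ler_normD _ _) _.
by apply: lerD; [exact: fC|exact: gC].
Qed.

Lemma bmeasM f g : bounded_measurable f -> bounded_measurable g ->
  bounded_measurable (fun x => f x * g x).
Proof.
move=> [mf [C fC]] [mg [C' gC]]; split; first exact: measurable_funM.
exists (C * C') => x Dx; rewrite normrM.
by apply: ler_pM => //; [exact: fC|exact: gC].
Qed.

Lemma bmeasN f : bounded_measurable f -> bounded_measurable (fun x => - f x).
Proof.
by move=> bf; apply: bmeas_eq (bmeasM (bmeas_cst (-1)) bf) => x _; rewrite mulN1r.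
Qed.

Lemma bmeasB f g : bounded_measurable f -> bounded_measurable g ->
  bounded_measurable (fun x => f x - g x).
Proof. by move=> bf bg; apply: bmeasD => //; exact: bmeasN. Qed.

Lemma bmeas_sum I (s : seq I) (f : I -> T -> R) :
  (forall i, bounded_measurable (f i)) ->
  bounded_measurable (fun x => \sum_(i <- s) f i x).
Proof.
move=> bf; elim: s => [|i s IHs].
  by under eq_fun do rewrite big_nil; exact: bmeas_cst.
by under eq_fun do rewrite big_cons; exact: bmeasD.
Qed.

Lemma bmeas_expR f : bounded_measurable f -> bounded_measurable (fun x => expR (f x)).
Proof.
move=> [mf [C fC]]; split; first exact: measurableT_comp.
exists (expR C) => x Dx; rewrite ger0_norm ?expR_ge0// ler_expR.
exact: le_trans (ler_norm _) (fC x Dx).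
Qed.

Variable mu : {measure set T -> \bar R}.

Lemma bmeas_integrable f : (mu D < +oo)%E -> bounded_measurable f ->
  mu.-integrable D (EFin \o f).
Proof. by move=> Doo [mf [C fC]]; exact: integrable_bnd fC. Qed.

Lemma integrable_bmeasM f g : mu.-integrable D (EFin \o f) ->
  bounded_measurable g -> mu.-integrable D (fun x => (f x * g x)%:E).
Proof. by move=> fi [mg [C gC]]; exact: integrable_bndM gC. Qed.

End bounded_measurable_functions.

(** * Polynomials in time *)

Section exp_polynomials.
Context {R : realType}.
Notation mu := (@lebesgue_measure R).
Variables (t0 t1 : R) (t01 : t0 < t1).

Lemma is_derive_expR_poly (p : {poly R}) s :
  is_derive s (1 : R) (fun s => expR p.[s]) (expR p.[s] * p^`().[s]).
Proof.
exact: (@is_derive1_comp R expR (horner p) s _ _ (is_derive_expR _) (is_derive_poly p s)).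
Qed.

Lemma continuous_expR_poly (p : {poly R}) : continuous (fun s => expR p.[s]).
Proof.
move=> s; apply: (@continuous_comp _ _ _ (horner p) expR); first exact: continuous_horner.
exact: continuous_expR.
Qed.

(** Integration by parts in time for the product of a concentration exp p and a
    test function q, along the line over a point of space. *)
Lemma Rintegral_expR_poly (p q : {poly R}) :
  \int[mu]_(s in `]t0, t1[)
    (expR p.[s] * p^`().[s] * q.[s] + expR p.[s] * q^`().[s]) =
  expR p.[t1] * q.[t1] - expR p.[t0] * q.[t0].
Proof.
have dF s : is_derive s (1 : R) (fun s => expR p.[s] * q.[s])
    (expR p.[s] * p^`().[s] * q.[s] + expR p.[s] * q^`().[s]).
  refine (is_derive_eq (@is_deriveM _ _ _ _ s 1 _ _ (is_derive_expR_poly p s)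
    (is_derive_poly q s)) _).
  by rewrite /GRing.scale /=; ring.
apply: (Rintegral_FTC _ _ t01 dF) => s.
have ce := @continuous_expR_poly p s.
exact: (continuousD (continuousM (continuousM ce (@continuous_horner _ (p^`()) s))
  (@continuous_horner _ q s)) (continuousM ce (@continuous_horner _ (q^`()) s))).
Qed.

Lemma Rintegral_expR_deriv (p : {poly R}) :
  \int[mu]_(s in `]t0, t1[) (expR p.[s] * p^`().[s]) = expR p.[t1] - expR p.[t0].
Proof.
rewrite -[X in X - _]mulr1 -[X in _ - X]mulr1.
have := Rintegral_expR_poly p 1; rewrite derivC !hornerC => <-.
by apply: eq_Rintegral => s _; rewrite !hornerC; ring.
Qed.

(** The entropy is a primitive of eta |-> eta exp eta. *)
Lemma Rintegral_entropy (p : {poly R}) :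
  \int[mu]_(s in `]t0, t1[) (expR p.[s] * p^`().[s] * p.[s]) =
  entropy p.[t1] - entropy p.[t0].
Proof.
have := Rintegral_expR_poly p (p - 1); rewrite /entropy !hornerE => <-.
by apply: eq_Rintegral => s _; rewrite derivB derivC !hornerE; ring.
Qed.

Lemma Rintegral_deriv_poly (q : {poly R}) :
  \int[mu]_(s in `]t0, t1[) q^`().[s] = q.[t1] - q.[t0].
Proof.
exact: (Rintegral_FTC _ _ t01 (is_derive_poly q) (@continuous_horner _ (q^`()))).
Qed.

Lemma Rintegral_mul_deriv (q : {poly R}) :
  \int[mu]_(s in `]t0, t1[) (q.[s] * q^`().[s]) = (q.[t1] ^+ 2 - q.[t0] ^+ 2) / 2.
Proof.
have := Rintegral_deriv_poly (2^-1 *: (q ^+ 2)).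
rewrite !hornerZ !horner_exp -mulrBr mulrC => <-.
apply: eq_Rintegral => s _; rewrite derivZ deriv_exp /= expr1 hornerZ hornerMn hornerM.
by rewrite mulr2n; field.
Qed.

End exp_polynomials.

Section time_polynomials.
Context {R : realType} {d M : nat}.
Variables (P : 'I_M -> 'I_d.+1 -> 'rV[R]_d).
Local Notation G := (mesh_interior P).

(** Discrete functions as polynomials in time, point by point: derivatives and
    traces in time become those of a polynomial. *)
Definition tpoly r (c : 'I_r -> 'rV[R]_d -> R) (x : 'rV[R]_d) : {poly R} :=
  \sum_(j < r) c j x *: 'X^j.

Lemma tpolyE r (c : 'I_r -> 'rV[R]_d -> R) x s :
  (tpoly c x).[s] = \sum_(j < r) c j x * s ^+ j.
Proof.
by rewrite /tpoly horner_sum; apply: eq_bigr => j _; rewrite hornerZ hornerXn.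
Qed.

Lemma tpoly_derivE r (c : 'I_r -> 'rV[R]_d -> R) x s :
  (tpoly c x)^`().[s] = \sum_(j < r) c j x * (s ^+ j.-1 *+ j).
Proof.
rewrite /tpoly raddf_sum /= horner_sum; apply: eq_bigr => j _.
by rewrite derivZ derivXn hornerZ hornerMn hornerXn.
Qed.

Lemma tpoly_derivS r (c : 'I_r.+1 -> 'rV[R]_d -> R) x :
  (tpoly c x)^`() = tpoly (fun (j : 'I_r) y => j.+1%:R * c (lift ord0 j) y) x.
Proof.
rewrite /tpoly raddf_sum /= big_ord_recl derivZ derivXn mulr0n scaler0 add0r.
apply: eq_bigr => j _; rewrite derivZ derivXn lift0 /=.
by rewrite [X in _ = X *: _]mulrC -scalerA scaler_nat.
Qed.

Lemma partial_tpoly r (c : 'I_r -> 'rV[R]_d -> R) j s x :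
  (forall l, pwpoly P (c l)) -> G x ->
  partial j (fun y => (tpoly c y).[s]) x =
  (tpoly (fun l => partial j (c l)) x).[s].
Proof.
move=> pc Gx; under eq_fun do rewrite tpolyE.
by rewrite (partial_sum _ _ _ pc Gx) tpolyE.
Qed.

Section representation.
Variables (t0 t1 : R) (t01 : t0 < t1) (r : nat) (c : 'I_r -> 'rV[R]_d -> R).
Variables (v : R -> 'rV[R]_d -> R) (x : 'rV[R]_d).
Hypothesis vE : forall s, t0 <= s < t1 -> v s x = (tpoly c x).[s].

Lemma trace_minus_tpoly : trace_minus t1 v x = (tpoly c x).[t1].
Proof.
rewrite /trace_minus; apply: cvg_lim => //.
apply: cvg_trans (cvg_at_left_filter (@continuous_horner _ (tpoly c x) t1)).
apply: near_eq_cvg; near=> s; apply/esym/vE; apply/andP; split.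
  by apply/ltW; near: s; exact: nbhs_left_gt.
by near: s; exact: nbhs_left_lt.
Unshelve. all: by end_near. Qed.

Lemma trace_plus_tpoly : trace_plus t0 v x = (tpoly c x).[t0].
Proof.
rewrite /trace_plus; apply: cvg_lim => //.
apply: cvg_trans (cvg_at_right_filter (@continuous_horner _ (tpoly c x) t0)).
apply: near_eq_cvg; near=> s; apply/esym/vE; apply/andP; split.
  by apply/ltW; near: s; exact: nbhs_right_gt.
by near: s; exact: nbhs_right_lt.
Unshelve. all: by end_near. Qed.

Lemma derive1_expR_tpoly s : t0 < s < t1 ->
  derive1 (fun s => expR (v s x)) s = expR (tpoly c x).[s] * (tpoly c x)^`().[s].
Proof.
move=> s01; rewrite derive1E.
rewrite -[RHS](@derive_val _ _ _ _ _ _ _ (is_derive_expR_poly (tpoly c x) s)).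
apply: near_eq_derive; near=> y; rewrite vE//; apply/andP; split.
  by apply/ltW; near: y; apply: lt_nbhsr; case/andP: s01.
by near: y; apply: lt_nbhsl; case/andP: s01.
Unshelve. all: by end_near. Qed.

End representation.

End time_polynomials.

(** * Integrals over a slab *)

Section slab_integrals.
Context {R : realType} {d M : nat}.
Variables (Omega : set 'rV[R]_d) (P : 'I_M -> 'I_d.+1 -> 'rV[R]_d).
Hypotheses (d0 : (0 < d)%N) (bdO : bounded_domain Omega)
  (trP : conforming_triangulation Omega P).
Notation mu := (@lebesgue_measure R).
Variables (t0 t1 : R) (t01 : t0 < t1).
Local Notation G := (mesh_interior P).

Let A : set (measurableTypeR R) := `]t0, t1[%classic.
Let mA : measurable A. Proof. exact: measurable_itv. Qed.
Let mG : measurable G. Proof. exact: measurable_mesh_interior. Qed.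

Lemma mesh_interior_fin : (leb R d G < +oo)%E.
Proof. by apply: leb_bounded_fin => //; exact: bounded_mesh_interior bdO trP. Qed.

Definition slab : set (measurableTypeR R * 'rV[R]_d) := A `*` G.

Lemma measurable_slab : measurable slab.
Proof. exact: measurableX. Qed.

Let muA : mu A = (t1 - t0)%:E.
Proof. by rewrite lebesgue_measure_itv /= lte_fin t01 EFinB. Qed.

Lemma slab_fin : ((mu \x leb R d)%E slab < +oo)%E.
Proof.
rewrite /slab product_measure1E//= lte_mul_pinfty ?ge0_fin_numE//.
  by rewrite [lebesgue_measure A]muA ltry.
exact: mesh_interior_fin.
Qed.

Definition slab_integral (F : R -> 'rV[R]_d -> R) : R :=
  \int[(mu \x leb R d)%E]_(z in slab) F z.1 z.2.

Definition slab_integrable (F : R -> 'rV[R]_d -> R) :=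
  (mu \x leb R d)%E.-integrable slab (fun z => (F z.1 z.2)%:E).

Definition slab_bmeas (F : R -> 'rV[R]_d -> R) :=
  bounded_measurable slab (fun z => F z.1 z.2).

Lemma slab_bmeas_integrable F : slab_bmeas F -> slab_integrable F.
Proof. by apply: bmeas_integrable; [exact: measurable_slab|exact: slab_fin]. Qed.

(** The integrand of the scheme is replaced by its polynomial representation,
    which agrees with it off a null set. Only then is it known to be integrable
    for the product measure, so that Fubini applies. *)
Lemma slab_integralE (F F' : R -> 'rV[R]_d -> R) :
  (forall s x, t0 < s < t1 -> G x -> F s x = F' s x) -> slab_integrable F' ->
  \int[mu]_(s in `[t0, t1[) (\int[leb R d]_(x in Omega) F s x) = slab_integral F'.
Proof.
move=> FF' iF'.
rewrite (Rintegral_itv_endpoints _ _ _ _ false true).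
rewrite /slab_integral.
rewrite -(@Rintegral12_prod _ _ (measurableTypeR R) _ R mu (leb R d) A G F' mA mG iF').
apply: eq_Rintegral => s; rewrite inE /= in_itv /= => s01.
rewrite (Rintegral_mesh d0 trP); apply: eq_Rintegral => x; rewrite inE => Gx.
exact: FF'.
Qed.

Lemma slab_integral_time_first F : slab_integrable F ->
  slab_integral F = \int[leb R d]_(x in G) (\int[mu]_(s in `]t0, t1[) F s x).
Proof.
move=> iF; rewrite /slab_integral.
by rewrite -(@Rintegral21_prod _ _ (measurableTypeR R) _ R mu (leb R d) A G F mA mG iF).
Qed.

Lemma slab_integralD F F' : slab_integrable F -> slab_integrable F' ->
  slab_integral (fun s x => F s x + F' s x) = slab_integral F + slab_integral F'.
Proof. by move=> iF iF'; rewrite /slab_integral RintegralD//; exact: measurable_slab. Qed.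

Lemma slab_integralZ a F : slab_integrable F ->
  slab_integral (fun s x => a * F s x) = a * slab_integral F.
Proof. by move=> iF; rewrite /slab_integral RintegralZl//; exact: measurable_slab. Qed.

Lemma slab_integral_sum I (s : seq I) (F : I -> R -> 'rV[R]_d -> R) :
  (forall i, slab_integrable (F i)) ->
  slab_integral (fun t x => \sum_(i <- s) F i t x) =
  \sum_(i <- s) slab_integral (F i).
Proof. by move=> iF; rewrite /slab_integral Rintegral_sum//; exact: measurable_slab. Qed.

Lemma slab_bmeas_space f : bounded_measurable G f -> slab_bmeas (fun _ x => f x).
Proof.
move=> [mf [C fC]]; split; last by exists C => z [_ Gz]; exact: fC.
apply: (@measurable_comp _ _ _ _ _ _ G) => //.
  by move=> _ [p [_ Gp] <-].
exact: measurable_funTS measurable_snd.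
Qed.

Lemma slab_bmeas_time (g : R -> R) : continuous g -> slab_bmeas (fun s _ => g s).
Proof.
move=> cg; split.
  apply: (@measurableT_comp _ _ _ _ _ _ g); first exact: continuous_measurable_fun.
  exact: measurable_funTS measurable_fst.
have [C gC] := continuous_bounded_itv t0 t1 cg.
by exists C => z [Az _]; exact: gC.
Qed.

Lemma bmeas_pwpoly f : pwpoly P f -> bounded_measurable G f.
Proof.
move=> pf; split; first exact: measurable_pwpoly.
exact: (pwpoly_bounded bdO trP pf).
Qed.

Lemma slab_bmeas_tpoly r (c : 'I_r -> 'rV[R]_d -> R) :
  (forall j, pwpoly P (c j)) -> slab_bmeas (fun s x => (tpoly c x).[s]).
Proof.
move=> pc; rewrite /slab_bmeas; under eq_fun do rewrite tpolyE.
apply: bmeas_sum => j; apply: bmeasM.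
  exact: (slab_bmeas_space (bmeas_pwpoly (pc j))).
apply: (@slab_bmeas_time (fun s => s ^+ j)); exact: exprn_continuous.
Qed.

Lemma slab_bmeas_tpoly_deriv r (c : 'I_r -> 'rV[R]_d -> R) :
  (forall j, pwpoly P (c j)) -> slab_bmeas (fun s x => (tpoly c x)^`().[s]).
Proof.
move=> pc; rewrite /slab_bmeas; under eq_fun do rewrite tpoly_derivE.
apply: bmeas_sum => j; apply: bmeasM.
  exact: (slab_bmeas_space (bmeas_pwpoly (pc j))).
apply: (@slab_bmeas_time (fun s => s ^+ j.-1 *+ j)).
have -> : (fun s : R => s ^+ j.-1 *+ j) = horner ('X^j)^`().
  by apply/funext => s; rewrite derivXn hornerMn hornerXn.
exact: continuous_horner.
Qed.

Lemma bmeas_tpoly r (c : 'I_r -> 'rV[R]_d -> R) s :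
  (forall j, pwpoly P (c j)) -> bounded_measurable G (fun x => (tpoly c x).[s]).
Proof.
move=> pc; under eq_fun do rewrite tpolyE.
apply: bmeas_sum => j; apply: bmeasM; first exact: bmeas_pwpoly.
exact: bmeas_cst.
Qed.

Lemma slab_integrable_space h : (leb R d).-integrable G (EFin \o h) ->
  slab_integrable (fun _ x => h x).
Proof.
move=> hi.
have := integrable_cyl mA mG (integrable_space t01 mG hi).
apply: eq_integrable; first exact: measurable_slab.
by move=> -[s x] _ /=; rewrite rsubmx_rV_cons.
Qed.

End slab_integrals.

(** * The intermediate value in Taylor's formula for the exponential *)

Section exponential_remainder.
Context {R : realType}.

Lemma nondecreasing_is_derive (f f' : R -> R) (x y : R) :
  (forall s, is_derive s (1 : R) f (f' s)) -> (forall s, 0 <= f' s) ->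
  x <= y -> f x <= f y.
Proof.
move=> df f'0; rewrite le_eqVlt => /predU1P[->//|xy].
have cf := is_derive_continuous df.
have [c _ fyx] := @MVT R f f' x y xy (fun s _ => df s) (continuous_subspaceT cf).
by rewrite -subr_ge0 fyx mulr_ge0// subr_ge0 ltW.
Qed.

Let rem (s : R) : R := expR s - 1 - s.

Let is_derive_rem (s : R) : is_derive s (1 : R) rem (expR s - 1).
Proof.
have d1 : is_derive s (1 : R) (fun s => expR s - 1) (expR s).
  by rewrite -[X in is_derive _ _ _ X]subr0; exact: is_deriveB.
exact: (@is_deriveB _ _ _ _ _ _ _ _ _ d1 (is_derive_id s 1)).
Qed.

Let is_derive_half_sqr (s : R) : is_derive s (1 : R) (fun s => s ^+ 2 / 2) s.
Proof.
have := is_derive_poly (2^-1 *: 'X^2 : {poly R}) s.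
rewrite derivZ derivXn hornerZ hornerMn hornerXn expr1.
rewrite (_ : 2^-1 * (s *+ 2) = s); last by rewrite mulr2n; field.
by rewrite (_ : horner _ = fun s => s ^+ 2 / 2)//; apply/funext => y;
  rewrite hornerZ hornerXn mulrC.
Qed.

Let rem_ge0 s : 0 <= rem s.
Proof. by rewrite /rem; have := expR_ge1Dx s; lra. Qed.

(** Compared at 0, where both vanish, this monotonicity gives
    rem s >= s^2 / 2 for s >= 0 and the reverse inequality for s <= 0. Together
    with rem_upper, it traps 2 rem s / s^2 between 1 and exp s, which is what
    places the point of Lagrange's remainder between the two arguments. *)
Let rem_lower (x y : R) : x <= y -> rem x - x ^+ 2 / 2 <= rem y - y ^+ 2 / 2.
Proof.
apply: (@nondecreasing_is_derive (fun s => rem s - s ^+ 2 / 2) rem) => // s.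
exact: (@is_deriveB _ _ _ _ _ _ _ _ _ (is_derive_rem s) (is_derive_half_sqr s)).
Qed.

Let rem_upper (x y : R) : x <= y ->
  expR x * (x ^+ 2 / 2) - rem x <= expR y * (y ^+ 2 / 2) - rem y.
Proof.
apply: (@nondecreasing_is_derive (fun s => expR s * (s ^+ 2 / 2) - rem s)
  (fun s => expR s * (s ^+ 2 / 2 + s) - (expR s - 1))) => [s|s].
  have dE := @is_deriveM _ _ _ _ s 1 _ _ (is_derive_expR s) (is_derive_half_sqr s).
  refine (is_derive_eq (@is_deriveB _ _ _ _ _ _ _ _ _ dE (is_derive_rem s)) _).
  by rewrite /GRing.scale /=; ring.
(* the derivative is exp s (exp (- s) - (1 - s) + s^2 / 2) *)
have e0 := expR_gt0 s; have := expR_ge1Dx (- s).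
have e1 : expR s * expR (- s) = 1 by rewrite -expRD subrr expR0.
move=> e2; have : 0 <= expR s * (expR (- s) - (1 - s) + s ^+ 2 / 2).
  by rewrite mulr_ge0 ?(ltW e0)// addr_ge0 ?divr_ge0 ?sqr_ge0//; lra.
rewrite mulrDr mulrBr e1; nra.
Qed.

(** The point where Lagrange's remainder of exp, expanded at w and evaluated at
    a, is attained. The convention ln 0 = 0 gives w when a = w, and keeps the
    formula free of divisions, hence evidently measurable. *)
Definition exp_mean (a w : R) : R :=
  w + ln (2 * rem (a - w)) - ln ((a - w) ^+ 2).

Let rem0 : rem 0 = 0. Proof. by rewrite /rem expR0; ring. Qed.

Let exp_mean_spec (a w : R) : a != w ->
  [/\ expR (exp_mean a w) = expR w * (2 * rem (a - w) / (a - w) ^+ 2),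
      0 < (a - w) ^+ 2 & 0 < rem (a - w)].
Proof.
move=> aw; have s0 : 0 < (a - w) ^+ 2.
  by rewrite exprn_even_gt0//= subr_eq0.
have r0 : 0 < rem (a - w).
  have [d0|d0] := leP 0 (a - w).
    by have := rem_lower d0; rewrite rem0 expr0n /=; lra.
  have := rem_upper (ltW d0); rewrite rem0 expr0n /= mul0r mulr0 => h.
  have : 0 < expR (a - w) * ((a - w) ^+ 2 / 2) by rewrite mulr_gt0 ?expR_gt0//; lra.
  lra.
split => //; rewrite /exp_mean -addrA expRD; congr (_ * _).
by rewrite expRD expRN !lnK ?posrE// mulr_gt0.
Qed.

Lemma exp_mean_remainder (a w : R) :
  2^-1 * expR (exp_mean a w) * (w - a) ^+ 2 =
  expR a - expR w - expR w * (a - w).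
Proof.
have [->|aw] := eqVneq a w; first by rewrite !subrr expr0n /=; ring.
have [-> s0 _] := exp_mean_spec aw.
have -> : expR a = expR w * expR (a - w) by rewrite -expRD addrC subrK.
have -> : (w - a) ^+ 2 = (a - w) ^+ 2 by ring.
have dN0 : a - w != 0 by rewrite subr_eq0.
by rewrite /rem; field.
Qed.

Lemma exp_mean_between (a w : R) :
  Num.min a w <= exp_mean a w <= Num.max a w.
Proof.
have [->|aw] := eqVneq a w.
  by rewrite /exp_mean subrr rem0 mulr0 expr0n/= ln0// addr0 subr0 minxx maxxx lexx.
have [E s0 r0] := exp_mean_spec aw.
have lo (c : R) : (expR c * (a - w) ^+ 2 <= expR w * (2 * rem (a - w))) ->
    c <= exp_mean a w.
  by move=> h; rewrite -ler_expR E mulrA ler_pdivlMr.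
have up (c : R) : (expR w * (2 * rem (a - w)) <= expR c * (a - w) ^+ 2) ->
    exp_mean a w <= c.
  by move=> h; rewrite -ler_expR E mulrA ler_pdivrMr.
have ea : expR a = expR w * expR (a - w) by rewrite -expRD addrC subrK.
have ew := expR_gt0 w.
have [d0|d0] := leP 0 (a - w).
  have h1 := rem_lower d0; have h2 := rem_upper d0.
  rewrite rem0 expr0n /= !mul0r mulr0 subr0 in h1 h2.
  have wa : w <= a by lra.
  rewrite min_r ?max_l//; apply/andP; split.
    by apply: lo; rewrite ler_pM2l//; lra.
  by apply: up; rewrite ea -mulrA ler_pM2l//; lra.
have h1 := rem_lower (ltW d0); have h2 := rem_upper (ltW d0).
rewrite rem0 expr0n /= !mul0r mulr0 subr0 in h1 h2.
have aw' : a <= w by lra.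
rewrite min_l ?max_r//; apply/andP; split.
  by apply: lo; rewrite ea -mulrA ler_pM2l//; lra.
by apply: up; rewrite ler_pM2l//; lra.
Qed.

Lemma measurable_exp_mean d (T : measurableType d) (D : set T) (a w : T -> R) :
  measurable_fun D a -> measurable_fun D w ->
  measurable_fun D (fun x => exp_mean (a x) (w x)).
Proof.
move=> ma mw; have maw : measurable_fun D (fun x => a x - w x) by exact: measurable_funB.
have ml (f : T -> R) : measurable_fun D f -> measurable_fun D (fun x => ln (f x)).
  by move=> mf; apply: measurableT_comp mf; exact: measurable_ln.
apply: measurable_funB; last by apply: ml; exact: measurable_funX.
apply: measurable_funD => //; apply: ml; apply: measurable_funM => //.
apply: measurable_funB => //; apply: measurable_funB => //.
exact: measurableT_comp.
Qed.

End exponential_remainder.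

(** * The energy balance over one time step *)

Section gradients.
Context {R : realType} {d M : nat}.
Variables (P : 'I_M -> 'I_d.+1 -> 'rV[R]_d).
Local Notation G := (mesh_interior P).

Lemma partialDZ f g (a : R) j x : pwpoly P f -> pwpoly P g -> G x ->
  partial j (fun y => f y + a * g y) x = partial j f x + a * partial j g x.
Proof.
move=> pf pg Gx; have df := pwpoly_is_derive j pf Gx.
have dg : is_derive x (delta_mx 0 j) (fun y => a * g y) (a * partial j g x).
  exact: (@is_deriveZ _ _ _ g a x _ _ (pwpoly_is_derive j pg Gx)).
exact: (@derive_val _ _ _ _ _ _ _ (@is_deriveD _ _ _ _ _ _ _ _ _ df dg)).
Qed.

Lemma pwpoly_tpoly r (c : 'I_r -> 'rV[R]_d -> R) s :
  (forall j, pwpoly P (c j)) -> pwpoly P (fun x => (tpoly c x).[s]).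
Proof.
move=> pc; under eq_fun do rewrite tpolyE.
by apply: pwpoly_sum => j; apply: pwpolyM => //; exact: pwpoly_cst.
Qed.

Lemma partial_cst (c : R) j (x : 'rV[R]_d) : partial j (fun=> c) x = 0.
Proof. exact: derive_cst. Qed.

End gradients.

Section one_step.
Context {R : realType} {d N M : nat}.
Variables (k m : nat) (Omega : set 'rV[R]_d) (P : 'I_M -> 'I_d.+1 -> 'rV[R]_d).
Variables (dat : pnp_data R d N) (t : nat -> R).
Variables (u : nat -> 'I_N -> R -> 'rV[R]_d -> R) (phi : nat -> R -> 'rV[R]_d -> R).
Hypotheses (d0 : (0 < d)%N) (bdO : bounded_domain Omega)
  (trP : conforming_triangulation Omega P).
Variable n0 : nat.
Notation n := n0.+1.
Hypothesis tn : t n < t n.+1.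
Notation mu := (@lebesgue_measure R).
Local Notation G := (mesh_interior P).
Local Notation J := (slab_integral P (t n) (t n.+1)).
Local Notation "\int_G_ x F" := (\int[leb R d]_(x in G) F)
  (at level 36, x name, F at level 36).

Variables (cu : 'I_N -> 'I_m.+1 -> 'rV[R]_d -> R) (cphi : 'I_m.+1 -> 'rV[R]_d -> R).
Hypothesis fcu : forall i j, fe_space Omega P k (cu i j).
Hypothesis fcphi : forall j, fe_space Omega P k (cphi j).
Hypothesis cuE : forall i s x, t n <= s < t n.+1 -> G x ->
  u n i s x = \sum_(j < m.+1) cu i j x * s ^+ j.
Hypothesis cphiE : forall s x, t n <= s < t n.+1 -> G x ->
  phi n s x = \sum_(j < m.+1) cphi j x * s ^+ j.

Let p i x := tpoly (cu i) x.
Let q x := tpoly cphi x.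
Let dp i j x := tpoly (fun l => partial j (cu i l)) x.
Let dq j x := tpoly (fun l => partial j (cphi l)) x.
Let kappa i := valence dat i * unit_charge dat / (boltzmann dat * temperature dat).

Let mG : measurable G. Proof. exact: measurable_mesh_interior. Qed.
Let Goo : (leb R d G < +oo)%E. Proof. exact: mesh_interior_fin bdO trP. Qed.
Let pcu i j : pwpoly P (cu i j). Proof. exact: pwpoly_fe (fcu i j). Qed.
Let pcphi j : pwpoly P (cphi j). Proof. exact: pwpoly_fe (fcphi j). Qed.

Let uE i s x : t n <= s < t n.+1 -> G x -> u n i s x = (p i x).[s].
Proof. by move=> s01 Gx; rewrite /p tpolyE cuE. Qed.
Let phiE s x : t n <= s < t n.+1 -> G x -> phi n s x = (q x).[s].
Proof. by move=> s01 Gx; rewrite /q tpolyE cphiE. Qed.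

Let u_plusE i x : G x -> u_plus t u n i x = (p i x).[t n].
Proof. by move=> Gx; apply: (trace_plus_tpoly tn) => s s01; exact: uE. Qed.
Let u_minusE i x : G x -> u_minus dat t u n i x = (p i x).[t n.+1].
Proof. by move=> Gx; apply: (trace_minus_tpoly tn) => s s01; exact: uE. Qed.
Let phi_plusE x : G x -> trace_plus (t n) (phi n) x = (q x).[t n].
Proof. by move=> Gx; apply: (trace_plus_tpoly tn) => s s01; exact: phiE. Qed.
Let phi_minusE x : G x -> trace_minus (t n.+1) (phi n) x = (q x).[t n.+1].
Proof. by move=> Gx; apply: (trace_minus_tpoly tn) => s s01; exact: phiE. Qed.

Let bp i : slab_bmeas P (t n) (t n.+1) (fun s x => (p i x).[s]).
Proof. exact: (slab_bmeas_tpoly bdO trP _ _ (pcu i)). Qed.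
Let bp' i : slab_bmeas P (t n) (t n.+1) (fun s x => (p i x)^`().[s]).
Proof. exact: (slab_bmeas_tpoly_deriv bdO trP _ _ (pcu i)). Qed.
Let be i : slab_bmeas P (t n) (t n.+1) (fun s x => expR (p i x).[s]).
Proof. by apply: bmeas_expR; exact: bp. Qed.
Let bdp i j : slab_bmeas P (t n) (t n.+1) (fun s x => (dp i j x).[s]).
Proof. by apply: (slab_bmeas_tpoly bdO trP _ _) => l; exact: pwpoly_partial. Qed.
Let bq : slab_bmeas P (t n) (t n.+1) (fun s x => (q x).[s]).
Proof. exact: (slab_bmeas_tpoly bdO trP _ _ pcphi). Qed.
Let bq' : slab_bmeas P (t n) (t n.+1) (fun s x => (q x)^`().[s]).
Proof. exact: (slab_bmeas_tpoly_deriv bdO trP _ _ pcphi). Qed.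
Let bdq j : slab_bmeas P (t n) (t n.+1) (fun s x => (dq j x).[s]).
Proof. by apply: (slab_bmeas_tpoly bdO trP _ _) => l; exact: pwpoly_partial. Qed.
Let bdq' j : slab_bmeas P (t n) (t n.+1) (fun s x => (dq j x)^`().[s]).
Proof. by apply: (slab_bmeas_tpoly_deriv bdO trP _ _) => l; exact: pwpoly_partial. Qed.
Let bsc c : slab_bmeas P (t n) (t n.+1) (fun _ _ => c).
Proof. exact: bmeas_cst. Qed.

Let gp i s : bounded_measurable G (fun x => (p i x).[s]).
Proof. exact: (bmeas_tpoly bdO trP _ (pcu i)). Qed.
Let gq s : bounded_measurable G (fun x => (q x).[s]).
Proof. exact: (bmeas_tpoly bdO trP _ pcphi). Qed.
Let gdq j s : bounded_measurable G (fun x => (dq j x).[s]).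
Proof. by apply: (bmeas_tpoly bdO trP) => l; exact: pwpoly_partial. Qed.
Let ge i s : bounded_measurable G (fun x => expR (p i x).[s]).
Proof. by apply: bmeas_expR; exact: gp. Qed.
Let gi f : bounded_measurable G f -> (leb R d).-integrable G (EFin \o f).
Proof. exact: bmeas_integrable. Qed.
Let si F : slab_bmeas P (t n) (t n.+1) F -> slab_integrable P (t n) (t n.+1) F.
Proof. exact: (slab_bmeas_integrable bdO trP tn). Qed.

Let partial_u i j s x : t n <= s < t n.+1 -> G x ->
  partial j (u n i s) x = (dp i j x).[s].
Proof.
move=> s01 Gx; rewrite -(partial_tpoly _ _ (pcu i) Gx).
by apply: partial_eq Gx => y Gy; exact: uE.
Qed.
Let partial_phi j s x : t n <= s < t n.+1 -> G x ->
  partial j (phi n s) x = (dq j x).[s].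
Proof.
move=> s01 Gx; rewrite -(partial_tpoly _ _ pcphi Gx).
by apply: partial_eq Gx => y Gy; exact: phiE.
Qed.
Let partial_phi_minus j x : G x ->
  partial j (trace_minus (t n.+1) (phi n)) x = (dq j x).[t n.+1].
Proof.
move=> Gx; rewrite -(partial_tpoly _ _ pcphi Gx).
by apply: partial_eq Gx => y Gy; exact: phi_minusE.
Qed.

Let w i := u_minus dat t u n0 i.
Hypothesis iw : forall i, (leb R d).-integrable G (fun x => (expR (w i x))%:E).

Section S1_tested.
Variables (i : 'I_N) (v : R -> 'rV[R]_d -> R) (cv : 'I_m.+1 -> 'rV[R]_d -> R).
Hypothesis S1 : scheme_S1 Omega P dat k m t u phi n.
Hypothesis Vv : st_space Omega P k m.+1 (t n) (t n.+1) v.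
Hypothesis fcv : forall j, fe_space Omega P k (cv j).
Hypothesis cvE : forall s x, t n <= s < t n.+1 -> G x ->
  v s x = \sum_(j < m.+1) cv j x * s ^+ j.

Let pcv j : pwpoly P (cv j). Proof. exact: pwpoly_fe (fcv j). Qed.
Let vE s x : t n <= s < t n.+1 -> G x -> v s x = (tpoly cv x).[s].
Proof. by move=> s01 Gx; rewrite tpolyE cvE. Qed.

(** The transport equation rewritten with the polynomial representations; it is
    then used with v equal to 1, to u and to the potential. *)
Lemma S1_tested :
  J (fun s x => expR (p i x).[s] * (p i x)^`().[s] * (tpoly cv x).[s]) +
  \int_G_ x ((expR (p i x).[t n] - expR (w i x)) * (tpoly cv x).[t n]) +
  J (fun s x => diffusion dat i * expR (p i x).[s] *
    \sum_j ((dp i j x).[s] + kappa i * (dq j x).[s]) *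
      (tpoly (fun l => partial j (cv l)) x).[s]) = 0.
Proof.
rewrite -[RHS](S1 i Vv); congr (_ + _ + _).
- apply/esym/(slab_integralE d0 trP) => [s x s01 Gx|].
    have s01' : t n <= s < t n.+1 by case/andP: s01 => /ltW -> ->.
    rewrite (vE s01' Gx) (derive1_expR_tpoly (c := cu i) _ s01)// => r r01.
    exact: uE.
  apply: si; apply: bmeasM; last exact: (slab_bmeas_tpoly bdO trP _ _ pcv).
  by apply: bmeasM; [exact: be|exact: bp'].
- rewrite (Rintegral_mesh d0 trP); apply: eq_Rintegral => x; rewrite inE => Gx.
  rewrite u_plusE//; congr (_ * _).
  by apply/esym; apply: (trace_plus_tpoly tn) => s s01; exact: vE.
- apply/esym/(slab_integralE d0 trP) => [s x s01 Gx|].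
    have s01' : t n <= s < t n.+1 by case/andP: s01 => /ltW -> ->.
    rewrite uE//; congr (_ * _); apply: eq_bigr => j _.
    rewrite !mxE partial_u// partial_phi//; congr (_ * _).
    rewrite -(partial_tpoly _ _ pcv Gx).
    by apply: partial_eq Gx => y Gy; exact: vE.
  apply: si; apply: bmeasM; first by apply: bmeasM; [exact: bsc|exact: be].
  apply: bmeas_sum => j; apply: bmeasM.
    by apply: bmeasD; [exact: bdp|apply: bmeasM; [exact: bsc|exact: bdq]].
  by apply: (slab_bmeas_tpoly bdO trP _ _) => l; exact: pwpoly_partial.
Qed.

End S1_tested.

(** Mass conservation: the constant 1 is an admissible test function. *)
Lemma mass_conservation i : scheme_S1 Omega P dat k m t u phi n ->
  \int[leb R d]_(x in Omega) expR (u_minus dat t u n i x) =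
  \int[leb R d]_(x in Omega) expR (w i x).
Proof.
move=> S1.
pose c1 (j : 'I_m.+1) (_ : 'rV[R]_d) : R := (j == ord0)%:R.
have fc1 j : fe_space Omega P k (c1 j) by exact: fe_space_cst.
have V1 := st_space_of_coefficients bdO tn fc1.
have t1 s x : (tpoly c1 x).[s] = 1.
  rewrite tpolyE big_ord_recl /c1 eqxx mul1r expr0 big1 ?addr0// => j _.
  by rewrite mul0r.
have t10 j s x : (tpoly (fun l => partial j (c1 l)) x).[s] = 0.
  by rewrite tpolyE big1// => l _; rewrite partial_cst mul0r.
have := S1_tested i S1 V1 fc1 (fun _ _ _ _ => erefl).
rewrite (_ : J (fun s x => diffusion dat i * _ * _) = 0); last first.
  rewrite /slab_integral Rintegral0_eq// => -[s x] _ /=.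
  by rewrite big1 ?mulr0// => j _; rewrite t10 mulr0.
rewrite addr0 (slab_integral_time_first); last first.
  apply: si; apply: bmeasM; last exact: (slab_bmeas_tpoly bdO trP _ _ (fun j => pwpoly_fe (fc1 j))).
  by apply: bmeasM; [exact: be|exact: bp'].
under eq_Rintegral => x _.
  under eq_Rintegral do rewrite t1 mulr1.
  rewrite (Rintegral_expR_deriv tn); over.
under [X in _ + X]eq_Rintegral do rewrite t1 mulr1.
rewrite RintegralB; [|exact: mG|exact: (gi (ge _ _))|exact: (gi (ge _ _))].
rewrite RintegralB; [|exact: mG|exact: (gi (ge _ _))|exact: iw].
rewrite addrA subrK => /eqP; rewrite subr_eq0 => /eqP h.
rewrite !(Rintegral_mesh d0 trP) -h; apply: eq_Rintegral => x.
by rewrite inE => Gx; rewrite u_minusE.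
Qed.

Section energy_balance.
Variable phi0 : 'rV[R]_d -> R.
Let f0 := phi_minus t phi phi0 n0.
Let rho0 := fixed_charge dat.
Let z i := valence dat i.
Let e := unit_charge dat.
Let kT := boltzmann dat * temperature dat.
Let eps := permittivity dat.
Hypotheses (D_gt0 : forall i, 0 < diffusion dat i) (kB_gt0 : 0 < boltzmann dat)
  (T_gt0 : 0 < temperature dat) (eps_gt0 : 0 < eps).
Hypothesis irho0 : (leb R d).-integrable G (EFin \o rho0).
Hypothesis mw : forall i, measurable_fun G (w i).
Hypothesis iww : forall i, (leb R d).-integrable G (fun x => (expR (w i x) * w i x)%:E).
Hypothesis pf0 : pwpoly P f0.
Hypothesis S1 : scheme_S1 Omega P dat k m t u phi n.
Hypothesis S2 : scheme_S2 Omega P dat k m t u phi n.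
Hypothesis S3 : scheme_S3 Omega P dat k t u phi n.
Hypothesis S3' : discrete_poisson Omega P dat k (u_minus dat t u n0) f0.
Hypothesis Vu : forall i, st_space Omega P k m.+1 (t n) (t n.+1) (u n i).
Hypothesis Vphi : st_space Omega P k m.+1 (t n) (t n.+1) (phi n).

Let gf j : bounded_measurable G (partial j f0).
Proof. by apply: (bmeas_pwpoly bdO trP); exact: pwpoly_partial. Qed.

(** Sums and multiples of the coefficients: the potential at any fixed time, and
    in particular its traces, is a test function for the Poisson equation. *)
Let fe_q s : fe_space Omega P k (fun x => (q x).[s]).
Proof.
rewrite (_ : (fun _ => _) = fun x => \sum_(j < m.+1) s ^+ j * cphi j x).
  by apply: (fe_space_sum bdO) => j; exact: fe_spaceZ.
by apply/funext => x; rewrite /q tpolyE; apply: eq_bigr => j _; rewrite mulrC.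
Qed.

Let partial_q j s x : G x -> partial j (fun y => (q y).[s]) x = (dq j x).[s].
Proof. by move=> Gx; rewrite (partial_tpoly _ _ pcphi Gx). Qed.

Let iwM i f : bounded_measurable G f ->
  (leb R d).-integrable G (fun x => (expR (w i x) * f x)%:E).
Proof. by move=> bf; apply: integrable_bmeasM => //; exact: iw. Qed.

Let irhoM f : bounded_measurable G f ->
  (leb R d).-integrable G (fun x => (rho0 x * f x)%:E).
Proof. by move=> bf; exact: integrable_bmeasM. Qed.

Let iZ a f : (leb R d).-integrable G (EFin \o f) ->
  (leb R d).-integrable G (fun x => (a * f x)%:E).
Proof. by move=> fi; exact: (integrableZl mG a fi). Qed.

(* The suffixes 1 and 0 refer to the end and to the beginning of the slab, 00 to
   the potential before the jump. *)
Let X1 i := \int_G_ x entropy (p i x).[t n.+1].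
Let X0 i := \int_G_ x entropy (p i x).[t n].
Let W i := \int_G_ x entropy (w i x).
Let Z i := \int_G_ x (expR (p i x).[t n] - expR (w i x)
  - expR (w i x) * ((p i x).[t n] - w i x)).
Let Y i := \int_G_ x ((expR (p i x).[t n] - expR (w i x)) * (p i x).[t n]).
Let grad_mu i s x j := (dp i j x).[s] + kappa i * (dq j x).[s].
Let K i := J (fun s x => diffusion dat i * expR (p i x).[s] *
  \sum_j grad_mu i s x j * (dp i j x).[s]).
Let L i := J (fun s x => diffusion dat i * expR (p i x).[s] *
  \sum_j grad_mu i s x j * (dq j x).[s]).
Let C i := J (fun s x => expR (p i x).[s] * (p i x)^`().[s] * (q x).[s]).
Let F i := J (fun s x => expR (p i x).[s] * (q x)^`().[s]).
Let P1 i := \int_G_ x (expR (p i x).[t n.+1] * (q x).[t n.+1]).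
Let P0 i := \int_G_ x (expR (p i x).[t n] * (q x).[t n]).
Let Q i := \int_G_ x (expR (w i x) * (q x).[t n]).
Let r1 := \int_G_ x (rho0 x * (q x).[t n.+1]).
Let r0 := \int_G_ x (rho0 x * (q x).[t n]).
Let g1 := \sum_j \int_G_ x ((dq j x).[t n.+1] ^+ 2).
Let g0 := \sum_j \int_G_ x ((dq j x).[t n] ^+ 2).
Let h := \sum_j \int_G_ x (partial j f0 x * (dq j x).[t n]).
Let g00 := \sum_j \int_G_ x (partial j f0 x ^+ 2).

Let bentropy i s : bounded_measurable G (fun x => entropy (p i x).[s]).
Proof.
by apply: bmeasM => //; apply: bmeasB => //; exact: bmeas_cst.
Qed.
Let ientropyw i : (leb R d).-integrable G (fun x => (entropy (w i x))%:E).
Proof.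
rewrite (_ : (fun _ => _) = fun x =>
    (expR (w i x) * w i x + -1 * expR (w i x))%:E).
  by apply: (integrable_EFinD mG); [exact: iww|exact: (@iZ (-1) (fun x => expR (w i x)) (iw i))].
by apply/funext => x; congr EFin; rewrite /entropy; ring.
Qed.

Let iZi i : (leb R d).-integrable G (fun x => (expR (p i x).[t n] - expR (w i x)
  - expR (w i x) * ((p i x).[t n] - w i x))%:E).
Proof.
rewrite (_ : (fun _ => _) = fun x => (expR (p i x).[t n] +
   (expR (w i x) * w i x + (-1) * (expR (w i x) * (1 + (p i x).[t n]))))%:E).
  apply: (integrable_EFinD mG); first exact: (gi (ge _ _)).
  apply: (integrable_EFinD mG); first exact: iww.
  apply: (@iZ (-1) (fun x => expR (w i x) * (1 + (p i x).[t n]))).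
  by apply: iwM; apply: bmeasD => //; exact: bmeas_cst.
by apply/funext => x; congr EFin; ring.
Qed.

(** Since U(b) - U(a) = b (exp b - exp a) - (exp b - exp a - exp a (b - a)), the
    jump of exp u against u is the jump of the entropy plus the remainder Z of
    the expansion of exp at the value w before the jump. *)
Let entropy_jump i : Y i = Z i + X0 i - W i.
Proof.
rewrite /Y /Z /X0 /W -RintegralD; [|exact: mG|exact: iZi|exact: (gi (bentropy _ _))].
rewrite -RintegralB; [|exact: mG| |exact: ientropyw]; last first.
  by apply: (integrable_EFinD mG); [exact: iZi|exact: (gi (bentropy _ _))].
by apply: eq_Rintegral => x _; rewrite /entropy; ring.
Qed.

Let bgrad_mu i j : slab_bmeas P (t n) (t n.+1) (fun s x => grad_mu i s x j).
Proof.
apply: bmeasD; first exact: bdp.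
by apply: bmeasM; [exact: bsc|exact: bdq].
Qed.
Let bK i : slab_bmeas P (t n) (t n.+1) (fun s x => diffusion dat i * expR (p i x).[s] *
  \sum_j grad_mu i s x j * (dp i j x).[s]).
Proof.
apply: bmeasM; first by apply: bmeasM; [exact: bsc|exact: be].
by apply: bmeas_sum => j; apply: bmeasM; [exact: bgrad_mu|exact: bdp].
Qed.
Let bL i : slab_bmeas P (t n) (t n.+1) (fun s x => diffusion dat i * expR (p i x).[s] *
  \sum_j grad_mu i s x j * (dq j x).[s]).
Proof.
apply: bmeasM; first by apply: bmeasM; [exact: bsc|exact: be].
by apply: bmeas_sum => j; apply: bmeasM; [exact: bgrad_mu|exact: bdq].
Qed.
Let bC i : slab_bmeas P (t n) (t n.+1)
  (fun s x => expR (p i x).[s] * (p i x)^`().[s] * (q x).[s]).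
Proof.
apply: bmeasM; last exact: bq.
by apply: bmeasM; [exact: be|exact: bp'].
Qed.
Let bF i : slab_bmeas P (t n) (t n.+1) (fun s x => expR (p i x).[s] * (q x)^`().[s]).
Proof. by apply: bmeasM; [exact: be|exact: bq']. Qed.

(** Testing the transport equation with u, and integrating the entropy. *)
Let tested_u i : X1 i - X0 i + Y i + K i = 0.
Proof.
rewrite -[RHS](S1_tested i S1 (Vu i) (fcu i) (@cuE i)); congr (_ + _ + _).
rewrite slab_integral_time_first//; last first.
  apply: si; apply: bmeasM; last exact: bp.
  by apply: bmeasM; [exact: be|exact: bp'].
rewrite /X1 /X0 -RintegralB; [|exact: mG|exact: (gi (bentropy _ _))|exact: (gi (bentropy _ _))].
by apply: eq_Rintegral => x _; rewrite (Rintegral_entropy tn).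
Qed.

(** Testing it with the potential; up to the factor kappa, the flux term L is the
    part of the dissipation carried by the electric field. *)
Let tested_phi i : C i + (P0 i - Q i) + L i = 0.
Proof.
rewrite -[RHS](S1_tested i S1 Vphi fcphi cphiE); congr (_ + _ + _).
rewrite /P0 /Q -RintegralB; [|exact: mG|exact: (gi (bmeasM (ge _ _) (gq _)))|exact: iwM].
by apply: eq_Rintegral => x _; rewrite mulrBl.
Qed.

(** Integration by parts in time trades the rate of change of the charge for that
    of the potential, which is an admissible test function. *)
Let by_parts i : C i + F i = P1 i - P0 i.
Proof.
rewrite /C /F -slab_integralD; last 2 first.
- exact: si.
- exact: si.
rewrite slab_integral_time_first//; last by apply: si; apply: bmeasD; [exact: bC|exact: bF].
rewrite /P1 /P0 -RintegralB; [|exact: mG|exact: (gi (bmeasM (ge _ _) (gq _)))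
  |exact: (gi (bmeasM (ge _ _) (gq _)))].
by apply: eq_Rintegral => x _; rewrite (Rintegral_expR_poly tn).
Qed.

Let Rintegral_charge (E : 'I_N -> 'rV[R]_d -> R) g :
  (forall i, (leb R d).-integrable G (EFin \o E i)) -> bounded_measurable G g ->
  \int_G_ x ((rho0 x + \sum_i z i * e * E i x) * g x) =
  \int_G_ x (rho0 x * g x) + \sum_i z i * e * \int_G_ x (E i x * g x).
Proof.
move=> iE bg.
transitivity (\int_G_ x (rho0 x * g x + \sum_i z i * e * (E i x * g x))).
  apply: eq_Rintegral => x _; rewrite mulrDl mulr_suml; congr (_ + _).
  by apply: eq_bigr => i _; rewrite mulrA.
have iEg i : (leb R d).-integrable G (EFin \o (fun x => E i x * g x)).
  exact: integrable_bmeasM.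
have iZEg i : (leb R d).-integrable G (EFin \o (fun x => z i * e * (E i x * g x))).
  exact: (@iZ (z i * e) (fun x => E i x * g x) (iEg i)).
rewrite RintegralD; [|exact: mG|exact: irhoM|exact: (integrable_EFin_sum mG)].
congr (_ + _); rewrite Rintegral_sum//; apply: eq_bigr => i _.
exact: (RintegralZl (z i * e) mG (iEg i)).
Qed.

Let Rintegral_dot (a b : 'I_d -> 'rV[R]_d -> R) (c : R) :
  (forall j, bounded_measurable G (a j)) -> (forall j, bounded_measurable G (b j)) ->
  \int_G_ x (c * \sum_j a j x * b j x) = c * \sum_j \int_G_ x (a j x * b j x).
Proof.
move=> ba bb; have bab j : bounded_measurable G (fun x => a j x * b j x) by exact: bmeasM.
rewrite RintegralZl; [|exact: mG|by apply: gi; exact: bmeas_sum].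
by rewrite Rintegral_sum// => j; exact: gi.
Qed.

(** The Poisson equation at the end of the slab, tested with the potential. *)
Let poisson1 : eps * g1 = r1 + \sum_i z i * e * P1 i.
Proof.
have := S3 (fe_q (t n.+1)); rewrite !(Rintegral_mesh d0 trP) => /eqP.
rewrite subr_eq0 => /eqP S3E.
rewrite -(Rintegral_charge (fun i => gi (ge i _)) (gq _)).
transitivity (\int_G_ x (charge_density dat (u_minus dat t u n) x * (q x).[t n.+1])).
  rewrite -S3E -Rintegral_dot; [|by move=> j; exact: gdq|by move=> j; exact: gdq].
  apply: eq_Rintegral => x; rewrite inE => Gx; congr (_ * _).
  by apply: eq_bigr => j _; rewrite !mxE partial_phi_minus// partial_q.
apply: eq_Rintegral => x; rewrite inE => Gx; congr ((_ + _) * _).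
by apply: eq_bigr => i _; rewrite u_minusE.
Qed.

(** The Poisson equation of the preceding trace, or of the initial datum at the
    first step, tested with the potential after the jump: it accounts for the
    charge before the jump that the transport equation leaves. *)
Let poisson0 : eps * h = r0 + \sum_i z i * e * Q i.
Proof.
have := S3' (fe_q (t n)); rewrite !(Rintegral_mesh d0 trP) => /eqP.
rewrite subr_eq0 => /eqP S3E.
rewrite -(@Rintegral_charge (fun i x => expR (w i x)) _ iw (gq _)).
rewrite -[RHS]S3E -Rintegral_dot; [|exact: gf|by move=> j; exact: gdq].
apply: eq_Rintegral => x; rewrite inE => Gx; congr (_ * _).
by apply: eq_bigr => j _; rewrite !mxE partial_q.
Qed.

Let irhoq' : slab_integrable P (t n) (t n.+1) (fun s x => rho0 x * (q x)^`().[s]).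
Proof.
apply: integrable_bmeasM; [exact: measurable_slab| |exact: bq'].
exact: (slab_integrable_space tn irho0).
Qed.

Let cpsi (j : 'I_m) (y : 'rV[R]_d) : R := j.+1%:R * cphi (lift ord0 j) y.

Let partial_psi j s x : G x ->
  partial j (fun y => \sum_(l < m) cpsi l y * s ^+ l) x = (dq j x)^`().[s].
Proof.
move=> Gx; have pc l : pwpoly P (cpsi l) by apply: pwpolyM => //; exact: pwpoly_cst.
rewrite (partial_sum _ _ _ pc Gx) /dq tpoly_derivS tpolyE; apply: eq_bigr => l _.
congr (_ * _); exact: (deriveZ _ (@ex_derive _ _ _ _ _ _ _ (pwpoly_is_derive j (pcphi _) Gx))).
Qed.

Let Jcharge : J (fun s x => (rho0 x + \sum_i z i * e * expR (p i x).[s]) * (q x)^`().[s]) =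
  r1 - r0 + \sum_i z i * e * F i.
Proof.
transitivity (J (fun s x => rho0 x * (q x)^`().[s] +
    \sum_i z i * e * (expR (p i x).[s] * (q x)^`().[s]))).
  apply: eq_Rintegral => -[s x] _ /=; rewrite mulrDl mulr_suml; congr (_ + _).
  by apply: eq_bigr => i _; rewrite mulrA.
have bzF i : slab_bmeas P (t n) (t n.+1)
    (fun s x => z i * e * (expR (p i x).[s] * (q x)^`().[s])).
  by apply: bmeasM; [exact: bsc|exact: bF].
rewrite slab_integralD; [|exact: irhoq'|by apply: si; exact: bmeas_sum].
congr (_ + _).
  rewrite slab_integral_time_first; [|exact: irhoq'].
  rewrite /r1 /r0 -RintegralB; [|exact: mG|exact: irhoM|exact: irhoM].
  apply: eq_Rintegral => x _; rewrite RintegralZl.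
  - by rewrite (Rintegral_deriv_poly tn) mulrBr.
  - exact: measurable_itv.
  - by apply: continuous_integrable_oo; exact: continuous_horner.
rewrite slab_integral_sum; last by move=> i; apply: si; exact: bzF.
by apply: eq_bigr => i _; rewrite slab_integralZ//; apply: si; exact: bF.
Qed.

Let Jfield : J (fun s x => eps * \sum_j (dq j x).[s] * (dq j x)^`().[s]) =
  eps * ((g1 - g0) / 2).
Proof.
have bqq j : slab_bmeas P (t n) (t n.+1) (fun s x => (dq j x).[s] * (dq j x)^`().[s]).
  by apply: bmeasM; [exact: bdq|exact: bdq'].
rewrite slab_integralZ; last by apply: si; exact: bmeas_sum.
congr (_ * _); rewrite slab_integral_sum; last by move=> j; exact: si.
rewrite /g1 /g0 -sumrB mulr_suml; apply: eq_bigr => j _.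
rewrite slab_integral_time_first//; last exact: si.
under eq_Rintegral do rewrite (Rintegral_mul_deriv tn).
have bsq s : bounded_measurable G (fun x => (dq j x).[s] ^+ 2).
  by under eq_fun do rewrite expr2; apply: bmeasM; exact: gdq.
rewrite RintegralZr; [|exact: mG|by apply: gi; apply: bmeasB; exact: bsq].
by rewrite RintegralB; [|exact: mG|exact: (gi (bsq _))|exact: (gi (bsq _))].
Qed.

(** Testing with the time derivative of the potential turns the field into the
    time derivative of its energy. The derivative has one degree less in time,
    which is why the Poisson equation in the slab suffices for such functions. *)
Let poisson_slab : eps * ((g1 - g0) / 2) = r1 - r0 + \sum_i z i * e * F i.
Proof.
have fc j : fe_space Omega P k (cpsi j) by exact: fe_spaceZ.
have := S2 (st_space_of_coefficients bdO tn fc).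
rewrite -Jfield -Jcharge => /eqP; rewrite subr_eq0 => /eqP S2E.
transitivity (\int[mu]_(s in `[t n, t n.+1[) (\int[leb R d]_(x in Omega)
    (eps * dot (grad (phi n s) x) (grad (fun y => \sum_(j < m) cpsi j y * s ^+ j) x)))).
  apply/esym/(slab_integralE d0 trP) => [s x s01 Gx|].
    have s01' : t n <= s < t n.+1 by case/andP: s01 => /ltW -> ->.
    congr (_ * _); apply: eq_bigr => j _.
    by rewrite !mxE partial_phi// partial_psi.
  apply: si; apply: bmeasM; first exact: bsc.
  by apply: bmeas_sum => j; apply: bmeasM; [exact: bdq|exact: bdq'].
rewrite S2E; apply: (slab_integralE d0 trP) => [s x s01 Gx|].
  have s01' : t n <= s < t n.+1 by case/andP: s01 => /ltW -> ->.
  congr (_ * _); last by rewrite /q tpoly_derivS tpolyE.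
  by congr (_ + _); apply: eq_bigr => i _; rewrite uE.
have -> : (fun s x => (rho0 x + \sum_i z i * e * expR (p i x).[s]) * (q x)^`().[s]) =
    (fun s x => rho0 x * (q x)^`().[s] + (\sum_i z i * e * expR (p i x).[s]) * (q x)^`().[s]).
  by apply/funext => s; apply/funext => x; rewrite mulrDl.
apply: (integrable_EFinD (measurable_slab _ _ _)); first exact: irhoq'.
apply: (@si (fun s x => (\sum_i z i * e * expR (p i x).[s]) * (q x)^`().[s])).
apply: bmeasM; last exact: bq'.
by apply: bmeas_sum => i; apply: bmeasM; [exact: bsc|exact: be].
Qed.

Let cE := eps / (2 * boltzmann dat * temperature dat).

Let energy_split (v : 'I_N -> 'rV[R]_d -> R) (a : 'I_d -> 'rV[R]_d -> R) :
  (forall i, (leb R d).-integrable G (fun x => (entropy (v i x))%:E)) ->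
  (forall j, bounded_measurable G (a j)) ->
  \int_G_ x (\sum_i entropy (v i x) + cE * \sum_j a j x * a j x) =
  \sum_i \int_G_ x entropy (v i x) + cE * \sum_j \int_G_ x (a j x ^+ 2).
Proof.
move=> iv ba.
have baa j : bounded_measurable G (fun x => a j x * a j x) by exact: bmeasM.
rewrite RintegralD; [|exact: mG|exact: (integrable_EFin_sum mG)|]; last first.
  by apply: gi; apply: bmeasM; [exact: bmeas_cst|exact: bmeas_sum].
by rewrite Rintegral_sum// Rintegral_dot//.
Qed.

Let energy_after : energy Omega dat t u phi phi0 n = \sum_i X1 i + cE * g1.
Proof.
rewrite /energy (Rintegral_mesh d0 trP) -(energy_split (fun i => gi (bentropy i _)))//.
apply: eq_Rintegral => x; rewrite inE => Gx; congr (_ + _ * _).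
  by apply: eq_bigr => i _; rewrite u_minusE.
by apply: eq_bigr => j _; rewrite !mxE /= partial_phi_minus.
Qed.

Let energy_before : energy Omega dat t u phi phi0 n0 = \sum_i W i + cE * g00.
Proof.
rewrite /energy (Rintegral_mesh d0 trP) -(energy_split ientropyw)//.
apply: eq_Rintegral => x; rewrite inE => Gx; congr (_ + _ * _).
by apply: eq_bigr => j _; rewrite !mxE.
Qed.

Let num_diss2E : num_diss2 Omega dat t phi phi0 n = cE * (g0 - 2 * h + g00).
Proof.
rewrite /num_diss2 (Rintegral_mesh d0 trP).
transitivity (\int_G_ x (cE * \sum_j ((dq j x).[t n] - partial j f0 x) *
    ((dq j x).[t n] - partial j f0 x))).
  apply: eq_Rintegral => x; rewrite inE => Gx; congr (_ * _).
  apply: eq_bigr => j _; rewrite !mxE.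
  suff -> : partial j (fun y => trace_plus (t n) (phi n) y - f0 y) x =
      (dq j x).[t n] - partial j f0 x by [].
  rewrite (partial_eq (g := fun y => (q y).[t n] + (-1) * f0 y) (P := P))//.
    by rewrite (partialDZ _ _ (pwpoly_tpoly _ pcphi) pf0 Gx) partial_q// mulN1r.
  by move=> y Gy; rewrite phi_plusE// mulN1r.
have bdiff j : bounded_measurable G (fun x => (dq j x).[t n] - partial j f0 x).
  by apply: bmeasB; [exact: gdq|exact: gf].
rewrite Rintegral_dot//; congr (_ * _).
rewrite /g0 /h /g00 mulr_sumr -sumrB -big_split; apply: eq_bigr => j _ /=.
have b1 : bounded_measurable G (fun x => (dq j x).[t n] ^+ 2).
  by under eq_fun do rewrite expr2; apply: bmeasM; exact: gdq.
have b2 : bounded_measurable G (fun x => partial j f0 x * (dq j x).[t n]).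
  by apply: bmeasM; [exact: gf|exact: gdq].
have b3 : bounded_measurable G (fun x => partial j f0 x ^+ 2).
  by under eq_fun do rewrite expr2; apply: bmeasM; exact: gf.
have b2' : bounded_measurable G (fun x => 2 * (partial j f0 x * (dq j x).[t n])).
  by apply: bmeasM; [exact: bmeas_cst|].
rewrite -(RintegralZl 2 mG (gi b2)).
rewrite -RintegralB; [|exact: mG|exact: (gi b1)|exact: (gi b2')].
rewrite -RintegralD; [|exact: mG|exact: (gi (bmeasB b1 b2'))|exact: (gi b3)].
by apply: eq_Rintegral => x _; ring.
Qed.

Let dissipationE : dissipation Omega dat t u phi n = \sum_i (K i + kappa i * L i).
Proof.
have bKL i : slab_bmeas P (t n) (t n.+1) (fun s x =>
    (diffusion dat i * expR (p i x).[s] * \sum_j grad_mu i s x j * (dp i j x).[s]) +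
    kappa i * (diffusion dat i * expR (p i x).[s] *
      \sum_j grad_mu i s x j * (dq j x).[s])).
  by apply: bmeasD; [exact: bK|apply: bmeasM; [exact: bsc|exact: bL]].
transitivity (J (fun s x => \sum_i (
    (diffusion dat i * expR (p i x).[s] * \sum_j grad_mu i s x j * (dp i j x).[s]) +
    kappa i * (diffusion dat i * expR (p i x).[s] *
      \sum_j grad_mu i s x j * (dq j x).[s])))).
  apply: (slab_integralE d0 trP) => [s x s01 Gx|]; last by apply: si; exact: bmeas_sum.
  have s01' : t n <= s < t n.+1 by case/andP: s01 => /ltW -> ->.
  apply: eq_bigr => i _; rewrite /conc uE// [in RHS]mulrCA -[in RHS]mulrDr.
  rewrite [X in _ = _ * (_ + X)]mulr_sumr -[in RHS]big_split /=.
  congr (_ * _); apply: eq_bigr => j _; rewrite !mxE.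
  have -> : partial j (chem_pot dat u phi n i s) x = grad_mu i s x j.
    rewrite (partial_eq (g := fun y => (p i y).[s] + kappa i * (q y).[s]) (P := P))//.
      rewrite (partialDZ _ _ (pwpoly_tpoly _ (pcu i)) (pwpoly_tpoly _ pcphi) Gx).
      by rewrite partial_q// (partial_tpoly _ _ (pcu i) Gx).
    by move=> y Gy; rewrite /chem_pot uE// phiE.
  by rewrite /grad_mu; ring.
rewrite slab_integral_sum; last by move=> i; exact: si.
apply: eq_bigr => i _; rewrite slab_integralD; [|exact: (si (bK i))|]; last first.
  by apply: si; apply: bmeasM; [exact: bsc|exact: bL].
by rewrite slab_integralZ//; exact: (si (bL i)).
Qed.

(** Zero on the skeleton, where traces may fail to be measurable. *)
Let xi i := (fun x => exp_mean (p i x).[t n] (w i x)) \_ G.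

Let num_diss1_densityE x : G x -> num_diss1_density dat t u n xi x =
  \sum_i (expR (p i x).[t n] - expR (w i x)
    - expR (w i x) * ((p i x).[t n] - w i x)).
Proof.
move=> Gx; apply: eq_bigr => i _.
by rewrite /xi patchT ?inE// u_plusE// exp_mean_remainder.
Qed.

Let num_diss1E : num_diss1 Omega dat t u n xi = \sum_i Z i.
Proof.
rewrite /num_diss1 (Rintegral_mesh d0 trP) -(Rintegral_sum mG)//.
by apply: eq_Rintegral => x; rewrite inE => Gx; rewrite num_diss1_densityE.
Qed.

Let intermediate_xi : intermediate Omega dat t u n xi.
Proof.
split.
- move=> i; apply: measurable_funTS; apply/(measurable_restrictT _ mG).
  by apply: measurable_exp_mean; [case: (gp i (t n))|exact: mw].
- move=> i; apply: filterS (mesh_interior_ae d0 trP) => x OG /OG Gx.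
  by rewrite /xi patchT ?inE// u_plusE//; exact: exp_mean_between.
- rewrite (integral_mesh d0 trP).
  rewrite (eq_integral (fun x => (\sum_i (expR (p i x).[t n] - expR (w i x)
      - expR (w i x) * ((p i x).[t n] - w i x)))%:E)); last first.
    by move=> x; rewrite inE => Gx; rewrite num_diss1_densityE.
  apply: integrable_lty => //; apply: (integrable_EFin_sum mG) => i; exact: iZi.
Qed.

(** All field terms are expressed through the three tested Poisson equations, in
    which the contributions of the fixed charge cancel. The rest is the identity
    g1 - (g1 - g0) / 2 - h = (g1 - g00) / 2 + (g0 - 2 h + g00) / 2, where the last
    term is the squared jump of the field. *)
Lemma energy_balance : exists2 xi, intermediate Omega dat t u n xi &
  [/\ energy Omega dat t u phi phi0 n - energy Omega dat t u phi phi0 n0 =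
        - dissipation Omega dat t u phi n - num_diss1 Omega dat t u n xi
        - num_diss2 Omega dat t phi phi0 n,
      0 <= dissipation Omega dat t u phi n,
      0 <= num_diss1 Omega dat t u n xi &
      0 <= num_diss2 Omega dat t phi phi0 n].
Proof.
exists xi; first exact: intermediate_xi.
have sqnorm_ge0 (a : 'rV[R]_d) : 0 <= sqnorm a.
  by apply: sumr_ge0 => j _; rewrite -expr2 sqr_ge0.
split; last 3 first.
- apply: Rintegral_ge0 => s _; apply: Rintegral_ge0 => x _; apply: sumr_ge0 => i _.
  by rewrite !mulr_ge0// ?(ltW (D_gt0 i))// /conc expR_ge0.
- apply: Rintegral_ge0 => x _; apply: sumr_ge0 => i _.
  by rewrite mulr_ge0 ?sqr_ge0// mulr_ge0 ?expR_ge0// invr_ge0.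
- apply: Rintegral_ge0 => x _; rewrite mulr_ge0// divr_ge0 ?ltW//.
  by rewrite !mulr_gt0.
rewrite energy_after energy_before dissipationE num_diss1E num_diss2E.
have sX : \sum_i X1 i = \sum_i W i - \sum_i Z i - \sum_i K i.
  rewrite -!sumrB; apply: eq_bigr => i _.
  by have := tested_u i; have := entropy_jump i; lra.
have sL : \sum_i kappa i * L i =
    kT^-1 * (\sum_i z i * e * F i + \sum_i z i * e * Q i - \sum_i z i * e * P1 i).
  rewrite -big_split -sumrB mulr_sumr; apply: eq_bigr => i _ /=.
  have -> : L i = F i + Q i - P1 i by have := tested_phi i; have := by_parts i; lra.
  by rewrite /kappa -/kT /z /e; ring.
have p1 : \sum_i z i * e * P1 i = eps * g1 - r1 by have := poisson1; lra.
have p0 : \sum_i z i * e * Q i = eps * h - r0 by have := poisson0; lra.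
have ps : \sum_i z i * e * F i = eps * ((g1 - g0) / 2) - (r1 - r0).
  by have := poisson_slab; lra.
rewrite big_split /= sX sL p1 p0 ps /cE.
have kN0 := gt_eqF kB_gt0; have TN0 := gt_eqF T_gt0; rewrite /kT.
by field; rewrite kN0 TN0.
Qed.

End energy_balance.

End one_step.

Section all_steps.
Context {R : realType} {d N M : nat}.
Variables (k m : nat) (Omega : set 'rV[R]_d) (P : 'I_M -> 'I_d.+1 -> 'rV[R]_d).
Variables (dat : pnp_data R d N) (t : nat -> R).
Variables (u : nat -> 'I_N -> R -> 'rV[R]_d -> R) (phi : nat -> R -> 'rV[R]_d -> R).
Hypotheses (d0 : (0 < d)%N) (bdO : bounded_domain Omega)
  (trP : conforming_triangulation Omega P).
Hypothesis adm : pnp_admissible Omega dat.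
Hypothesis c0_gt0 : forall i x, Omega x -> 0 < init_density dat i x.
Hypothesis t_incr : forall n, t n.+1 < t n.+2.
Hypothesis sol : scheme_solution Omega P dat k m t u phi.
Local Notation G := (mesh_interior P).

Let mG : measurable G. Proof. exact: measurable_mesh_interior. Qed.
Let GO : G `<=` Omega. Proof. exact: mesh_interior_sub. Qed.
Let iG f : (leb R d).-integrable Omega f -> (leb R d).-integrable G f.
Proof. by move=> fi; apply: integrableS fi => //; exact: measurable_domain bdO. Qed.

Let u_coefficients n : exists cu : 'I_N -> 'I_m.+1 -> 'rV[R]_d -> R,
  (forall i j, fe_space Omega P k (cu i j)) /\
  forall i s x, t n.+1 <= s < t n.+2 -> G x ->
    u n.+1 i s x = \sum_(j < m.+1) cu i j x * s ^+ j.
Proof.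
have [Vu _ _ _] := sol (ltn0Sn n).
have H i := st_space_coefficients bdO (t_incr n) (Vu i).
exists (fun i => s2val (cid2 (H i))); split.
  by move=> i; exact: (s2valP (cid2 (H i))).
by move=> i; exact: (s2valP' (cid2 (H i))).
Qed.

Let phi_coefficients n : exists2 cphi : 'I_m.+1 -> 'rV[R]_d -> R,
  (forall j, fe_space Omega P k (cphi j)) &
  forall s x, t n.+1 <= s < t n.+2 -> G x ->
    phi n.+1 s x = \sum_(j < m.+1) cphi j x * s ^+ j.
Proof.
have [_ Vphi _ _] := sol (ltn0Sn n).
exact: (st_space_coefficients bdO (t_incr n) Vphi).
Qed.

(** The trace left by the preceding slab is piecewise polynomial; at the first
    step it is the logarithm of the initial density, of which only integrability
    is known. *)
Let previous_density n i :
  [/\ measurable_fun G (u_minus dat t u n i),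
      (leb R d).-integrable G (fun x => (expR (u_minus dat t u n i x))%:E) &
      (leb R d).-integrable G
        (fun x => (expR (u_minus dat t u n i x) * u_minus dat t u n i x)%:E)].
Proof.
case: n => [|n] /=.
  have [_ _ ic0 ic0l] := adm.
  have cE x : G x -> expR (ln (init_density dat i x)) = init_density dat i x.
    move=> /GO Ox; rewrite lnK ?posrE//; exact: c0_gt0.
  split.
  - apply: measurableT_comp; first exact: measurable_ln.
    by apply/measurable_EFinP; exact: measurable_int (iG (ic0 i)).
  - apply: eq_integrable (iG (ic0 i)) => // x; rewrite inE => Gx /=.
    by rewrite cE.
  - apply: eq_integrable (iG (ic0l i)) => // x; rewrite inE => Gx /=.
    by rewrite cE.
have [cu [fcu cuE]] := u_coefficients n.
have bw : bounded_measurable G (u_minus dat t u n.+1 i).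
  apply: (@bmeas_eq _ _ _ G _ (fun x => (tpoly (cu i) x).[t n.+2])).
    move=> x Gx; apply: (trace_minus_tpoly (t_incr n)) => s s01.
    by rewrite tpolyE cuE.
  by apply: (bmeas_tpoly bdO trP) => j; exact: pwpoly_fe (fcu i j).
have Goo := mesh_interior_fin bdO trP.
split; first by case: bw.
- by apply: (bmeas_integrable mG Goo); exact: bmeas_expR.
- by apply: (bmeas_integrable mG Goo); apply: bmeasM => //; exact: bmeas_expR.
Qed.

Let previous_potential n phi0 : (n = 0%N -> initial_potential Omega P dat k phi0) ->
  pwpoly P (phi_minus t phi phi0 n) /\
  discrete_poisson Omega P dat k (u_minus dat t u n) (phi_minus t phi phi0 n).
Proof.
case: n => [/(_ erefl)[fphi0 _ dphi0]|n _] /=.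
  by split => //; exact: pwpoly_fe fphi0.
have [_ _ _ [_ _ S3]] := sol (ltn0Sn n); split => //.
have [cphi fcphi cphiE] := phi_coefficients n.
apply: (pwpoly_eq (g := fun x => (tpoly cphi x).[t n.+2])).
  move=> x Gx; apply: (trace_minus_tpoly (t_incr n)) => s s01.
  by rewrite tpolyE cphiE.
by apply: pwpoly_tpoly => j; exact: pwpoly_fe (fcphi j).
Qed.

Lemma step_mass_conservation n i :
  \int[leb R d]_(x in Omega) expR (u_minus dat t u n.+1 i x) =
  \int[leb R d]_(x in Omega) expR (u_minus dat t u n i x).
Proof.
have [_ _ _ [S1 _ _]] := sol (ltn0Sn n).
have [cu [fcu cuE]] := u_coefficients n.
have [cphi fcphi cphiE] := phi_coefficients n.
apply: (mass_conservation d0 bdO trP (t_incr n) fcu fcphi cuE cphiE _ _ S1).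
by move=> l; case: (previous_density n l).
Qed.

Lemma step_energy_balance n phi0 :
  (n = 0%N -> initial_potential Omega P dat k phi0) ->
  exists2 xi, intermediate Omega dat t u n.+1 xi &
    [/\ energy Omega dat t u phi phi0 n.+1 - energy Omega dat t u phi phi0 n =
          - dissipation Omega dat t u phi n.+1 - num_diss1 Omega dat t u n.+1 xi
          - num_diss2 Omega dat t phi phi0 n.+1,
        0 <= dissipation Omega dat t u phi n.+1,
        0 <= num_diss1 Omega dat t u n.+1 xi &
        0 <= num_diss2 Omega dat t phi phi0 n.+1].
Proof.
move=> /previous_potential[pf0 S3'].
have [Vu Vphi _ [S1 S2 S3]] := sol (ltn0Sn n).
have [cu [fcu cuE]] := u_coefficients n.
have [cphi fcphi cphiE] := phi_coefficients n.
have [[D_gt0 _ kB_gt0 T_gt0 eps_gt0] irho0 _ _] := adm.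
apply: (energy_balance d0 bdO trP (t_incr n) fcu fcphi cuE cphiE) => //.
- by move=> i; case: (previous_density n i).
- exact: iG.
- by move=> i; case: (previous_density n i).
- by move=> i; case: (previous_density n i).
Qed.

End all_steps.

Theorem theorem2p2 (R : realType) (d N M k m : nat)
  (Omega : set 'rV[R]_d) (P : 'I_M -> 'I_d.+1 -> 'rV[R]_d)
  (dat : pnp_data R d N) (t dt : nat -> R)
  (u : nat -> 'I_N -> R -> 'rV[R]_d -> R) (phi : nat -> R -> 'rV[R]_d -> R) :
  (1 <= d <= 3)%N -> (1 <= k)%N ->
  bounded_domain Omega -> conforming_triangulation Omega P ->
  pnp_admissible Omega dat ->
  (forall i x, Omega x -> 0 < init_density dat i x) ->
  (forall n, (1 <= n)%N -> 0 < dt n) ->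
  (forall n, (1 <= n)%N -> t n.+1 = t n + dt n) ->
  scheme_solution Omega P dat k m t u phi ->
  forall n, (1 <= n)%N ->
  [/\ forall i, \int[leb R d]_(x in Omega) expR (u_minus dat t u n i x) =
                \int[leb R d]_(x in Omega) expR (u_minus dat t u n.-1 i x),
      forall i s x, t n <= s < t n.+1 -> Omega x -> 0 < conc u n i s x &
      forall phi0, (n = 1%N -> initial_potential Omega P dat k phi0) ->
      exists2 xi, intermediate Omega dat t u n xi &
        [/\ energy Omega dat t u phi phi0 n - energy Omega dat t u phi phi0 n.-1 =
              - dissipation Omega dat t u phi n - num_diss1 Omega dat t u n xi
              - num_diss2 Omega dat t phi phi0 n,
            0 <= dissipation Omega dat t u phi n,
            0 <= num_diss1 Omega dat t u n xi &
            0 <= num_diss2 Omega dat t phi phi0 n]].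
Proof.
move=> /andP[d0 _] _ bdO trP adm c0_gt0 dt_gt0 tE sol [//|n] _.
have t_incr l : t l.+1 < t l.+2 by rewrite (tE l.+1)// ltrDl dt_gt0.
split=> [i|i s x _ _|phi0 Hphi0] /=.
- exact: (step_mass_conservation d0 bdO trP adm c0_gt0 t_incr sol).
- exact: expR_gt0.
- apply: (step_energy_balance d0 bdO trP adm c0_gt0 t_incr sol) => n0.
  by apply: Hphi0; rewrite n0.
Qed.
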